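(* Suppose that the lattice gauge theory on $\mathbb{Z}^d$ with gauge group $G$ and coupling parameter $\beta$ has unbroken center symmetry. Let $\pi$ be a finite-dimensional irreducible unitary representation of $G$ that acts nontrivially on the center of $G$ (i.e. there is an element $g_0$ of the center of $G$ such that $\pi(g_0)$ is not the identity operator), and for a loop $\ell$ let $W_\ell$ denote the Wilson loop variable defined using $\pi$. Then there is a function $V:\mathbb{Z}_+\to\mathbb{R}$ with $V(R)\to\infty$ as $R\to\infty$, such that for any rectangular loop $\ell$ with side-lengths $R\le T$, and for any Gibbs measure of the lattice gauge theory on $\mathbb{Z}^d$, we have $|\langle W_\ell\rangle|\le e^{-V(R)T}$, where $\langle W_\ell\rangle$ is the expected value of $W_\ell$ under the Gibbs measure.
   Context: Fix integers $n\ge 1$, $d\ge 2$, a closed connected subgroup $G$ of $U(n)$, and a coupling parameter $\beta>0$ (the inverse of the squared coupling strength). Configurations and plaquettes. A positively oriented edge of $\mathbb{Z}^d$ is a nearest-neighbor edge directed from its lexicographically smaller endpoint to the larger one; $E$ is the set of these, and $\Omega=G^E$. For $\omega\in\Omega$ and a negatively oriented edge $e$, put $\omega_e:=\omega_{e^{-1}}^{-1}$, where $e^{-1}$ is the reversed edge. A plaquette $p$ is a set of four directed edges forming the boundary of a unit square; traversing them in order as $e_1,e_2,e_3,e_4$, put $\omega_p:=\omega_{e_1}\omega_{e_2}\omega_{e_3}\omega_{e_4}$; $\mathrm{Re}(\mathrm{Tr}(\omega_p))$ does not depend on the starting edge or direction. (Each unit square is counted as one plaquette.) Gibbs measures. The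 lattice gauge theory on $\mathbb{Z}^d$ is the specification with formal Hamiltonian $H(\omega)=-\sum_p \mathrm{Re}(\mathrm{Tr}(\omega_p))$, the sum being over all plaquettes. A Gibbs measure is a probability measure on $\Omega$ such that for every finite set $\Lambda\subset E$, the conditional distribution of $(\omega_e)_{e\in\Lambda}$ given $(\omega_e)_{e\notin\Lambda}$ has density proportional to $\exp(\beta\sum_{p}\mathrm{Re}(\mathrm{Tr}(\omega_p)))$ with respect to product Haar measure on $G^\Lambda$, the sum being over the plaquettes containing at least one edge of $\Lambda$ (up to orientation). Slabs and center symmetry. For $N\ge1$ let $S=\{0,1,\ldots,N\}\times\mathbb{Z}^{d-1}$, with positively oriented edges $E(S)$. The boundary edges $\partial E(S)$ are the edges lying in $\{0\}\times\mathbb{Z}^{d-1}$ or in $\{N\}\times\mathbb{Z}^{d-1}$. A boundary condition is an element $\delta\in G^{\partial E(S)}$, and $\Omega(S,\delta)$ is the set of $\omega\in G^{E(S)}$ agreeing with $\delta$ on $\partial E(S)$. The theory on $S$ with boundary condition $\delta$ is the specification on $\Omega(S,\delta)$ with formal Hamiltonian $-\sum_{p}\mathrm{Re}(\mathrm{Tr}(\omega_p))$ (sum over plaquettes in $S$) and coupling parameter $\beta$; its Gibbs measures are the probability measures on $\Omega(S,\delta)$ having the corresponding conditional distributions for every finite set of non-boundary edges. For $g_0$ in the center of $G$, the center transform $\tau:\Omega(S,\delta)\to\Omega(S,\delta)$ replaces $\omega_e$ by $g_0\omega_e$ for each edge $e$ from $\{0\}\times\mathbb{Z}^{d-1}$ to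 $\{1\}\times\mathbb{Z}^{d-1}$ and leaves all other $\omega_e$ unchanged. The theory on $S$ with boundary condition $\delta$ has unbroken center symmetry if every one of its Gibbs measures is invariant under every center transform. The lattice gauge theory on $\mathbb{Z}^d$ has unbroken center symmetry if for some $N\ge1$, the theory on $S=\{0,\ldots,N\}\times\mathbb{Z}^{d-1}$ has unbroken center symmetry under every boundary condition $\delta$. Wilson loops. A loop $\ell$ is a sequence of directed edges $e_1,\ldots,e_k$ such that the end vertex of each $e_i$ is the beginning vertex of $e_{i+1}$ and the end vertex of $e_k$ is the beginning vertex of $e_1$. The Wilson loop variable is $W_\ell(\omega)=\mathrm{Tr}(\pi(\omega_{e_1})\pi(\omega_{e_2})\cdots\pi(\omega_{e_k}))$. A loop is rectangular if it forms the boundary of a (lattice) rectangle. $\mathbb{Z}_+$ is the set of positive integers. *)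

(* Defs.v *)
From HB Require Import structures.
From mathcomp Require Import all_boot all_order all_algebra.
From mathcomp Require Import spectral monoid.
From mathcomp Require Import all_classical all_reals all_analysis.
From mathcomp.real_closed Require Import complex.

Set Implicit Arguments.
Unset Strict Implicit.
Unset Printing Implicit Defensive.

Import Order.TTheory GRing.Theory Num.Theory.
Import numFieldNormedType.Exports.

Local Open Scope classical_set_scope.
Local Open Scope ring_scope.

(* The topology of R[i] is the one given by the complex modulus; it induces
   the usual topology on complex matrices. *)
HB.instance Definition _ (R : rcfType) := NormedModule.copy R[i] R[i]^o.

Record gaugeGroup (R : realType) (n : nat) := GaugeGroup {
  gg_set : set 'M[R[i]]_n ;
  gg_unitary : forall A, gg_set A -> A \is unitarymx ;
  gg_one : gg_set 1%:M ;
  gg_mul : forall A B, gg_set A -> gg_set B -> gg_set (A *m B) ;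
  gg_inv : forall A, gg_set A -> gg_set (invmx A) ;
  gg_closed : closed gg_set ;
  gg_connected : connected gg_set }.

Definition gauge_elt (R : realType) (n : nat) (G : gaugeGroup R n) : Type :=
  set_type (gg_set G).
Coercion gauge_elt : gaugeGroup >-> Sortclass.

Section gauge_elt.
Variables (R : realType) (n : nat) (G : gaugeGroup R n).

HB.instance Definition _ := SubType.on (gauge_elt G).
HB.instance Definition _ := Choice.on (gauge_elt G).
HB.instance Definition _ := Topological.copy (gauge_elt G) (set_type (gg_set G)).

Let gelt1 : G := SigSub (mem_set (gg_one G)).
Let geltM (x y : G) : G :=
  SigSub (mem_set (gg_mul (set_mem (valP x)) (set_mem (valP y)))).
Let geltV (x : G) : G := SigSub (mem_set (gg_inv (set_mem (valP x)))).

Let gelt_unit (x : G) : \val x \in unitmx.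
Proof. exact: unitarymx_unit (gg_unitary (set_mem (valP x))). Qed.

Let geltA : associative geltM.
Proof. by move=> x y z; apply: val_inj; exact: mulmxA. Qed.
Let gelt1M : left_id gelt1 geltM.
Proof. by move=> x; apply: val_inj; exact: mul1mx. Qed.
Let geltM1 : right_id gelt1 geltM.
Proof. by move=> x; apply: val_inj; exact: mulmx1. Qed.
Let geltVM : left_inverse gelt1 geltV geltM.
Proof. by move=> x; apply: val_inj; exact: mulVmx. Qed.
Let geltMV : right_inverse gelt1 geltV geltM.
Proof. by move=> x; apply: val_inj; exact: mulmxV. Qed.

HB.instance Definition _ := isPointed.Build (gauge_elt G) gelt1.
HB.instance Definition _ :=
  isGroup.Build (gauge_elt G) geltA gelt1M geltM1 geltVM geltMV.

HB.instance Definition _ :=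
  Measurable.copy (gauge_elt G) (g_sigma_algebraType (@open (gauge_elt G))).

Definition central (g0 : G) := forall g : G, (g0 * g = g * g0)%g.

End gauge_elt.

(* As G is compact, its normalized Haar measure is the only left-invariant
   Borel probability measure. *)
Definition is_haar (R : realType) (n : nat) (G : gaugeGroup R n)
    (nu : probability G R) :=
  forall (g : G) (A : set G), measurable A ->
    nu ((fun h : G => (g * h)%g) @^-1` A) = nu A.

Section product_probability.
Context d (T : measurableType d) (R : realType) (P : probability T R).

Definition tuple_cons k (p : T * k.-tuple T) : k.+1.-tuple T :=
  [the k.+1.-tuple T of p.1 :: p.2].

Let measurable_tuple_cons k : measurable_fun setT (@tuple_cons k).
Proof. exact: measurable_cons measurable_fst measurable_snd. Qed.

HB.instance Definition _ k :=
  isMeasurableFun.Build _ _ _ _ (@tuple_cons k) (@measurable_tuple_cons k).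

Fixpoint tuple_probability k : probability (k.-tuple T) R :=
  if k is k'.+1 then
    distribution (P \x tuple_probability k')%E (@tuple_cons k')
  else \d_([tuple] : 0.-tuple T).

End product_probability.

Section lattice.
Variable d : nat.

Definition site : Type := 'rV[int]_d.

Definition step (i : 'I_d) : site := delta_mx ord0 i.

(* (x, i) is the positively oriented edge from x to x + step i: these are the
   nearest-neighbor pairs directed from the lexicographically smaller endpoint
   to the larger one. *)
Definition edge : Type := (site * 'I_d)%type.

Definition src (e : edge) : site := e.1.
Definition tgt (e : edge) : site := e.1 + step e.2.

(* (e, false) is e and (e, true) is e reversed. *)
Definition dedge : Type := (edge * bool)%type.

Definition dsrc (a : dedge) : site := if a.2 then tgt a.1 else src a.1.
Definition dtgt (a : dedge) : site := if a.2 then src a.1 else tgt a.1.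

(* The unit square with lowest corner x in the directions i < j, so that each
   square occurs exactly once. *)
Definition plaquette : Type :=
  {p : site * 'I_d * 'I_d | (p.1.2 < p.2)%N}.

Definition plaquette_path (p : plaquette) : seq dedge :=
  let: (x, i, j) := \val p in
  [:: ((x, i), false); ((x + step i, j), false);
      ((x + step j, i), true); ((x, j), true)].

Definition plaquette_edges (p : plaquette) : seq edge :=
  [seq a.1 | a <- plaquette_path p].

Definition is_loop (l : seq dedge) := cycle (fun a b => dtgt a == dsrc b) l.

(* The boundary of the rectangle with corner x, traversed r steps along i and
   then t steps along j. *)
Definition rectangle_path (x : site) (i j : 'I_d) (r t : nat) : seq dedge :=
  [seq ((x + step i *+ k, i), false) | k <- iota 0 r] ++
  [seq ((x + step i *+ r + step j *+ k, j), false) | k <- iota 0 t] ++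
  rev [seq ((x + step j *+ t + step i *+ k, i), true) | k <- iota 0 r] ++
  rev [seq ((x + step j *+ k, j), true) | k <- iota 0 t].

(* The two paths are the two orientations, rot gives the starting edge. *)
Definition rectangular_loop (l : seq dedge) (r t : nat) :=
  is_loop l /\
  exists (x : site) (i j : 'I_d) (k : nat), i != j /\
    (l = rot k (rectangle_path x i j r t) \/
     l = rot k (rectangle_path x j i t r)).

Definition layer (k : nat) : set site :=
  [set x : site | forall i : 'I_d, i = 0%N :> nat -> x ord0 i = k%:Z].

Definition slab (N : nat) : set site :=
  [set x | exists2 k, (k <= N)%N & layer k x].

Definition slab_edges (N : nat) : set edge :=
  [set e | slab N (src e) /\ slab N (tgt e)].

Definition slab_boundary (N : nat) : set edge :=
  [set e | (layer 0 (src e) /\ layer 0 (tgt e)) \/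
           (layer N (src e) /\ layer N (tgt e))].

End lattice.

HB.instance Definition _ d := Choice.on (site d).
HB.instance Definition _ d := Choice.on (edge d).
HB.instance Definition _ d := Choice.on (dedge d).
HB.instance Definition _ d := Choice.on (plaquette d).

Definition config (R : realType) (n : nat) (G : gaugeGroup R n) (d : nat)
    (D : set (edge d)) : Type := set_type D -> G.

Section config.
Variables (R : realType) (n : nat) (G : gaugeGroup R n).
Variables (d : nat) (D : set (edge d)).

HB.instance Definition _ := Pointed.copy (config G D) (set_type D -> G).

Definition coordinate_sets (F : set (set_type D)) : set (set (config G D)) :=
  \bigcup_(e in F)
    preimage_set_system setT (fun w : config G D => w e) measurable.

HB.instance Definition _ := Measurable.copy (config G D)
  (g_sigma_algebraType (coordinate_sets setT)).

(* Edges outside D get the value 1; this value plays no role, since only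
   loops and plaquettes lying in D are evaluated. *)
Definition edge_value (w : config G D) (e : edge d) : G :=
  oapp w 1%g (insub e).

Definition dedge_value (w : config G D) (a : dedge d) : G :=
  if a.2 then ((edge_value w a.1)^-1)%g else edge_value w a.1.

Definition holonomy (w : config G D) (l : seq (dedge d)) : G :=
  \big[*%g/1%g]_(a <- l) dedge_value w a.

Definition Re_tr_plaquette (w : config G D) (p : plaquette d) : R :=
  complex.Re (\tr (\val (holonomy w (plaquette_path p)))).

Definition touching (s : seq (set_type D)) : set (plaquette d) :=
  [set p | (forall e, e \in plaquette_edges p -> D e) /\
           (exists2 e : set_type D, e \in s & \val e \in plaquette_edges p)].

(* The k-th edge of s gets the value eta_k, the edges outside s are as in w
   (there index e s = size s, hence nth returns its default). *)
Definition glue (s : seq (set_type D)) (w : config G D)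
    (eta : (size s).-tuple G) : config G D :=
  fun e => nth (w e) eta (index e s).

Variables (haar : probability G R) (beta : R).

Definition gibbs_weight (s : seq (set_type D)) (w : config G D)
    (eta : (size s).-tuple G) : R :=
  expR (beta * \sum_(p \in touching s) Re_tr_plaquette (glue w eta) p).

Definition gibbs_kernel (s : seq (set_type D)) (w : config G D)
    (A : set ((size s).-tuple G)) : R :=
  (\int[tuple_probability haar (size s)]_(eta in A) gibbs_weight w eta) /
  (\int[tuple_probability haar (size s)]_eta gibbs_weight w eta).

(* For every finite set of edges in F, enumerated by s, gibbs_kernel is the
   conditional distribution of (w_e)_(e in s) given (w_e)_(e notin s). *)
Definition specified (F : set (edge d)) (mu : probability (config G D) R) :=
  forall s : seq (set_type D), uniq s -> (forall e, e \in s -> F (\val e)) ->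
  forall A : set ((size s).-tuple G), measurable A ->
  forall B : set (config G D), <<s coordinate_sets [set e | e \notin s] >> B ->
    mu (B `&` [set w | A (map_tuple w (in_tuple s))]) =
    (\int[mu]_(w in B) (gibbs_kernel w A)%:E)%E.

End config.

Section gibbs_measures.
Variables (R : realType) (n : nat) (G : gaugeGroup R n) (d : nat).
Variables (haar : probability G R) (beta : R).

Definition gibbs_measure (mu : probability (config G [set: edge d]) R) :=
  specified haar beta setT mu.

Definition slab_config (N : nat) (delta : set_type (@slab_boundary d N) -> G) :
    set (config G (@slab_edges d N)) :=
  [set w | forall e f, \val e = \val f -> w e = delta f].

Definition slab_gibbs_measure (N : nat)
    (delta : set_type (@slab_boundary d N) -> G)
    (mu : probability (config G (@slab_edges d N)) R) :=
  mu (slab_config delta) = 1%E /\ specified haar beta (~` slab_boundary N) mu.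

Definition center_transform (N : nat) (g0 : G)
    (w : config G (@slab_edges d N)) : config G (@slab_edges d N) :=
  fun e => if `[< layer 0 (src (\val e)) /\ layer 1 (tgt (\val e)) >]
           then (g0 * w e)%g else w e.

Definition slab_unbroken_center_symmetry (N : nat)
    (delta : set_type (@slab_boundary d N) -> G) :=
  forall mu, slab_gibbs_measure delta mu ->
  forall g0 : G, central g0 ->
  forall A, measurable A -> pushforward mu (center_transform g0) A = mu A.

Definition unbroken_center_symmetry :=
  exists2 N : nat, (0 < N)%N &
    forall delta : set_type (@slab_boundary d N) -> G,
      slab_unbroken_center_symmetry delta.

End gibbs_measures.

Arguments unbroken_center_symmetry {R n G} d haar beta.

Record irreducible_unitary_representation (R : realType) (n : nat)
    (G : gaugeGroup R n) (m : nat) (rho : G -> 'M[R[i]]_m) : Prop := {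
  rep_continuous : continuous rho ;
  rep_unitary : forall g, rho g \is unitarymx ;
  rep_mul : forall g h, rho (g * h)%g = rho g *m rho h ;
  rep_nonzero : (0 < m)%N ;
  rep_irreducible : forall U : {vspace 'cV[R[i]]_m},
    (forall g v, v \in U -> rho g *m v \in U) -> U = 0%VS \/ U = fullv }.

Section wilson.
Variables (R : realType) (n : nat) (G : gaugeGroup R n) (d m : nat).
Variable rho : G -> 'M[R[i]]_m.

Definition wilson_loop (l : seq (dedge d)) (w : config G [set: edge d]) :
    R[i] :=
  \tr (\big[mulmx/1%:M]_(a <- l) rho (dedge_value w a)).

Definition wilson_expectation (mu : probability (config G [set: edge d]) R)
    (l : seq (dedge d)) : R[i] :=
  Complex (\int[mu]_w complex.Re (wilson_loop l w))
          (\int[mu]_w complex.Im (wilson_loop l w)).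

End wilson.

(* Main.v *)
(* On a slab with unbroken center symmetry the expectation A of rho along a
   straight path crossing the slab satisfies rho g0 *m A = A in every Gibbs
   measure; as rho is irreducible and g0 central, A = 0. By compactness the
   expectation given the configuration outside a large finite set s of interior
   edges of the slab is then below eps in modulus, uniformly in that
   configuration. Here compactness is an ultraproduct of the finite-volume
   measures: its Loeb measure, pushed forward by the standard part map, is a
   Gibbs measure.

   Cut the long side of an R x T loop into T / N crossings of parallel slabs.
   If R exceeds the extent of s, the copies of s in these slabs avoid each
   other and the rest of the loop, so integrating them out one at a time
   replaces each crossing by a matrix with entries at most 2 eps. This gives
   2 m (2 m eps) ^ (T / N), and eps is arbitrary as R grows. *)
From HB Require Import structures.
Require Import Defs.
From mathcomp Require Import all_boot all_order all_algebra.
From mathcomp Require Import perm spectral monoid finmap zify ring lra.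
From mathcomp Require Import all_classical all_reals all_analysis measurable_realfun.
From mathcomp.real_closed Require Import complex.

Set Implicit Arguments.
Unset Strict Implicit.
Unset Printing Implicit Defensive.

Import Order.TTheory GRing.Theory Num.Theory.
Import numFieldNormedType.Exports.
Import HBNNSimple.

Local Open Scope classical_set_scope.
Local Open Scope ring_scope.

(** * Loeb measures *)

(** The boundary condition may vary with the volume, so the limit must keep track of it. The
    standard part map sends every sequence to a configuration carrying the ultralimit of the
    boundary conditions, and center symmetry is used for that single condition. The limit is Gibbs
    because finite-volume operators are consistent and preserve bounded continuous functions.

    These operators act on nonnegative functions, where Tonelli and monotone convergence apply
    freely; signed quantities are shifted by constants.

    Consecutive slabs share a boundary layer. This is harmless: an interior edge of one slab lies in
    no other slab, and the sides of the loop transversal to the stack lie at or beyond its end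
    layers. The average that replaces a crossing depends only on its own slab, so it is unaffected
    when the other slabs are integrated.

    For T >= N the number of slabs is at least T / (2 N), so eps = exp (- 2 N (A + 2 m)) / (2 m)
    absorbs the prefactor 2 m and yields the rate A for all large R. V(R) is the largest A <= R
    whose threshold is at most R, and - 2 m if there is none. *)

Section ultrafilter.
Variable (U : set_system nat).
Hypothesis UU : UltraFilter U.

Lemma ultra_fmap (T : Type) (u : nat -> T) : UltraFilter (u L @[L --> U]).
Proof.
split=> [|G GF uG]; first exact: fmap_proper_filter.
rewrite eqEsubset; split => // A GA.
have [//|nA] := in_ultra_setVsetC (u @^-1` A) UU.
have : G (~` A) by apply: uG.
by move=> cA; have [x []] := filter_ex (filterI GA cA).
Qed.

Lemma ultra_bounded_cvg (R : realType) (a b : R) (u : nat -> R) :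
  (forall L, a <= u L <= b) ->
  exists2 l, a <= l <= b & u L @[L --> U] --> l.
Proof.
move=> ab; have := @segment_compact R a b; rewrite compact_ultra.
move=> /(_ _ (ultra_fmap u)) [|l [/= lab ul]].
  by apply: (@filterE _ U) => L; rewrite /= in_itv/=.
by rewrite in_itv/= in lab; exists l.
Qed.

Lemma ultra_not (A : set nat) : ~ U A <-> U (~` A).
Proof.
split=> [nA|cA Aa]; first by have [|] := in_ultra_setVsetC A UU.
by have [x []] := filter_ex (filterI Aa cA).
Qed.

Lemma ultra_or (A B : set nat) : U (A `|` B) -> U A \/ U B.
Proof.
move=> AB; have [?|cA] := in_ultra_setVsetC A UU; first by left.
by right; apply: filterS2 AB cA => x [].
Qed.

End ultrafilter.

(** * Integration of nonnegative and of bounded functions *)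

Section nonneg_induction.
Context d (T : measurableType d) (R : realType).
Local Open Scope ereal_scope.

(** Simple functions approximate [f] from below, and each is a finite sum of nonnegative multiples
    of indicators. Identities between integrals and Gibbs operators are extended from indicators in
    this way. *)
Lemma ge0_measurable_ind (Pr : (T -> \bar R) -> Prop) :
  (forall A, measurable A -> Pr (fun x => (\1_A x)%:E)) ->
  (forall (f : T -> \bar R) (k : R), (0 <= k)%R -> measurable_fun setT f ->
     (forall x, 0 <= f x) -> Pr f -> Pr (fun x => k%:E * f x)) ->
  (forall f g : T -> \bar R, measurable_fun setT f -> (forall x, 0 <= f x) ->
     measurable_fun setT g -> (forall x, 0 <= g x) -> Pr f -> Pr g ->
     Pr (fun x => f x + g x)) ->
  (forall (f_ : nat -> T -> \bar R) (f : T -> \bar R),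
     (forall n, measurable_fun setT (f_ n)) -> (forall n x, 0 <= f_ n x) ->
     (forall x, nondecreasing_seq (f_^~ x)) ->
     (forall x, f_ n x @[n --> \oo] --> f x) ->
     (forall n, Pr (f_ n)) -> Pr f) ->
  forall f : T -> \bar R, measurable_fun setT f -> (forall x, 0 <= f x) -> Pr f.
Proof.
move=> Pind Pscale Padd Plim f mf f0.
pose f_ := nnsfun_approx measurableT mf.
apply: (Plim (fun n x => (f_ n x)%:E)) => [n|n x|x m n mn|x|n].
- exact/measurable_EFinP/measurable_funTS.
- by rewrite lee_fin.
- by rewrite lee_fin; exact/lefP/nd_nnsfun_approx.
- exact: cvg_nnsfun_approx.
rewrite (_ : (fun x => _) = fun x =>
  \sum_(y <- enum_fset (fset_set (range (f_ n)))) (y * \1_(f_ n @^-1` [set y]) x)%:E); last first.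
  by apply/funext => x; rewrite {1}fimfunE fsbig_finite//= sumEFin.
have : all (fun y => 0 <= y)%R (enum_fset (fset_set (range (f_ n)))).
  by apply/allP => y; rewrite in_fset_set// inE => -[x _ <-].
have P0 : Pr (fun=> 0%E).
  have := Pind _ (@measurable0 _ T); congr Pr; apply/funext => x.
  by rewrite indicE in_set0.
(* [Padd] asks for measurable nonnegative summands, so the induction on the list of values carries
   both along with [Pr]. *)
suff : forall s : seq R, all (fun y => 0 <= y)%R s ->
   [/\ Pr (fun x => \sum_(y <- s) (y * \1_(f_ n @^-1` [set y]) x)%:E),
    measurable_fun setT (fun x => \sum_(y <- s) (y * \1_(f_ n @^-1` [set y]) x)%:E)
    & forall x, 0 <= \sum_(y <- s) (y * \1_(f_ n @^-1` [set y]) x)%:E].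
  by move=> H /H[].
elim=> [_|y s IH /= /andP[y0 /IH[IH1 IH2 IH3]]].
  split; first by under eq_fun do rewrite big_nil.
  - under eq_fun do rewrite big_nil.
    exact: measurable_cst.
  - by move=> x; rewrite big_nil.
have my : measurable (f_ n @^-1` [set y]) by exact: measurable_funPTI.
have mi : measurable_fun setT (fun x => (\1_(f_ n @^-1` [set y]) x)%:E : \bar R).
  by apply/measurable_EFinP.
split.
- under eq_fun do rewrite big_cons EFinM.
  apply: Padd => //.
  + exact: measurable_funeM.
  + by move=> x; rewrite mule_ge0// lee_fin.
  + by apply: Pscale => //; exact: Pind.
- under eq_fun do rewrite big_cons EFinM.
  apply: emeasurable_funD => //; exact: measurable_funeM.
- by move=> x; rewrite big_cons adde_ge0// lee_fin mulr_ge0.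
Qed.

End nonneg_induction.

Section bounded_Rintegral.
Context d (T : measurableType d) (R : realType) (P : probability T R).
Implicit Types f g : T -> R.

Lemma bounded_integrable f (M : R) : measurable_fun setT f ->
  (forall x, `|f x| <= M) -> P.-integrable setT (EFin \o f).
Proof.
move=> mf fM; apply: (@le_integrable _ _ _ _ _ measurableT _ (cst M%:E)) => //.
- exact/measurable_EFinP.
- by move=> x _ /=; rewrite lee_fin (le_trans (fM x))// ler_norm.
- exact: finite_measure_integrable_cst.
Qed.

Lemma Rintegral_probability_cst (c : R) : \int[P]_x c = c.
Proof. by rewrite Rintegral_cst// (congr1 fine (@probability_setT _ _ _ P)) mulr1. Qed.

Lemma Rintegral_sum_indic (c : R) (K : nat) (A : nat -> set T) : 0 <= c ->
  (forall k, measurable (A k)) ->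
  \int[P]_x (c * \sum_(k < K) \1_(A k) x) = c * \sum_(k < K) fine (P (A k)).
Proof.
move=> c0 mA; elim: K => [|K IH].
  under eq_Rintegral do rewrite big_ord0 mulr0.
  by rewrite big_ord0 mulr0 Rintegral_probability_cst.
have mi k : measurable_fun setT (\1_(A k) : T -> R) by exact: measurable_indic.
have bi k x : `|\1_(A k) x : R| <= 1.
  by rewrite indicE; case: (_ \in _); rewrite ?normr0 ?normr1.
have ms : measurable_fun setT (fun x => c * \sum_(k < K) \1_(A k) x : R).
  by apply: measurable_funM => //; apply: measurable_sum => k.
have bs x : `|c * \sum_(k < K) \1_(A k) x| <= c * K%:R.
  rewrite normrM (ger0_norm c0) ler_wpM2l// (le_trans (ler_norm_sum _ _ _))//.
  by rewrite -[leRHS]mulr1 mulr_natl -[in leRHS](card_ord K) -sumr_const ler_sum.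
under eq_Rintegral do rewrite big_ord_recr/= mulrDr.
rewrite RintegralD//; last 2 first.
- exact: bounded_integrable bs.
- apply: (@bounded_integrable _ c).
    by apply: measurable_funM.
  by move=> x; rewrite normrM (ger0_norm c0) -[leRHS]mulr1 ler_wpM2l.
rewrite IH big_ord_recr/= mulrDr; congr (_ + _).
rewrite RintegralZl//; last exact: bounded_integrable (bi K).
by congr (c * _); rewrite /Rintegral (integral_indic _ measurableT)// setIT.
Qed.

End bounded_Rintegral.

Section level_sum.
Variables (R : realType) (c : R).
Hypothesis c0 : 0 < c.
Variable x : R.

(** The sum counts the positive multiples of [c] below [x], up to [c *+ K]. It gives a staircase
    within [c] below [x] whose steps are superlevel sets; on an ultraproduct these are internal. *)
Lemma level_sum_le (K : nat) : 0 <= x ->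
  c * \sum_(k < K) (c *+ k.+1 < x)%R%:R <= x.
Proof.
move=> x0; elim: K => [|K IH]; first by rewrite big_ord0 mulr0.
have [cx|xc] := ltP (c *+ K.+1) x; last first.
  by rewrite big_ord_recr/= ltNge xc addr0.
rewrite (le_trans _ (ltW cx))// -mulr_natr ler_pM2l//.
rewrite -[in leRHS](card_ord K.+1) -sumr_const ler_sum// => i _.
by case: (_ < _).
Qed.

Lemma le_level_sum (K : nat) : x <= c *+ K ->
  x <= c * (\sum_(k < K) (c *+ k.+1 < x)%R%:R) + c.
Proof.
elim: K => [|K IH].
  by rewrite mulr0n big_ord0 mulr0 add0r => /le_trans; apply; exact: ltW.
rewrite big_ord_recr/=; have [/IH xK _|Kx xK] := leP x (c *+ K).
  by rewrite (le_trans xK)// lerD2r ler_pM2l// lerDl.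
apply: (le_trans xK); have {1}-> : c *+ K.+1 = c * K%:R + c.
  by rewrite mulr_natr mulrSr.
rewrite lerD2r ler_pM2l//.
rewrite ler_wpDr//.
rewrite -[in leLHS](card_ord K) -sumr_const ler_sum// => i _.
by rewrite (le_lt_trans _ Kx)// ler_wpMn2l// ltW.
Qed.

End level_sum.

(** * Internal sets and the Loeb measure of an ultraproduct *)

Section ultraproduct_measure.
Context d (T : measurableType d) (R : realType).
Variables (Q : nat -> probability T R) (U : set_system nat).
Hypotheses (UU : UltraFilter U) (Uoo : \oo `<=` U).

(* The idle UU makes the type depend on U, as do the structures put on it. *)
Definition ultraproduct : Type := let _ := UU in nat -> T.

HB.instance Definition _ := Pointed.copy ultraproduct (nat -> T).

(** The internal sets of nonstandard analysis, as sets of sequences. Sequences that agree on a set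
    in [U] are not identified, but no internal set separates them. *)
Definition internal (A : nat -> set T) : set ultraproduct :=
  [set y | U [set L | A L (y L)]].

Definition is_internal : set (set ultraproduct) :=
  [set B | exists2 A, (forall L, measurable (A L)) & B = internal A].

Lemma internalC A : ~` internal A = internal (fun L => ~` A L).
Proof. by rewrite eqEsubset; split=> y /=; rewrite ultra_not. Qed.

Lemma internalU A B : internal A `|` internal B = internal (fun L => A L `|` B L).
Proof.
rewrite eqEsubset; split=> y /=; last exact: ultra_or.
by case; apply: filterS => L; [left|right].
Qed.

Lemma internalI A B : internal A `&` internal B = internal (fun L => A L `&` B L).
Proof.
rewrite eqEsubset; split=> y /=; first by case; exact: filterI.
by move=> H; split; apply: filterS H => L [].
Qed.

Lemma internal0 : internal (fun=> set0) = set0.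
Proof. by rewrite eqEsubset; split=> y //= H; have [] := filter_ex H. Qed.

Lemma is_internal0 : is_internal set0.
Proof. by exists (fun=> set0) => //; rewrite internal0. Qed.

Lemma is_internalC : setC_closed is_internal.
Proof.
move=> _ [A mA ->]; exists (fun L => ~` A L); last exact: internalC.
by move=> L; exact: measurableC.
Qed.

Lemma is_internalU : setU_closed is_internal.
Proof.
move=> _ _ [A mA ->] [B mB ->]; exists (fun L => A L `|` B L).
  by move=> L; exact: measurableU.
exact: internalU.
Qed.

HB.instance Definition _ := isAlgebraOfSets.Build default_measure_display
  ultraproduct is_internal0 is_internalU is_internalC.

Lemma internal_measurable A : (forall L, measurable (A L)) ->
  measurable (internal A).
Proof. by move=> mA; exists A. Qed.

(** If [A L] and [B L] differ for [U]-most [L], a sequence of points in the symmetric differences is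
    [U]-mostly on one fixed side, hence in exactly one of the two internal sets. So the limit
    defining [ultra_content] does not depend on the representative. *)
Lemma internal_inj A B : internal A = internal B -> U [set L | A L = B L].
Proof.
move=> AB; have [//|nAB] := in_ultra_setVsetC [set L | A L = B L] UU.
have /choice[y Hy] : forall L, exists y : T, A L <> B L ->
    (A L y /\ ~ B L y) \/ (B L y /\ ~ A L y).
  move=> L; have [AL|nAL] := pselect (A L = B L); first by exists point.
  have [[y H]|H] := pselect (exists y, (A L y /\ ~ B L y) \/ (B L y /\ ~ A L y)).
    by exists y.
  exfalso; apply: nAL; rewrite eqEsubset; split=> y Ay; apply: contrapT => nBy;
    by apply: H; exists y; tauto.
have : U [set L | A L (y L) /\ ~ B L (y L)] \/ U [set L | B L (y L) /\ ~ A L (y L)].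
  by apply: ultra_or; apply: filterS nAB => L /= /Hy[]; [left|right].
case=> H.
  have Ay : internal A y by apply: filterS H => L [].
  by rewrite AB in Ay; have [L [[_ ?] ?]] := filter_ex (filterI H Ay).
have By : internal B y by apply: filterS H => L [].
by rewrite -AB in By; have [L [[_ ?] ?]] := filter_ex (filterI H By).
Qed.

(** Countable saturation by diagonalization: [y L] is taken in the last nonempty [A n L] with
    [n <= L]. For fixed [n], the condition [n <= L] fails for finitely many [L] only, which [U]
    ignores. *)
Lemma internal_saturated (A : nat -> nat -> set T) :
  (forall n L, A n.+1 L `<=` A n L) -> (forall n, internal (A n) !=set0) ->
  \bigcap_n internal (A n) !=set0.
Proof.
move=> Adec Ane.
have Amon m n L : (m <= n)%N -> A n L `<=` A m L.
  move=> /subnK <-; elim: (n - m)%N => [|k IH]; first by rewrite add0n.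
  by apply: subset_trans IH; rewrite addSn; exact: Adec.
have /choice[y Hy] : forall L, exists y : T, forall n, (n <= L)%N ->
    A n L !=set0 -> A n L y.
  move=> L; suff : forall k, exists y : T, forall n, (n <= k)%N ->
    A n L !=set0 -> A n L y by exact.
  elim=> [|k [y IH]].
    have [[y Ay]|nA] := pselect (A 0%N L !=set0).
      by exists y => n; rewrite leqn0 => /eqP ->.
    by exists point => n; rewrite leqn0 => /eqP ->.
  have [[z Az]|nA] := pselect (A k.+1 L !=set0).
    by exists z => n nk _; exact: Amon Az.
  by exists y => n; rewrite leq_eqVlt => /orP[/eqP ->//|]; exact: IH.
exists y => n _; have [z zA] := Ane n.
have nL : U [set L | (n <= L)%N] by apply: Uoo; exact: nbhs_infty_ge.
by apply: filterS2 nL zA => L /= nL zA; apply: Hy => //; exists (z L).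
Qed.

Definition internal_repr (B : set ultraproduct) : nat -> set T :=
  xget (fun=> set0) [set A | (forall L, measurable (A L)) /\ B = internal A].

Lemma internal_repr_measurable B L : measurable (internal_repr B L).
Proof. by rewrite /internal_repr; case: xgetP => [A -> []|_]. Qed.

Lemma internal_reprK B : measurable B -> internal (internal_repr B) = B.
Proof.
by move=> [A mA BA]; rewrite /internal_repr; case: xgetP => [C -> [] //|/(_ A) []].
Qed.

Definition ultra_content (B : set ultraproduct) : \bar R :=
  (lim (fine (Q L (internal_repr B L)) @[L --> U]))%:E.

Let Q01 (A : set T) L : measurable A -> 0 <= fine (Q L A) <= 1.
Proof.
move=> mA; rewrite fine_ge0//= -lee_fin fineK ?fin_num_measure//.
exact: probability_le1.
Qed.

Lemma ultra_content_internal A : (forall L, measurable (A L)) ->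
  fine (Q L (A L)) @[L --> U] --> fine (ultra_content (internal A)).
Proof.
move=> mA; have mB : measurable (internal A) by exists A.
have := internal_inj (internal_reprK mB); rewrite /ultra_content/=.
set B := internal_repr _ => AB.
have [l _ Al] := ultra_bounded_cvg UU (fun L => Q01 L (mA L)).
have Bl : fine (Q L (B L)) @[L --> U] --> l.
  by apply: cvg_trans Al; apply: near_eq_cvg; apply: filterS AB => L /= ->.
by rewrite (cvg_lim _ Bl).
Qed.

Lemma ultra_content_ge0 B : (0 <= ultra_content B)%E.
Proof.
rewrite lee_fin; have [l l01 Al] := ultra_bounded_cvg UU
  (fun L => Q01 L (internal_repr_measurable B L)).
by rewrite (cvg_lim _ Al)//; case/andP: l01.
Qed.

Lemma ultra_content0 : ultra_content set0 = 0%E.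
Proof.
have := @ultra_content_internal (fun=> set0) (fun=> measurable0).
rewrite internal0 => H; rewrite -[LHS]fineK//; congr EFin.
apply: (cvg_unique _ H) => //.
by apply: cvg_near_cst; apply: filterE => L; rewrite measure0.
Qed.

Lemma ultra_content_additive : measure_function.semi_additive ultra_content.
Proof.
apply/(additive2P ultra_content0) => _ _ [A mA ->] [B mB ->] AB0.
have mAB L : measurable (A L `|` B L) by exact: measurableU.
have := @ultra_content_internal _ mAB; rewrite -internalU => cAB.
rewrite -[LHS]fineK// -[X in (X + _)%E]fineK// -[X in (_ + X)%E]fineK//.
rewrite -EFinD; congr EFin; apply: (cvg_unique _ cAB) => //.
have cA := ultra_content_internal mA; have cB := ultra_content_internal mB.
apply: cvg_trans (cvgD cA cB); apply: near_eq_cvg.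
rewrite internalI -internal0 in AB0.
apply: filterS (internal_inj AB0) => L /= ABL.
by rewrite measureU// fineD// fin_num_measure.
Qed.

HB.instance Definition _ := isContent.Build _ ultraproduct R ultra_content
  ultra_content_ge0 ultra_content_additive.

(* By saturation, a countable cover of an internal set by internal sets has a
   finite subcover. *)
Lemma ultra_content_sigma_subadditive :
  measurable_subset_sigma_subadditive ultra_content.
Proof.
move=> A F mF mA AF; pose C n := internal_repr (A `\` \big[setU/set0]_(k < n) F k).
have mD n : measurable (A `\` \big[setU/set0]_(k < n) F k).
  by apply: measurableD => //; exact: bigsetU_measurable.
have [n An0] : exists n, A `\` \big[setU/set0]_(k < n) F k = set0.
  apply: contrapT => nA.
  (* The representatives of the decreasing remainders decrease only for [U]-most [L]. Intersecting
     the first ones makes them decrease at every [L], as saturation requires. *)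
  have Cn n : internal (fun L => \big[setI/setT]_(k < n.+1) C k L) =
      A `\` \big[setU/set0]_(k < n) F k.
    elim: n => [|n IH].
      by under [X in internal X]eq_fun do rewrite big_ord1; rewrite internal_reprK.
    under [X in internal X]eq_fun do rewrite big_ord_recr/=.
    rewrite -(internalI (fun L => \big[setI/setT]_(k < n.+1) C k L)) IH internal_reprK//.
    apply/setIidr => y [Ay nF]; split => // Fy; apply: nF.
    by rewrite big_ord_recr/=; left.
  have [|n|y Hy] := @internal_saturated (fun n L => \big[setI/setT]_(k < n.+1) C k L).
  - by move=> n L y; rewrite big_ord_recr/= => -[].
  - rewrite Cn; apply/set0P/eqP => H; apply: nA; by exists n.
  have Ay : A y by have := Hy 0%N I; rewrite Cn => -[].
  have [k _ Fky] := AF _ Ay.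
  have := Hy k.+1 I; rewrite Cn => -[_]; apply.
  by rewrite big_ord_recr/=; right.
apply: (@le_trans _ _ (\sum_(k < n) ultra_content (F k))%E).
  by apply: content_subadditive => //; rewrite -setD_eq0.
rewrite -(big_mkord xpredT (fun k => ultra_content (F k))).
apply: nneseries_lim_ge => k _ _; exact: ultra_content_ge0.
Qed.

HB.instance Definition _ := Content_SigmaSubAdditive_isMeasure.Build _ _ _
  ultra_content ultra_content_sigma_subadditive.

Definition ultra_measure := measure_extension ultra_content.

HB.instance Definition _ := Measure.on ultra_measure.

Lemma ultra_measure_internal A : (forall L, measurable (A L)) ->
  ultra_measure (internal A) = ultra_content (internal A).
Proof.
move=> mA; rewrite /ultra_measure /measure_extension measurable_mu_extE//.
exact: internal_measurable.
Qed.

Lemma ultra_measure_setT : ultra_measure setT = 1%E.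
Proof.
have mT : forall L : nat, measurable [set: T] by move=> _; exact: measurableT.
have -> : [set: ultraproduct] = internal (fun=> setT).
  by rewrite eqEsubset; split=> y //= _; exact: filterE.
have := ultra_content_internal mT; rewrite ultra_measure_internal// => H.
rewrite -[LHS]fineK//; congr EFin; apply: (cvg_unique _ H) => //.
by apply: cvg_near_cst; apply: filterE => L; rewrite (congr1 fine (@probability_setT _ _ _ (Q L))).
Qed.

HB.instance Definition _ := Measure_isProbability.Build _ _ _ ultra_measure
  ultra_measure_setT.

Let I : measurableType _ := g_sigma_algebraType (@measurable _ ultraproduct).

Let internal_measurable_sigma A : (forall L, measurable (A L)) ->
  @measurable _ I (internal A).
Proof. by move=> mA; apply: sub_sigma_algebra; exact: internal_measurable. Qed.

Section ultra_integral.
Variables (f : nat -> T -> R) (M : R) (F : ultraproduct -> R).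
Hypotheses (mf : forall L, measurable_fun setT (f L))
  (fM : forall L x, 0 <= f L x <= M)
  (fF : forall y : ultraproduct, f L (y L) @[L --> U] --> F y).

Let mlevel c L : measurable [set x | c < f L x].
Proof.
have := mf L measurableT (measurable_itv `]c, +oo[); rewrite setTI.
by congr measurable; rewrite eqEsubset; split=> x /=; rewrite in_itv/= andbT.
Qed.

Lemma ultra_limit_measurable : measurable_fun [set: I] F.
Proof.
apply: (measurability _ (RGenOInfty.measurableE R)) => //.
move=> /= _ [_ [c ->] <-]; apply: measurableI => //.
(* A strict inequality does not survive the limit, so [c < F y] is expressed by a margin that holds
   for [U]-most [L]. *)
have -> : F @^-1` `]c, +oo[ =
    \bigcup_k internal (fun L => [set x | c + k.+1%:R^-1 < f L x]).
  rewrite eqEsubset; split=> y /=; rewrite in_itv/= andbT.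
    move=> /ltr_add_invr[k ck]; exists k => //.
    exact: (cvgr_gt _ (@fF y) _ ck).
  move=> [k _ yk]; apply: (@lt_le_trans _ _ (c + k.+1%:R^-1)).
    by rewrite ltrDl.
  apply: (cvgr_to_ge (@fF y)).
  by apply: filterS yk => L /ltW.
by apply: bigcupT_measurable => k; apply: internal_measurable_sigma => L.
Qed.

Let F0M y : 0 <= F y <= M.
Proof.
by apply/andP; split; [apply: (cvgr_to_ge (@fF y))|apply: (cvgr_to_le (@fF y))];
  apply: (@filterE _ U) => L; case/andP: (fM L (y L)).
Qed.

Let bf L x : `|f L x| <= M.
Proof. by case/andP: (fM L x) => f0 ?; rewrite ger0_norm. Qed.

Let bF y : `|F y| <= M.
Proof. by case/andP: (F0M y) => f0 ?; rewrite ger0_norm. Qed.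

(** Both sides are compared with staircases of step [e]. The integral of a staircase is a finite
    combination of measures of internal sets, for which [ultra_content_internal] gives the
    convergence. *)
Lemma cvg_ultra_integral :
  \int[Q L]_x f L x @[L --> U] --> \int[ultra_measure]_(y in [set: I]) F y.
Proof.
have M0 : 0 <= M by case/andP: (fM 0 point) => ? ?; exact: le_trans (f 0%N point) _ _ _ _.
have fi L : (Q L).-integrable setT (EFin \o f L).
  exact: bounded_integrable (mf L) (bf L).
have Fi : ultra_measure.-integrable [set: I] (EFin \o F).
  exact: bounded_integrable ultra_limit_measurable bF.
have [L|l _ ul] := @ultra_bounded_cvg U UU R 0 M (fun L => \int[Q L]_x f L x).
  rewrite Rintegral_ge0/=; last by move=> x _; case/andP: (fM L x).
  rewrite -[leRHS](Rintegral_probability_cst (Q L)).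
  apply: le_Rintegral; [exact: measurableT|exact: fi| |].
    exact: finite_measure_integrable_cst.
  by move=> x _; case/andP: (fM L x).
suff H : forall e : R, 0 < e ->
    (l <= \int[ultra_measure]_(y in [set: I]) F y + e) &&
    (\int[ultra_measure]_(y in [set: I]) F y <= l + e).
  suff -> : \int[ultra_measure]_(y in [set: I]) F y = l by [].
  apply/eqP; rewrite eq_le; apply/andP; split; apply/ler_addgt0Pr => e /H/andP[];
  by [].
move=> e e0.
have [K MK] : exists K : nat, M <= e *+ K.
  exists (Num.bound (M / e)); rewrite -mulr_natl -ler_pdivrMr//.
  by rewrite ltW// archi_boundP// divr_ge0// ltW.
pose A k L := [set x | e *+ k.+1 < f L x].
have mA k L : measurable (A k L) by exact: mlevel.
have AE k L x : \1_(A k L) x = (e *+ k.+1 < f L x)%R%:R :> R.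
  by rewrite indicE; congr ((_ : bool)%:R); apply/idP/idP; rewrite inE.
pose g L x := e * \sum_(k < K) \1_(A k L) x.
pose G y := e * \sum_(k < K) \1_(internal (A k)) y.
have gf L x : g L x <= f L x.
  rewrite /g; under eq_bigr do rewrite AE.
  by apply: level_sum_le => //; case/andP: (fM L x).
have fg L x : f L x <= g L x + e.
  rewrite /g; under eq_bigr do rewrite AE.
  apply: le_level_sum => //; case/andP: (fM L x) => _ /le_trans; exact.
(* Each of the [K] level conditions is decided by [U], so the staircase at [y L] equals the one at
   [y] for [U]-most [L], not merely in the limit. *)
have gG y : U [set L | g L (y L) = G y].
  suff : U [set L | forall k : 'I_K, \1_(A k L) (y L) = \1_(internal (A k)) y :> R].
    by apply: filterS => L /= H; rewrite /g /G; congr (e * _); apply: eq_bigr.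
  apply: filter_forall => k; rewrite indicE.
  have [yk|yk] := pselect (internal (A k) y).
    rewrite mem_set//; apply: filterS yk => L /= yk.
    by rewrite indicE mem_set.
  rewrite memNset//; move: yk; rewrite -[~ _]/((~` internal (A k)) y) internalC.
  by apply: filterS => L /= yk; rewrite indicE memNset.
have GF y : G y <= F y.
  apply: (cvgr_to_ge (@fF y)); apply: filterS (gG y) => L /= <-; exact: gf.
have FG y : F y <= G y + e.
  apply: (cvgr_to_le (@fF y)); apply: filterS (gG y) => L /= <-; exact: fg.
have intg L : \int[Q L]_x g L x = e * \sum_(k < K) fine (Q L (A k L)).
  exact: (@Rintegral_sum_indic _ _ _ (Q L) e K (fun k => A k L) (ltW e0)).
have intG : \int[ultra_measure]_(y in [set: I]) G y =
    e * \sum_(k < K) fine (ultra_content (internal (A k))).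
  rewrite (@Rintegral_sum_indic _ I _ ultra_measure e K (fun k => internal (A k)) (ltW e0)).
    by congr (e * _); apply: eq_bigr => k _; congr fine; exact: ultra_measure_internal.
  by move=> k; exact: internal_measurable_sigma.
have gcvg : \int[Q L]_x g L x @[L --> U] --> \int[ultra_measure]_(y in [set: I]) G y.
  under eq_fun do rewrite intg.
  rewrite intG; apply: (@cvgMr _ _ U); apply: cvg_big => [|k _]; first exact: add_continuous.
  exact: ultra_content_internal.
have mg L : measurable_fun setT (g L).
  by apply: measurable_funM => //; apply: measurable_sum => k; exact: measurable_indic.
have mG : measurable_fun [set: I] G.
  apply: measurable_funM => //; apply: measurable_sum => k; apply: measurable_indic.
  exact: internal_measurable_sigma.
have g0 L x : 0 <= g L x.
  by rewrite mulr_ge0 ?(ltW e0)// sumr_ge0// => k _; rewrite indicE.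
have G0 y : 0 <= G y.
  by rewrite mulr_ge0 ?(ltW e0)// sumr_ge0// => k _; rewrite indicE.
have gi L : (Q L).-integrable setT (EFin \o g L).
  apply: (@bounded_integrable _ _ _ (Q L) (g L) M (mg L)) => x.
  by rewrite ger0_norm// (le_trans (gf L x))//; case/andP: (fM L x).
have Gi : ultra_measure.-integrable [set: I] (EFin \o G).
  apply: (@bounded_integrable _ I _ ultra_measure G M mG) => x.
  by rewrite ger0_norm// (le_trans (GF x))//; case/andP: (F0M x).
have upper d' (T' : measurableType d') (P : probability T' R) (h k : T' -> R) :
    P.-integrable setT (EFin \o h) -> P.-integrable setT (EFin \o k) ->
    (forall x, h x <= k x + e) -> \int[P]_x h x <= \int[P]_x k x + e.
  move=> hi ki hk; rewrite -[leRHS]/(_ + e) -[X in _ <= _ + X](Rintegral_probability_cst P e).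
  have ei := @finite_measure_integrable_cst _ _ _ P setT e.
  rewrite -RintegralD//; last exact: ei.
  apply: le_Rintegral => //.
  by have := integrableD measurableT ki (ei measurableT).
apply/andP; split.
  apply: (@le_trans _ _ (\int[ultra_measure]_(y in [set: I]) G y + e)).
    have gecvg : \int[Q L]_x g L x + e @[L --> U] -->
        \int[ultra_measure]_(y in [set: I]) G y + e.
      by apply: cvgD => //; exact: cvg_cst.
    apply: (ler_cvg_to ul gecvg).
    by apply: (@filterE _ U) => L; exact: upper.
  by rewrite lerD2r; apply: le_Rintegral.
apply: (@le_trans _ _ (\int[ultra_measure]_(y in [set: I]) G y + e)).
  exact: upper.
rewrite lerD2r; apply: (ler_cvg_to gcvg ul).
apply: (@filterE _ U) => L.
by apply: le_Rintegral; [exact: measurableT|exact: gi|exact: fi|].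
Qed.

End ultra_integral.

End ultraproduct_measure.

(** * The gauge group *)

Section complex_part.
Variable R : realType.
Implicit Types z : R[i].

(** A Boolean index treats real and imaginary parts by one argument and reduces complex expectations
    to real integrals. *)
Definition part (b : bool) z : R := if b then complex.Im z else complex.Re z.

Lemma partD b : {morph part b : z w / z + w}.
Proof. by case: b => -[a c] [a' c']. Qed.

Lemma partN b : {morph part b : z / - z}.
Proof. by case: b => -[a c]. Qed.

Lemma partB b : {morph part b : z w / z - w}.
Proof. by move=> z w; rewrite partD partN. Qed.

Lemma part_sum b (I : Type) (r : seq I) (P : pred I) (F : I -> R[i]) :
  part b (\sum_(i <- r | P i) F i) = \sum_(i <- r | P i) part b (F i).
Proof. by apply: (big_morph _ (partD b)); case: b. Qed.

Lemma partM b z w : part b (z * w) =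
  if b then part false z * part true w + part true z * part false w
  else part false z * part false w - part true z * part true w.
Proof. by case: b; case: z => a c; case: w => a' c'. Qed.

Lemma part_le_norm b z : (`|part b z|%:C <= `|z|)%C.
Proof.
rewrite normc_def lecR -sqrtr_sqr ler_wsqrtr//.
by case: b; rewrite /= ?lerDl ?lerDr sqr_ge0.
Qed.

Lemma norm_le_part z : (`|z| <= (`|part false z| + `|part true z|)%:C)%C.
Proof.
rewrite normc_def lecR -[leRHS]ger0_norm ?addr_ge0// -sqrtr_sqr ler_wsqrtr//.
by rewrite sqrrD !real_normK ?num_real//= addrAC lerDl mulrn_wge0.
Qed.

Lemma part_continuous b : continuous (part b : R[i] -> R).
Proof.
move=> z A /nbhs_ballP[e /= e0 eA]; apply/nbhs_ballP.
exists e%:C%C => /=; first by rewrite ltcR.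
move=> w; rewrite /ball/= => zw; apply: eA; rewrite /ball/= -partB -ltcR.
exact: le_lt_trans (part_le_norm _ _) zw.
Qed.

Lemma cvg_complex (T : Type) (F : set_system T) (FF : Filter F) (f : T -> R[i]) z :
  (forall b, part b (f t) @[t --> F] --> part b z) -> f t @[t --> F] --> z.
Proof.
move=> fz A /nbhs_ballP[e /= e0 eA].
(* A positive element of [R[i]] is real. *)
have eE : e = (complex.Re e)%:C%C.
  by case: e e0 {eA} => x y; rewrite ltcE/= => /andP[/eqP -> _].
rewrite eE ltcR in e0.
have e20 : 0 < complex.Re e / 2 by rewrite divr_gt0.
have := fz false; move/cvgrPdist_lt => /(_ _ e20) H0.
have := fz true; move/cvgrPdist_lt => /(_ _ e20) H1.
apply: filterS2 H0 H1 => t H0 H1; apply: eA; rewrite /ball/= eE.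
apply: le_lt_trans (norm_le_part _) _; rewrite ltcR !partB.
by rewrite [ltRHS]splitr ltrD.
Qed.

Lemma cvg_mx (T : Type) (F : set_system T) (FF : Filter F) p q
    (f : T -> 'M[R[i]]_(p, q)) (A : 'M[R[i]]_(p, q)) :
  (forall i j b, part b (f t i j) @[t --> F] --> part b (A i j)) ->
  f t @[t --> F] --> A.
Proof.
move=> fA B [P AP PB].
have : F [set t | forall i j, P i j (f t i j)].
  apply: filter_forall => i; apply: filter_forall => j.
  by have /= := @cvg_complex _ _ FF (fun t => f t i j) (A i j) (fA i j) _ (AP i j).
by move=> H; apply: (@filterS _ F _ _ _ _ H) => t; exact: PB.
Qed.

Lemma cvg_mx_part (T : Type) (F : set_system T) (FF : Filter F) p q
    (f : T -> 'M[R[i]]_(p, q)) (A : 'M[R[i]]_(p, q)) i j b :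
  f t @[t --> F] --> A -> part b (f t i j) @[t --> F] --> part b (A i j).
Proof.
move=> fA; apply: (@cvg_comp _ _ _ (fun t => f t i j) (part b)); last exact: part_continuous.
by apply: (@cvg_comp _ _ _ f (fun M => M i j)) fA _; exact: coord_continuous.
Qed.

Lemma unitarymx_norm_le1 p (A : 'M[R[i]]_p) i j : A \is unitarymx -> `|A i j| <= 1.
Proof.
move/unitarymxP => /matrixP/(_ i i); rewrite !mxE eqxx/= => AA.
rewrite -(@expr_le1 _ 2)// -[leRHS]AA (bigD1 j)//= !mxE -normCK lerDl sumr_ge0// => k _.
by rewrite !mxE -normCK exprn_ge0.
Qed.

Lemma unitarymx_part_le1 p (A : 'M[R[i]]_p) i j b :
  A \is unitarymx -> `|part b (A i j)| <= 1.
Proof.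
move=> uA; rewrite -lecR; apply: le_trans (part_le_norm _ _) _.
exact: unitarymx_norm_le1.
Qed.

End complex_part.

(** * Compactness of the group and approximation of open sets *)

Section gauge_topology.
Variables (R : realType) (n : nat) (G : gaugeGroup R n).
Implicit Types g h : G.

Lemma gauge_unitary g : \val g \is unitarymx.
Proof. exact: gg_unitary (set_mem (valP g)). Qed.

Definition entry (i j : 'I_n) (b : bool) g : R := part b (\val g i j).

Lemma entry_le1 i j b g : `|entry i j b g| <= 1.
Proof. by apply: unitarymx_part_le1; exact: gauge_unitary. Qed.

Lemma gauge_cvg (T : Type) (F : set_system T) (FF : Filter F) (g_ : T -> G) g :
  (forall i j b, entry i j b (g_ t) @[t --> F] --> entry i j b g) ->
  g_ t @[t --> F] --> g.
Proof.
move=> gE A [_ [[B Bop <-] Bg BA]].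
have vg : \val (g_ t) @[t --> F] --> \val g by apply: cvg_mx => i j b; exact: gE.
have /vg : nbhs (\val g) B by apply: open_nbhs_nbhs.
by apply: (@filterS _ F) => t; exact: BA.
Qed.

Lemma entry_continuous i j b : continuous (entry i j b).
Proof.
move=> g; apply: (@cvg_mx_part _ _ (nbhs g) _ _ _ (fun g : G => \val g)).
exact: (@initial_continuous _ _ (set_val : gg_set G -> _)).
Qed.

(** Compactness of [G], in the form used throughout: the entries are bounded, hence have
    ultralimits, and the limit matrix stays in the group because the group is closed. *)
Lemma gauge_ultra_cvg (U : set_system nat) (UU : UltraFilter U) (g_ : nat -> G) :
  exists g, g_ t @[t --> U] --> g.
Proof.
have /choice[l Hl] : forall ijb : 'I_n * 'I_n * bool, exists l : R,
    entry ijb.1.1 ijb.1.2 ijb.2 (g_ t) @[t --> U] --> l.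
  move=> [[i j] b]; have [t|l _ ?] := @ultra_bounded_cvg U UU R (-1) 1
    (fun t => entry i j b (g_ t)); last by exists l.
  by rewrite -ler_norml entry_le1.
pose M := \matrix_(i, j) (Complex (l (i, j, false)) (l (i, j, true))).
have Mcvg : \val (g_ t) @[t --> U] --> M.
  by apply: cvg_mx => i j b; rewrite mxE; case: b; exact: Hl.
have MG : gg_set G M.
  apply: (closed_cvg (gg_set G) (gg_closed (g:=G)) _ _ Mcvg).
  by apply: (@filterE _ U) => t; exact: set_mem (valP (g_ t)).
exists (SigSub (mem_set MG)); apply: gauge_cvg => i j b.
by rewrite /entry/= mxE; case: b; exact: Hl.
Qed.

Lemma gauge_measurable_continuous (f : G -> R) :
  continuous f -> measurable_fun setT f.
Proof.
move=> cf; apply: (measurability _ (RGenOInfty.measurableE R)) => //.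
move=> /= _ [_ [c ->] <-]; rewrite setTI; apply: sub_sigma_algebra.
by move/continuousP: cf; apply; exact: interval_open.
Qed.

Definition gdist g h : R :=
  \sum_(k : 'I_n * 'I_n * bool)
    `|entry k.1.1 k.1.2 k.2 g - entry k.1.1 k.1.2 k.2 h|.

Lemma gdist_ge0 g h : 0 <= gdist g h. Proof. by apply: sumr_ge0. Qed.

Lemma gdistxx g : gdist g g = 0.
Proof. by rewrite /gdist big1// => k _; rewrite subrr normr0. Qed.

Lemma gdist_triangle g h k : gdist g k <= gdist g h + gdist h k.
Proof.
rewrite -big_split/= ler_sum// => i _.
by apply: le_trans (ler_normD _ _); rewrite addrA subrK.
Qed.

Lemma gdistC g h : gdist g h = gdist h g.
Proof. by apply: eq_bigr => k _; rewrite distrC. Qed.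

Lemma entry_le_gdist i j b g h : `|entry i j b g - entry i j b h| <= gdist g h.
Proof. by rewrite /gdist (bigD1 (i, j, b))//= lerDl sumr_ge0. Qed.

Lemma gdist_continuous g : continuous (gdist g).
Proof.
move=> h; apply: (@cvg_big _ _ _ _ _ _ _ (nbhs h) _ _ _ (nbhs_filter h)) => [|k _].
  exact: add_continuous.
by apply: (@cvg_norm _ _ _ (nbhs h)); apply: (@cvgB _ _ _ (nbhs h)); [exact: cvg_cst|exact: entry_continuous].
Qed.

Lemma gauge_cvg_gdist (T : Type) (F : set_system T) (FF : Filter F) (g_ : T -> G) g :
  gdist g (g_ t) @[t --> F] --> 0 -> g_ t @[t --> F] --> g.
Proof.
move=> /cvgrPdist_lt g0; apply: gauge_cvg => i j b; apply/cvgrPdist_lt => e e0.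
apply: filterS (g0 _ e0) => t /=; rewrite sub0r normrN ger0_norm ?gdist_ge0//.
exact: le_lt_trans (entry_le_gdist _ _ _ _ _).
Qed.

(** The distance to the complement of [O], truncated at 1; the added point 1 keeps the infimum over
    a nonempty set when [O] is the whole group. *)
Definition codist (O : set G) g : R := inf ([set 1] `|` [set gdist g h | h in ~` O]).

Let codist_lb O g : has_lbound ([set 1] `|` [set gdist g h | h in ~` O]).
Proof. by exists 0 => _ [->//|[h _ <-]]; exact: gdist_ge0. Qed.

Let codist_neq0 O g : ([set 1] `|` [set gdist g h | h in ~` O]) !=set0.
Proof. by exists 1; left. Qed.

Lemma codist_ge0 O g : 0 <= codist O g.
Proof. by apply: lb_le_inf => // _ [->//|[h _ <-]]; exact: gdist_ge0. Qed.

Lemma codist_lipschitz O g h : codist O g - codist O h <= gdist g h.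
Proof.
rewrite lerBlDl -lerBlDr; apply: lb_le_inf => // _ [->|[k Ok <-]].
  by rewrite lerBlDr (le_trans (ge_inf (codist_lb O g) (or_introl erefl)))// lerDl gdist_ge0.
rewrite lerBlDr addrC; apply: le_trans (gdist_triangle g h k).
by apply: ge_inf => //; right; exists k.
Qed.

Lemma codist_continuous O : continuous (codist O).
Proof.
move=> g; have Fg := nbhs_filter g; apply/(cvgrPdist_lt (FF := Fg)) => e e0.
have /(cvgrPdist_lt (FF := Fg))/(_ _ e0) := @gdist_continuous g g; rewrite gdistxx.
apply: filterS => h; rewrite sub0r normrN ger0_norm ?gdist_ge0//.
apply: le_lt_trans; rewrite ler_norml codist_lipschitz andbT lerNl opprB gdistC.
exact: codist_lipschitz.
Qed.

Lemma codist_eq0 O g : open O -> (codist O g == 0) = (g \notin O).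
Proof.
move=> oO; apply/eqP/idP => [d0|nO]; last first.
  apply/eqP; rewrite eq_le codist_ge0 andbT -(gdistxx g).
  by apply: ge_inf => //; right; exists g => //; rewrite notin_setE in nO.
rewrite notin_setE => Og.
have /choice[h_ Hh] : forall k : nat, exists h, ~ O h /\ gdist g h < k.+1%:R^-1.
  move=> k; apply: contrapT => Hk.
  suff : k.+1%:R^-1 <= codist O g by rewrite d0 leNgt invr_gt0 ltr0n.
  apply: lb_le_inf => // _ [->|[h Oh <-]]; first by rewrite invf_le1 ?ler1n.
  by rewrite leNgt; apply/negP => ?; apply: Hk; exists h.
have hg : h_ k @[k --> \oo] --> g.
  apply: gauge_cvg_gdist; apply: (squeeze_cvgr _ (cvg_cst 0) cvg_harmonic).
  by apply: nearW => k; rewrite gdist_ge0/= ltW//; case: (Hh k).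
have /hg [k _ /(_ k (leqnn _))] : nbhs g O by apply: open_nbhs_nbhs.
by case: (Hh k).
Qed.

(** The functions min (1, k [codist O]) increase to the indicator because [codist O] vanishes
    exactly off [O]. Through them, statements about continuous functions reach open sets, which
    generate the Borel sets. *)
Lemma open_indic_approx (O : set G) : open O -> exists phi : nat -> G -> R,
  [/\ forall k, continuous (phi k), forall k g, 0 <= phi k g <= 1,
      forall g, nondecreasing_seq (phi^~ g) &
      forall g, phi k g @[k --> \oo] --> (\1_O g : R)].
Proof.
move=> oO; exists (fun k g => Num.min 1 (k%:R * codist O g)); split.
- move=> k g; apply: (@continuous_min _ _ (cst 1) (fun g => k%:R * codist O g)).
    exact: (@cvg_cst _ _ _ (nbhs g)).
  by apply: (@cvgM _ _ (nbhs g)); [exact: cvg_cst|exact: codist_continuous].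
- by move=> k g; rewrite le_min ler01 ge_min lexx/= mulr_ge0// codist_ge0.
- by move=> g k l kl; rewrite le_min ge_min lexx/= ge_min [X in _ || X]ler_wpM2r ?orbT ?codist_ge0 ?ler_nat.
- move=> g; rewrite indicE; have := codist_eq0 g oO; case: (g \in O) => [|/eqP ->] /=.
    move/negbT => d0; have dpos : 0 < codist O g by rewrite lt_neqAle eq_sym d0 codist_ge0.
    apply: cvg_near_cst; exists (Num.bound (codist O g)^-1) => // k /= kb.
    apply: min_l; rewrite -ler_pdivrMr// div1r ltW//.
    rewrite (lt_le_trans (archi_boundP _))// ?invr_ge0 ?codist_ge0//.
    by rewrite ler_nat.
  apply: cvg_near_cst; apply: nearW => k.
  by rewrite mulr0 min_r.
Qed.

End gauge_topology.

(** * Finite-volume Gibbs operators *)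

Section resampling.
Variables (R : realType) (n : nat) (G : gaugeGroup R n).
Variables (d : nat) (D : set (edge d)) (haar : probability G R).
Local Notation C := (config G D).
Local Notation E := (set_type D).
Implicit Types (w : C) (e f : E) (x : G) (s : seq E) (F : C -> \bar R).

Definition upd w e x : C := fun f => if f == e then x else w f.

Lemma measurable_coord e : measurable_fun [set: C] (fun w : C => w e).
Proof.
move=> _ A mA; apply: sub_sigma_algebra; exists e => //.
by exists A.
Qed.

Lemma measurable_config d' (T : measurableType d') (h : T -> C) :
  (forall e, measurable_fun setT (fun t => h t e)) -> measurable_fun setT h.
Proof.
move=> mh; apply: (measurability (coordinate_sets (G := G) setT)) => //.
move=> _ [_ [e _ [A mA <-]] <-]; rewrite !setTI.
by have := mh e measurableT A mA; rewrite setTI.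
Qed.

Lemma measurable_upd e : measurable_fun [set: C * G] (fun p => upd p.1 e p.2).
Proof.
apply: measurable_config => f; rewrite /upd; case: (f == e).
  exact: measurable_snd.
apply: (@measurableT_comp _ _ _ _ _ _ (fun w : C => w f) _ fst).
  exact: measurable_coord.
exact: measurable_fst.
Qed.

Lemma measurable_upd_value w e : measurable_fun [set: G] (upd w e).
Proof.
apply: measurable_config => f; rewrite /upd; case: (f == e).
  exact: measurable_id.
exact: measurable_cst.
Qed.

Lemma measurable_glue s w : measurable_fun setT (@Defs.glue _ _ G _ D s w).
Proof.
apply: measurable_config => e; rewrite /Defs.glue.
have [es|se] := ltnP (index e s) (size s); last first.
  rewrite (_ : (fun t => _) = cst (w e)); first exact: measurable_cst.
  by apply/funext => eta; rewrite nth_default// size_tuple.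
rewrite (_ : (fun t => _) = (fun t : (size s).-tuple G => tnth t (Ordinal es))).
  exact: measurable_tnth.
by apply/funext => eta; rewrite (tnth_nth (w e)).
Qed.

Lemma updC w e f x y : e != f -> upd (upd w e x) f y = upd (upd w f y) e x.
Proof.
move=> ef; apply/funext => k; rewrite /upd.
by case: (eqVneq k f) => [->|//]; rewrite eq_sym (negbTE ef).
Qed.

Lemma upd_upd w e x y : upd (upd w e x) e y = upd w e y.
Proof. by apply/funext => k; rewrite /upd; case: (k == e). Qed.

Local Open Scope ereal_scope.

Definition mge0 F := measurable_fun setT F /\ forall w, 0 <= F w.

(** Haar integration over several edges is an iteration of one-edge integrations acting on functions
    of the full configuration. Consistency then rests on commutation and idempotence;
    [resamples_glue] recovers the integral over [tuple_probability]. *)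
Definition resample e F w := \int[haar]_x F (upd w e x).

Definition resamples s F := foldr resample F s.

Lemma mge0_upd F e : mge0 F ->
  measurable_fun setT (fun p : C * G => F (upd p.1 e p.2)).
Proof. by case=> mF _; apply: measurableT_comp mF _; exact: measurable_upd. Qed.

Lemma mge0_upd_value F e w : mge0 F -> measurable_fun setT (fun x => F (upd w e x)).
Proof. by case=> mF _; apply: measurableT_comp mF _; exact: measurable_upd_value. Qed.

Lemma mge0_resample e F : mge0 F -> mge0 (resample e F).
Proof.
move=> mF; split; last by move=> w; apply: integral_ge0 => x _; exact: mF.2.
have := measurable_fun_fubini_tonelli_F (m2 := haar) _ (mge0_upd e mF).
by apply => p; exact: mF.2.
Qed.

Lemma mge0_resamples s F : mge0 F -> mge0 (resamples s F).
Proof. by move=> mF; elim: s => //= e s; exact: mge0_resample. Qed.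

Lemma resampleC e f F : mge0 F ->
  resample e (resample f F) = resample f (resample e F).
Proof.
move=> mF; have [->//|ef] := eqVneq e f; apply/funext => w.
rewrite /resample (fubini_tonelli (fun p : G * G => F (upd (upd w e p.1) f p.2))) /=.
- by apply: eq_integral => y _; apply: eq_integral => x _; rewrite updC.
- apply: measurableT_comp mF.1 _; apply: measurable_config => k; rewrite /upd.
  case: (k == f); first exact: measurable_snd.
  by case: (k == e); [exact: measurable_fst|exact: measurable_cst].
- by move=> p; exact: mF.2.
Qed.

Lemma integral_probability_cst d' (T : measurableType d') (P : probability T R)
  (c : \bar R) : \int[P]_x c = c.
Proof. transitivity (c * P setT); first exact: integral_cst.
by rewrite (probability_setT P) mule1. Qed.

Definition indep e F := forall w x, F (upd w e x) = F w.
Definition indeps s F := forall e, e \in s -> indep e F.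

Lemma resample_indep_id e F : indep e F -> resample e F = F.
Proof.
move=> iF; apply/funext => w; rewrite /resample.
by under eq_integral do rewrite iF; rewrite integral_probability_cst.
Qed.

Lemma indep_resample e F : indep e (resample e F).
Proof. by move=> w x; apply: eq_integral => y _; rewrite upd_upd. Qed.

Lemma indep_resample_neq e f F : indep e F -> indep e (resample f F).
Proof.
have [->|ef] := eqVneq e f; first by move=> _; exact: indep_resample.
by move=> iF w x; apply: eq_integral => y _; rewrite updC// iF.
Qed.

Lemma resample_idem e F : resample e (resample e F) = resample e F.
Proof. by apply: resample_indep_id; exact: indep_resample. Qed.

Lemma indeps_resamples s F : indeps s (resamples s F).
Proof.
elim: s => [//|f s IH] e; rewrite inE => /orP[/eqP ->|es] /=.
  exact: indep_resample.
by apply: indep_resample_neq; exact: IH.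
Qed.

Lemma resamples_resample s e F : mge0 F -> e \in s ->
  resamples s (resample e F) = resamples s F.
Proof.
move=> mF; elim: s => // f s IH; rewrite inE => /orP[/eqP <-|/IH /= -> //].
have H t : resamples t (resample e F) = resample e (resamples t F).
  by elim: t => //= f' t ->; rewrite resampleC//; exact: mge0_resamples.
by rewrite /= H resample_idem.
Qed.

Lemma resamples_sub s t F : mge0 F -> {subset s <= t} ->
  resamples t (resamples s F) = resamples t F.
Proof.
move=> mF; elim: s => //= e s IH st.
rewrite resamples_resample ?IH//; last by apply: st; rewrite mem_head.
  by move=> f fs; apply: st; rewrite inE fs orbT.
exact: mge0_resamples.
Qed.

Lemma resamplesM s F H : mge0 F -> mge0 H -> indeps s H ->
  resamples s (fun w => H w * F w) = (fun w => H w * resamples s F w).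
Proof.
move=> mF mH; elim: s => //= e s IH iH.
rewrite IH; last by move=> f fs; apply: iH; rewrite inE fs orbT.
apply/funext => w; rewrite /resample.
under eq_integral do rewrite (iH _ (mem_head _ _)).
apply: ge0_integralZl => //.
- by apply: mge0_upd_value; exact: mge0_resamples.
- by move=> x _; exact: (mge0_resamples s mF).2.
- exact: mH.2.
Qed.

Lemma resamplesD s F H : mge0 F -> mge0 H ->
  resamples s (fun w => F w + H w) = (fun w => resamples s F w + resamples s H w).
Proof.
move=> mF mH; elim: s => //= e s ->; apply/funext => w; rewrite /resample.
have msF := mge0_resamples s mF; have msH := mge0_resamples s mH.
by apply: ge0_integralD => //; [move=> x _; exact: msF.2|exact: mge0_upd_value|
  move=> x _; exact: msH.2|exact: mge0_upd_value].
Qed.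

Lemma le_resamples s F H : mge0 F -> mge0 H -> (forall w, F w <= H w) ->
  forall w, resamples s F w <= resamples s H w.
Proof.
move=> mF mH FH; elim: s => //= e s IH w.
have msF := mge0_resamples s mF; have msH := mge0_resamples s mH.
by apply: ge0_le_integral => //; [move=> x _; exact: msF.2|exact: mge0_upd_value|
  exact: mge0_upd_value].
Qed.

Lemma resamples_lim s (F_ : nat -> C -> \bar R) F : (forall k, mge0 (F_ k)) ->
  (forall w, nondecreasing_seq (F_^~ w)) -> (forall w, F_ k w @[k --> \oo] --> F w) ->
  mge0 F ->
  [/\ forall w, nondecreasing_seq (fun k => resamples s (F_ k) w) &
     forall w, resamples s (F_ k) w @[k --> \oo] --> resamples s F w].
Proof.
move=> mF_ ndF_ cF_ mF; elim: s => [//|e s [IHnd IHc]].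
have ms k := mge0_resamples s (mF_ k).
split=> w.
  move=> k l kl; apply: ge0_le_integral => //.
  - by move=> x _; exact: (ms k).2.
  - exact: (mge0_upd_value e w (ms k)).
  - exact: (mge0_upd_value e w (ms l)).
  - by move=> x _; exact: IHnd.
rewrite /= /resample.
rewrite (_ : (fun x => resamples s F (upd w e x)) =
   (fun x => limn (fun k => resamples s (F_ k) (upd w e x)))); last first.
  by apply/funext => x; apply/esym/cvg_lim => //; exact: IHc.
apply: cvg_monotone_convergence => //.
- by move=> k; exact: mge0_upd_value.
- by move=> k x _; exact: (ms k).2.
Qed.

Lemma glue_cons s w e x (eta : (size s).-tuple G) : e \notin s ->
  @Defs.glue _ _ G _ D (e :: s) w (tuple_cons (x, eta)) = Defs.glue (upd w e x) eta.
Proof.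
move=> es; apply/funext => f; rewrite /Defs.glue/= /upd eq_sym.
have [->|fe] := eqVneq f e.
  by rewrite memNindex// [RHS]nth_default ?size_tuple.
by [].
Qed.

Lemma resamples_glue s F w : uniq s -> mge0 F ->
  resamples s F w = \int[tuple_probability haar (size s)]_eta F (Defs.glue w eta).
Proof.
elim: s w => [|e s IH] w /=.
  move=> _ mF; rewrite integral_dirac//; last first.
    by apply: measurableT_comp mF.1 _; exact: (@measurable_glue [::] w).
  by rewrite diracT mul1e.
move=> /andP[es us] mF.
rewrite ge0_integral_distribution; last 2 first.
- by apply: measurableT_comp mF.1 _; exact: (@measurable_glue (e :: s) w).
- by move=> y; exact: mF.2.
rewrite (fubini_tonelli1 (m1 := haar)); last 2 first.
- apply: measurableT_comp (measurableT_comp mF.1 (@measurable_glue (e :: s) w)) _.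
  exact: measurable_cons measurable_fst measurable_snd.
- by move=> p; exact: mF.2.
apply: eq_integral => x _; rewrite IH//.
by apply: eq_integral => eta _ /=; rewrite glue_cons.
Qed.

End resampling.

(** * Bounded continuous observables *)

Section regular.
Variables (R : realType) (n : nat) (G : gaugeGroup R n).
Variables (d : nat) (D : set (edge d)) (haar : probability G R).
Local Notation C := (config G D).
Local Notation E := (set_type D).
Implicit Types (w : C) (e : E) (x : G) (s : seq E) (f g : C -> R).

(* Ultrafilters on nat suffice: infinite-volume limits are taken along them. *)
Definition ucont f := forall U, UltraFilter U -> forall (w_ : nat -> C) w,
  (forall e, w_ L e @[L --> U] --> w e) -> f (w_ L) @[L --> U] --> f w.

(** Gibbs operators preserve this class ([regular_rgibbs_op]). This Feller property is what lets
    invariance pass to limit measures. *)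
Definition regular f :=
  [/\ measurable_fun setT f, ucont f & exists M : R, forall w, `|f w| <= M].

Lemma regular_cst c : regular (fun=> c).
Proof.
by split; [exact: measurable_cst|move=> U UU w_ w _; exact: cvg_cst|exists `|c|].
Qed.

Lemma regularD f g : regular f -> regular g -> regular (fun w => f w + g w).
Proof.
move=> [mf cf [M fM]] [mg cg [N gN]]; split; first exact: measurable_funD.
  by move=> U UU w_ w ww; apply: cvgD; [exact: cf|exact: cg].
by exists (M + N) => w; rewrite (le_trans (ler_normD _ _))// lerD.
Qed.

Lemma regularN f : regular f -> regular (fun w => - f w).
Proof.
move=> [mf cf [M fM]]; split; first exact: measurable_funN.
  by move=> U UU w_ w ww; apply: cvgN; exact: cf.
by exists M => w; rewrite normrN.
Qed.

Lemma regularM f g : regular f -> regular g -> regular (fun w => f w * g w).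
Proof.
move=> [mf cf [M fM]] [mg cg [N gN]]; split; first exact: measurable_funM.
  by move=> U UU w_ w ww; apply: cvgM; [exact: cf|exact: cg].
exists (M * N) => w; rewrite normrM ler_pM//.
Qed.

Lemma regularB f g : regular f -> regular g -> regular (fun w => f w - g w).
Proof. by move=> rf rg; apply: regularD rf _; exact: regularN. Qed.

Lemma regular_sum (I : Type) (r : seq I) (F : I -> C -> R) :
  (forall i, regular (F i)) -> regular (fun w => \sum_(i <- r) F i w).
Proof.
move=> rF; elim: r => [|i r IH].
  by under eq_fun do rewrite big_nil; exact: regular_cst.
by under eq_fun do rewrite big_cons; exact: regularD.
Qed.

Lemma regular_expR f : regular f -> regular (fun w => expR (f w)).
Proof.
move=> [mf cf [M fM]]; split; first exact: measurableT_comp.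
  move=> U UU w_ w ww; apply: (cvg_comp _ expR (cf _ _ _ _ ww)).
  exact: continuous_expR.
exists (expR M) => w; rewrite ger0_norm ?expR_ge0// ler_expR.
by rewrite (le_trans (ler_norm _)).
Qed.

Lemma regular_coord (phi : G -> R) e (M : R) : continuous phi ->
  (forall x, `|phi x| <= M) -> regular (fun w => phi (w e)).
Proof.
move=> cphi phiM; split; last by exists M.
  apply: measurableT_comp; first exact: gauge_measurable_continuous.
  exact: measurable_coord.
by move=> U UU w_ w ww; exact: (cvg_comp _ phi (ww e) (cphi _)).
Qed.

Lemma regular_inv f (c : R) : 0 < c -> (forall w, c <= f w) -> regular f ->
  regular (fun w => (f w)^-1).
Proof.
move=> c0 cf [mf cvf _]; have f0 w : 0 < f w by exact: lt_le_trans (cf w).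
split.
- rewrite (_ : (fun w => _) = (fun w => expR (- ln (f w)))).
    apply: measurableT_comp => //; apply: measurable_funN.
    by apply: measurableT_comp => //; exact: measurable_ln.
  by apply/funext => w; rewrite expRN lnK// posrE.
- by move=> U UU w_ w ww; apply: cvgV; [rewrite gt_eqF|exact: cvf].
- by exists c^-1 => w; rewrite ger0_norm ?invr_ge0 ?(ltW (f0 w))// lef_pV2 ?posrE.
Qed.

Definition rresample e f w := \int[haar]_x f (upd w e x).

Lemma regular_integrable f e w : regular f ->
  haar.-integrable setT (EFin \o (fun x => f (upd w e x))).
Proof.
move=> [mf _ [M fM]]; apply: (@bounded_integrable _ _ _ _ _ M) => //.
by apply: measurableT_comp mf _; exact: measurable_upd_value.
Qed.

Lemma EFin_rresample e f : regular f ->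
  resample haar e (EFin \o f) = EFin \o rresample e f.
Proof.
move=> rf; apply/funext => w; rewrite /= /rresample /Rintegral fineK//.
by apply: integrable_fin_num => //; exact: regular_integrable.
Qed.

Lemma le_rresample e f g : regular f -> regular g -> (forall w, f w <= g w) ->
  forall w, rresample e f w <= rresample e g w.
Proof. by move=> rf rg fg w; apply: le_Rintegral => //; exact: regular_integrable. Qed.

Lemma rresample_cst e c w : rresample e (fun=> c) w = c.
Proof. exact: Rintegral_probability_cst. Qed.

(** Pointwise convergence along an ultrafilter does not give convergence of integrals, so uniformity
    in the resampled value is needed. It comes from compactness of [G]: values [x_ L] violating it
    would have an ultralimit [x], and continuity at [upd w e x] is contradicted. *)
Lemma ucont_rresample e f : regular f -> ucont (rresample e f).
Proof.
move=> rf U UU w_ w ww; apply/cvgrPdist_le => eps eps0.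
have [mf cf _] := rf.
suff : U [set L | forall x, `|f (upd w e x) - f (upd (w_ L) e x)| <= eps].
  apply: filterS => L /= H; rewrite /rresample -RintegralB//; try exact: regular_integrable.
  apply: le_trans (le_normr_Rintegral _ _) _ => //.
    have := integrableB measurableT (regular_integrable e w rf) (regular_integrable e (w_ L) rf).
    by [].
  rewrite -[leRHS](Rintegral_probability_cst haar); apply: le_Rintegral => //.
  - have := integrable_abse (integrableB measurableT (regular_integrable e w rf)
      (regular_integrable e (w_ L) rf)).
    by [].
  - exact: finite_measure_integrable_cst.
have [//|nA] := in_ultra_setVsetC [set L | forall x,
  `|f (upd w e x) - f (upd (w_ L) e x)| <= eps] UU.
have /choice[x_ Hx] : forall L, exists x,
    ~ (forall x, `|f (upd w e x) - f (upd (w_ L) e x)| <= eps) ->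
    eps < `|f (upd w e x) - f (upd (w_ L) e x)|.
  move=> L; have [H|H] := pselect (exists x, eps < `|f (upd w e x) - f (upd (w_ L) e x)|).
    by case: H => x Hx; exists x.
  exists 1%g => nH; exfalso; apply: nH => x; rewrite leNgt; apply/negP => Hx.
  by apply: H; exists x.
have [x xx] := gauge_ultra_cvg UU x_.
have H1 : f (upd w e (x_ L)) @[L --> U] --> f (upd w e x).
  apply: cf => k; rewrite /upd; case: (k == e) => //; exact: cvg_cst.
have H2 : f (upd (w_ L) e (x_ L)) @[L --> U] --> f (upd w e x).
  by apply: cf => k; rewrite /upd; case: (k == e).
have H3 : U [set L | `|f (upd w e (x_ L)) - f (upd (w_ L) e (x_ L))| <= eps].
  have : (f (upd w e (x_ L)) - f (upd (w_ L) e (x_ L))) @[L --> U] --> 0.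
    by rewrite -(subrr (f (upd w e x))); exact: cvgB.
  by move/cvgr0Pnorm_le => /(_ _ eps0).
have [L [/= L1 L2]] := filter_ex (filterI nA H3).
by have := Hx L L1; rewrite ltNge => /negP; case.
Qed.

Lemma regular_rresample e f : regular f -> regular (rresample e f).
Proof.
move=> rf; split; last 2 first.
- exact: ucont_rresample.
- have [mf _ [M fM]] := rf; exists M => w.
  rewrite ler_norml -[X in X <= _](rresample_cst e (- M) w).
  rewrite -[X in _ && (_ <= X)](rresample_cst e M w).
  by apply/andP; split; apply: le_rresample => //; try exact: regular_cst;
    move=> w'; have := fM w'; rewrite ler_norml => /andP[].
have [mf _ [M fM]] := rf.
(* The measurability part of Tonelli is for nonnegative functions, so [f] is shifted by its
   bound. *)
have rM : regular (fun w => f w + M) by apply: regularD => //; exact: regular_cst.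
have [mM _] : mge0 (resample haar e (EFin \o (fun w => f w + M))).
  apply: mge0_resample; split; first by apply/measurable_EFinP; case: rM.
  by move=> w; rewrite lee_fin -lerBlDr sub0r; have := fM w; rewrite ler_norml => /andP[].
rewrite EFin_rresample// in mM; move/measurable_EFinP in mM.
rewrite (_ : rresample e f = (fun w => rresample e (fun w => f w + M) w - M)).
  by apply: measurable_funB.
apply/funext => w; rewrite /rresample RintegralD//.
- by rewrite Rintegral_probability_cst addrK.
- exact: regular_integrable.
- exact: finite_measure_integrable_cst.
Qed.

Definition rresamples s f := foldr rresample f s.

Lemma regular_rresamples s f : regular f -> regular (rresamples s f).
Proof. by move=> rf; elim: s => //= e s; exact: regular_rresample. Qed.

Lemma EFin_rresamples s f : regular f ->
  resamples haar s (EFin \o f) = EFin \o rresamples s f.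
Proof.
move=> rf; elim: s => //= e s ->; rewrite EFin_rresample//.
exact: regular_rresamples.
Qed.

Lemma le_rresamples s f g : regular f -> regular g -> (forall w, f w <= g w) ->
  forall w, rresamples s f w <= rresamples s g w.
Proof.
move=> rf rg fg; elim: s => //= e s IH w.
by apply: le_rresample => //; exact: regular_rresamples.
Qed.

Lemma rresamples_cst s c w : rresamples s (fun=> c) w = c.
Proof.
elim: s w => //= e s IH w; rewrite -[RHS](rresample_cst e c w).
by congr rresample; apply/funext.
Qed.

Definition mx_regular p q (F : C -> 'M[R[i]]_(p, q)) :=
  forall i j b, regular (fun w => part b (F w i j)).

Lemma mx_regularM p q r (A : C -> 'M[R[i]]_(p, q)) (B : C -> 'M[R[i]]_(q, r)) :
  mx_regular A -> mx_regular B -> mx_regular (fun w => A w *m B w).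
Proof.
move=> rA rB i j b; under eq_fun do rewrite mxE part_sum.
apply: regular_sum => k; under eq_fun do rewrite partM.
by case: b; [apply: regularD|apply: regularB]; apply: regularM.
Qed.

Lemma mx_regular_cst p q (A : 'M[R[i]]_(p, q)) : mx_regular (fun=> A).
Proof. by move=> i j b; exact: regular_cst. Qed.

Lemma mx_regular_trC p q (A : C -> 'M[R[i]]_(p, q)) :
  mx_regular A -> mx_regular (fun w => (A w ^t*)%sesqui).
Proof.
move=> rA i j b; under eq_fun do rewrite !mxE.
have -> : (fun w => part b (A w j i)^*) =
    (fun w => if b then - part b (A w j i) else part b (A w j i)).
  by apply/funext => w; case: b; case: (A w j i).
by case: b; [apply: regularN|]; exact: rA.
Qed.

End regular.

Lemma big_cat_mulmx (R : comNzRingType) (m : nat) (I : Type) (r1 r2 : seq I) (F : I -> 'M[R]_m) :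
  \big[mulmx/1%:M]_(h <- r1 ++ r2) F h =
  \big[mulmx/1%:M]_(h <- r1) F h *m \big[mulmx/1%:M]_(h <- r2) F h.
Proof.
elim: r1 => [|h r IH]; first by rewrite big_nil mul1mx.
by rewrite /= !big_cons IH mulmxA.
Qed.

(** * Holonomies in a unitary representation *)

Section path_holonomy.
Variables (R : realType) (n : nat) (G : gaugeGroup R n) (m : nat).
Variables (phi : G -> 'M[R[i]]_m).

Definition unitary_rep := [/\ continuous phi, forall g, phi g \is unitarymx &
  forall g h, phi (g * h)%g = phi g *m phi h].

Hypothesis phiP : unitary_rep.

Lemma unitary_rep1 : phi 1%g = 1%:M.
Proof.
have [_ uphi phiM] := phiP.
have /(congr1 (mulmx (invmx (phi 1%g)))) := phiM 1%g 1%g.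
rewrite mul1g mulmxA mulVmx ?mul1mx//; exact: unitarymx_unit.
Qed.

Lemma unitary_repV g : phi g^-1%g = (phi g ^t*)%sesqui.
Proof.
have [_ uphi phiM] := phiP.
have := phiM g^-1%g g; rewrite mulVg unitary_rep1 => /(congr1 (mulmx^~ (phi g ^t*)%sesqui)).
by rewrite -mulmxA (unitarymxP (uphi g)) mulmx1 mul1mx.
Qed.

Lemma unitary_rep_part_continuous i j b : continuous (fun g => part b (phi g i j)).
Proof.
have [cphi _ _] := phiP => g.
by apply: (@cvg_mx_part _ _ (nbhs g) (nbhs_filter g) _ _ phi); exact: cphi.
Qed.

Variables (d : nat) (D : set (edge d)).
Local Notation C := (config G D).
Implicit Types (w : C) (e : set_type D) (l : seq (dedge d)).

Lemma mx_regular_edge (f : edge d) : mx_regular (fun w : C => phi (edge_value w f)).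
Proof.
move=> i j b; rewrite /edge_value; case: insubP => [e _ _|_] /=.
  apply: (regular_coord (phi := fun g => part b (phi g i j)) e (M := 1)).
    exact: unitary_rep_part_continuous.
  by move=> g; apply: unitarymx_part_le1; case: phiP.
exact: regular_cst.
Qed.

Definition rep_path l w := \big[mulmx/1%:M]_(a <- l) phi (dedge_value w a).

Lemma mx_regular_path l : mx_regular (rep_path l).
Proof.
rewrite /rep_path; elim: l => [|a l IH].
  by under eq_fun do rewrite big_nil; exact: mx_regular_cst.
under eq_fun do rewrite big_cons; apply: mx_regularM => //.
case: a => f [] /=; rewrite /dedge_value/=; last exact: mx_regular_edge.
under eq_fun do rewrite unitary_repV.
by apply: mx_regular_trC; exact: mx_regular_edge.
Qed.

Lemma rep_path_unitary l w : rep_path l w \is unitarymx.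
Proof.
rewrite /rep_path; elim: l => [|a l IH].
  by rewrite big_nil; apply/unitarymxP; rewrite mul1mx trmx1 map_mx1.
rewrite big_cons; apply: mul_unitarymx IH.
by have [_ uphi _] := phiP; exact: uphi.
Qed.

Lemma rep_path_cat l1 l2 w : rep_path (l1 ++ l2) w = rep_path l1 w *m rep_path l2 w.
Proof. exact: big_cat_mulmx. Qed.

Lemma edge_value_upd w e x f : \val e != f -> edge_value (upd w e x) f = edge_value w f.
Proof.
rewrite /edge_value; case: insubP => [k _ <-|//] /= ek; rewrite /upd.
by rewrite eq_sym -val_eqE (negbTE ek).
Qed.

Lemma rep_path_upd w e x l : \val e \notin [seq a.1 | a <- l] ->
  rep_path l (upd w e x) = rep_path l w.
Proof.
move=> el; apply: eq_big_seq => a al; rewrite /dedge_value edge_value_upd//.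
by apply: contra el => /eqP ->; exact: map_f.
Qed.

End path_holonomy.

(** * Boltzmann weights and Gibbs operators *)

Section gibbs_weight.
Variables (R : realType) (n : nat) (G : gaugeGroup R n).
Variables (d : nat) (D : set (edge d)) (beta : R).
Local Notation C := (config G D).
Local Notation E := (set_type D).
Implicit Types (w : C) (e : E) (s t : seq E) (p : plaquette d).

Lemma val_unitary_rep : unitary_rep (fun g : G => \val g).
Proof.
split=> //; last exact: gauge_unitary.
exact: (@initial_continuous _ _ (set_val : gg_set G -> _)).
Qed.

Lemma val_holonomy w l : \val (holonomy w l) = rep_path (fun g : G => \val g) l w.
Proof.
rewrite /holonomy /rep_path; elim: l => [|a l IH]; first by rewrite !big_nil.
by rewrite !big_cons -IH.
Qed.

Lemma regular_Re_tr p : regular (fun w : C => Re_tr_plaquette w p).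
Proof.
rewrite (_ : (fun w => _) = fun w : C =>
    \sum_i part false (rep_path (fun g : G => \val g) (plaquette_path p) w i i)).
  by apply: regular_sum => i; apply: mx_regular_path; exact: val_unitary_rep.
by apply/funext => w; rewrite /Re_tr_plaquette val_holonomy -(part_sum false).
Qed.

Lemma Re_tr_plaquette_upd w e x p : \val e \notin plaquette_edges p ->
  Re_tr_plaquette (upd w e x) p = Re_tr_plaquette w p.
Proof. by move=> ep; rewrite /Re_tr_plaquette !val_holonomy rep_path_upd. Qed.

Lemma finite_touching s : finite_set (touching s).
Proof.
(* A plaquette containing [e] has its lowest corner at the source of [e], or one step before it in
   one of its two directions; [insub] discards the pairs of directions that are not increasing. *)
pose l : seq (plaquette d) := pmap insub (flatten [seq flatten [seq
  [:: ((\val e).1, k.1, k.2); ((\val e).1 - step k.1, k.1, k.2);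
      ((\val e).1 - step k.2, k.1, k.2)] | k <- enum {: 'I_d * 'I_d}] | e <- s]).
apply: (@sub_finite_set _ _ [set` l]); last exact: finite_seq.
move=> p [_ [e es ep]]; rewrite /= mem_pmap_sub.
apply/flatten_mapP; exists e => //.
apply/flatten_mapP; case: p ep => -[[x i] j] ij /= ep.
exists (i, j); first by rewrite mem_enum.
move: ep; rewrite /plaquette_edges/= !inE /= => /or4P[]/eqP ->/=.
- by rewrite eqxx.
- by rewrite addrK eqxx orbT.
- by rewrite addrK eqxx !orbT.
- by rewrite eqxx.
Qed.

Definition weight s w : R := expR (beta * \sum_(p \in touching s) Re_tr_plaquette w p).

Lemma regular_fsum (A : set (plaquette d)) (f : plaquette d -> C -> R) : finite_set A ->
  (forall p, regular (f p)) -> regular (fun w => \sum_(p \in A) f p w).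
Proof.
by move=> fA rf; under eq_fun do rewrite fsbig_finite//; exact: regular_sum.
Qed.

Lemma regular_weight s : regular (weight s).
Proof.
apply: regular_expR; apply: regularM; first exact: regular_cst.
by apply: regular_fsum; [exact: finite_touching|exact: regular_Re_tr].
Qed.

Lemma weight_gt0 s w : 0 < weight s w. Proof. exact: expR_gt0. Qed.

Lemma weight_lb s : exists2 c, 0 < c & forall w, c <= weight s w.
Proof.
have : regular (fun w : C => beta * \sum_(p \in touching s) Re_tr_plaquette w p).
  apply: regularM; first exact: regular_cst.
  by apply: regular_fsum; [exact: finite_touching|exact: regular_Re_tr].
move=> [_ _ [M HM]]; exists (expR (- M)) => [|w]; first exact: expR_gt0.
by rewrite ler_expR; have := HM w; rewrite ler_norml => /andP[].
Qed.

Lemma touching_sub s t : {subset s <= t} -> touching s `<=` touching t.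
Proof. by move=> st p [pD [e es ep]]; split=> //; exists e => //; exact: st. Qed.

(** [V] collects the plaquettes that touch [t] but not [s], so it is constant in the edges of [s]
    and can be pulled out when these are integrated. *)
Lemma weight_split s t : {subset s <= t} -> exists V : C -> R,
  [/\ regular V, forall w, 0 <= V w, forall e, e \in s -> forall w x, V (upd w e x) = V w
    & forall w, weight t w = V w * weight s w].
Proof.
move=> st; exists (fun w =>
  expR (beta * \sum_(p \in touching t `\` touching s) Re_tr_plaquette w p)).
have fD : finite_set (touching t `\` touching s).
  by apply: sub_finite_set (finite_touching t) => p [].
split.
- apply: regular_expR; apply: regularM; first exact: regular_cst.
  by apply: regular_fsum => //; exact: regular_Re_tr.
- by move=> w; exact: expR_ge0.
- move=> e es w x; congr (expR (_ * _)); apply: eq_fsbigr => p.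
  rewrite inE => -[[pD _] ps]; apply: Re_tr_plaquette_upd; apply/negP => ep.
  by apply: ps; split => //; exists e.
- move=> w; rewrite /weight -expRD -mulrDr; congr (expR (_ * _)).
  rewrite addrC -fsbigU//=.
  + by rewrite setDUK//; exact: touching_sub.
  + exact: finite_touching.
  + by move=> p [ps [_]].
Qed.

End gibbs_weight.

Section gibbs_operator.
Variables (R : realType) (n : nat) (G : gaugeGroup R n).
Variables (d : nat) (D : set (edge d)) (haar : probability G R) (beta : R).
Local Notation C := (config G D).
Local Notation E := (set_type D).
Implicit Types (w : C) (e : E) (s t : seq E) (F H : C -> \bar R) (f : C -> R).

Definition partition_function s w : R := rresamples haar s (weight beta s) w.

Lemma regular_partition_function s : regular (partition_function s).
Proof. by apply: regular_rresamples; exact: regular_weight. Qed.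

Lemma partition_function_lb s : exists2 c, 0 < c & forall w, c <= partition_function s w.
Proof.
have [c c0 cW] := weight_lb G beta s; exists c => // w.
rewrite -(rresamples_cst haar s c w); apply: le_rresamples => //.
  exact: regular_cst.
exact: regular_weight.
Qed.

Lemma partition_function_gt0 s w : 0 < partition_function s w.
Proof. by have [c c0 cZ] := partition_function_lb s; exact: lt_le_trans (cZ w). Qed.

(** The Gibbs operator exists in two versions: this one on regular functions, for continuity and
    limits along ultrafilters, and [gibbs_op] on nonnegative extended functions, for monotone
    convergence. [EFin_gibbs_op] identifies them. *)
Definition rgibbs_op s f w : R :=
  (partition_function s w)^-1 * rresamples haar s (fun w => weight beta s w * f w) w.

Lemma regular_rgibbs_op s f : regular f -> regular (rgibbs_op s f).
Proof.
move=> rf; apply: regularM; last first.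
  by apply: regular_rresamples; apply: regularM => //; exact: regular_weight.
have [c c0 cZ] := partition_function_lb s.
by apply: (regular_inv c0 cZ); exact: regular_partition_function.
Qed.

Local Open Scope ereal_scope.

Definition weighted s F w := (weight beta s w)%:E * F w.

Definition gibbs_op s F w :=
  ((partition_function s w)^-1)%:E * resamples haar s (weighted s F) w.

Lemma mge0_regular f : regular f -> (forall w, (0 <= f w)%R) -> mge0 (EFin \o f).
Proof.
by move=> [mf _ _] f0; split=> [|w]; [exact/measurable_EFinP|rewrite lee_fin].
Qed.

Lemma mge0M F H : mge0 F -> mge0 H -> mge0 (fun w => F w * H w).
Proof.
move=> [mF F0] [mH H0]; split=> [|w]; first exact: emeasurable_funM.
by rewrite mule_ge0.
Qed.

Lemma mge0D F H : mge0 F -> mge0 H -> mge0 (fun w => F w + H w).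
Proof.
move=> [mF F0] [mH H0]; split=> [|w]; first exact: emeasurable_funD.
by rewrite adde_ge0.
Qed.

Lemma mge0_cst (c : \bar R) : 0 <= c -> mge0 (fun _ : C => c).
Proof. by move=> c0; split=> //; exact: measurable_cst. Qed.

Lemma mge0_indic (A : set C) : measurable A -> mge0 (fun w => (\1_A w)%:E).
Proof.
by move=> mA; split=> [|w]; [exact/measurable_EFinP/measurable_indic|rewrite lee_fin].
Qed.

Lemma mge0_weight s : mge0 (EFin \o weight (G := G) beta s).
Proof.
apply: mge0_regular; first exact: regular_weight.
by move=> w; rewrite ltW// weight_gt0.
Qed.

Lemma mge0_weighted s F : mge0 F -> mge0 (weighted s F).
Proof. by move=> mF; apply: mge0M => //; exact: mge0_weight. Qed.

Let mge0_invZ s : mge0 (fun w => ((partition_function s w)^-1)%:E).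
Proof.
have [c c0 cZ] := partition_function_lb s.
apply: (mge0_regular (regular_inv c0 cZ (regular_partition_function s))) => w.
by rewrite invr_ge0 ltW// partition_function_gt0.
Qed.

Lemma mge0_gibbs_op s F : mge0 F -> mge0 (gibbs_op s F).
Proof.
by move=> mF; apply: mge0M => //; apply: mge0_resamples; exact: mge0_weighted.
Qed.

Lemma EFin_gibbs_op s f : regular f -> gibbs_op s (EFin \o f) = EFin \o rgibbs_op s f.
Proof.
move=> rf; apply/funext => w; rewrite /gibbs_op /= EFinM; congr (_ * _).
rewrite (_ : weighted s _ = EFin \o (fun w => weight beta s w * f w)%R) //.
by rewrite EFin_rresamples//; apply: regularM => //; exact: regular_weight.
Qed.

Lemma indeps_partition_function s : indeps s (fun w => (partition_function s w)%:E).
Proof.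
rewrite (_ : (fun w => _) = resamples haar s (EFin \o weight beta s)).
  exact: indeps_resamples.
by rewrite EFin_rresamples//; exact: regular_weight.
Qed.

Lemma indeps_gibbs_op s F : indeps s (gibbs_op s F).
Proof.
move=> e es w x; rewrite /gibbs_op (@indeps_resamples _ _ _ _ _ haar s _ e es); congr (_%:E * _).
by have [->] := indeps_partition_function es w x.
Qed.

Lemma gibbs_opM s F H : mge0 F -> mge0 H -> indeps s H ->
  gibbs_op s (fun w => H w * F w) = (fun w => H w * gibbs_op s F w).
Proof.
move=> mF mH iH; apply/funext => w; rewrite /gibbs_op muleCA; congr (_ * _).
rewrite (_ : weighted s _ = fun w => H w * weighted s F w).
  by rewrite resamplesM//; exact: mge0_weighted.
by apply/funext => w'; rewrite /weighted muleCA.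
Qed.

Lemma gibbs_opD s F H : mge0 F -> mge0 H ->
  gibbs_op s (fun w => F w + H w) = (fun w => gibbs_op s F w + gibbs_op s H w).
Proof.
move=> mF mH; apply/funext => w; rewrite /gibbs_op -ge0_muleDr; last 2 first.
- exact: (mge0_resamples haar s (mge0_weighted s mF)).2.
- exact: (mge0_resamples haar s (mge0_weighted s mH)).2.
congr (_ * _); rewrite -(congr1 (@^~ w) (resamplesD _ _ (mge0_weighted s mF) (mge0_weighted s mH))).
congr resamples; apply/funext => w'.
by rewrite /weighted ge0_muleDr//; [exact: mF.2|exact: mH.2].
Qed.

Lemma gibbs_op_indep_id s H : mge0 H -> indeps s H -> gibbs_op s H = H.
Proof.
move=> mH iH; have := gibbs_opM (mge0_cst lee01) mH iH.
under eq_fun do rewrite mule1; move=> ->; apply/funext => w.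
rewrite (_ : gibbs_op s _ w = 1) ?mule1// /gibbs_op.
rewrite (_ : weighted s _ = EFin \o weight beta s); last first.
  by apply/funext => w'; rewrite /weighted mule1.
rewrite EFin_rresamples /=; last exact: regular_weight.
by rewrite -EFinM mulVf// gt_eqF// partition_function_gt0.
Qed.

Lemma gibbs_op_cst s (c : \bar R) : 0 <= c -> gibbs_op s (fun _ : C => c) = fun=> c.
Proof. by move=> c0; apply: gibbs_op_indep_id => //; exact: mge0_cst. Qed.

Lemma gibbs_op_lim s (F_ : nat -> C -> \bar R) F : (forall k, mge0 (F_ k)) ->
  (forall w, nondecreasing_seq (F_^~ w)) -> (forall w, F_ k w @[k --> \oo] --> F w) ->
  mge0 F ->
  [/\ forall w, nondecreasing_seq (fun k => gibbs_op s (F_ k) w) &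
     forall w, gibbs_op s (F_ k) w @[k --> \oo] --> gibbs_op s F w].
Proof.
move=> mF_ nF_ cF_ mF.
have nW w : nondecreasing_seq (fun k => weighted s (F_ k) w).
  by move=> k l kl; rewrite /weighted lee_pmul2l ?lte_fin ?weight_gt0//; exact: nF_.
have cW w : weighted s (F_ k) w @[k --> \oo] --> weighted s F w by exact: cvgeMl.
have [nd cv] := resamples_lim haar s (fun k => mge0_weighted s (mF_ k)) nW cW
  (mge0_weighted s mF).
split=> w; last exact: cvgeMl.
move=> k l kl; rewrite /gibbs_op lee_pmul2l ?lte_fin ?invr_gt0 ?partition_function_gt0//.
exact: nd.
Qed.

(** Consistency of the specification. The weight of [t] is [V] times that of [s]; resampling [s]
    first leaves [V] and [gibbs_op s F] alone and turns the weight of [s] into its partition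
    function, which cancels the normalization. *)
Lemma gibbs_op_sub s t F : mge0 F -> {subset s <= t} ->
  gibbs_op t (gibbs_op s F) = gibbs_op t F.
Proof.
move=> mF st; apply/funext => w; rewrite /gibbs_op; congr (_ * _).
have [V [rV V0 iV WV]] := weight_split G beta st.
have mV : mge0 (EFin \o V) by exact: mge0_regular.
have iV' : indeps s (EFin \o V) by move=> e es w' x /=; rewrite iV.
have mK := mge0_gibbs_op s mF; have iK := @indeps_gibbs_op s F.
have mR := mge0_resamples haar s (mge0_weighted s mF).
have wtE H : mge0 H -> indeps s H -> weighted t (fun w => H w) =
    fun w' => (V w')%:E * H w' * (EFin \o weight beta s) w'.
  by move=> _ _; apply/funext => w'; rewrite /weighted WV EFinM /= -!muleA [H _ * _]muleC.
transitivity (resamples haar t (fun w' => (V w')%:E * resamples haar s (weighted s F) w') w).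
  rewrite -(resamples_sub _ (mge0_weighted t mK) st); congr resamples.
  rewrite wtE// resamplesM; last 3 first.
  - exact: mge0_weight.
  - exact: mge0M.
  - by move=> e es w' x; rewrite iV//; congr (_ * _); exact: iK.
  apply/funext => w'; rewrite -muleA; congr (_ * _).
  rewrite EFin_rresamples; last exact: regular_weight.
  rewrite /gibbs_op muleC muleA /= -EFinM divff ?mul1e//.
  by rewrite gt_eqF// partition_function_gt0.
rewrite -(resamples_sub _ (mge0_weighted t mF) st); congr resamples.
rewrite -resamplesM//; last exact: mge0_weighted.
by congr resamples; apply/funext => w'; rewrite /weighted WV EFinM muleA.
Qed.

End gibbs_operator.

(** * Specifications *)

Section specification.
Variables (R : realType) (n : nat) (G : gaugeGroup R n).
Variables (d : nat) (D : set (edge d)) (haar : probability G R) (beta : R).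
Local Notation C := (config G D).
Local Notation E := (set_type D).
Local Notation K := (@gibbs_op _ _ _ _ D haar beta).
Implicit Types (w : C) (e : E) (s t : seq E) (F H : C -> \bar R) (f : C -> R).
Local Open Scope ereal_scope.

Definition restrict s w : (size s).-tuple G := map_tuple w (in_tuple s).

Lemma measurable_restrict s : measurable_fun setT (@restrict s).
Proof.
apply/measurable_fun_tnthP => i.
rewrite (_ : _ \o _ = fun w : C => w (tnth (in_tuple s) i)).
  exact: measurable_coord.
by apply/funext => w /=; rewrite tnth_map.
Qed.

Lemma restrict_glue s w (eta : (size s).-tuple G) : uniq s ->
  restrict s (Defs.glue w eta) = eta.
Proof.
move=> us; apply: eq_from_tnth => i; rewrite tnth_map /Defs.glue (tnth_nth (w (tnth (in_tuple s) i))).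
by rewrite (tnth_nth (tnth (in_tuple s) i)) /= index_uniq.
Qed.

Lemma mge0_indic_restrict s (A : set ((size s).-tuple G)) : measurable A ->
  mge0 (fun w : C => (\1_A (restrict s w))%:E : \bar R).
Proof.
move=> mA; have mB : measurable (@restrict s @^-1` A).
  by have := @measurable_restrict s measurableT A mA; rewrite setTI.
rewrite (_ : (fun w => _) = fun w => (\1_(@restrict s @^-1` A) w)%:E).
  exact: mge0_indic.
by apply/funext => w; rewrite !indicE.
Qed.

(** The kernel is a quotient of real integrals while the operator is extended-valued; they agree
    because the weight is bounded, which makes the numerator finite. *)
Lemma gibbs_kernelE s w (A : set ((size s).-tuple G)) : uniq s -> measurable A ->
  (gibbs_kernel haar beta w A)%:E = K s (fun w => (\1_A (restrict s w))%:E) w.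
Proof.
move=> us mA; rewrite /gibbs_op /gibbs_kernel.
have rW := regular_weight G beta s.
have mW := mge0_weight G beta s.
have ZE : (\int[tuple_probability haar (size s)]_eta gibbs_weight beta w eta)%R =
    partition_function haar beta s w.
  rewrite /Rintegral (_ : \int[_]_x _ = resamples haar s (EFin \o weight beta s) w).
    by rewrite EFin_rresamples.
  by rewrite resamples_glue.
rewrite ZE mulrC EFinM; congr (_ * _).
have mI : mge0 (fun w : C => (\1_A (restrict s w))%:E : \bar R).
  exact: mge0_indic_restrict.
rewrite resamples_glue//; last exact: mge0_weighted.
rewrite /Rintegral.
have -> : \int[tuple_probability haar (size s)]_(eta in A) (gibbs_weight beta w eta)%:E =
    resamples haar s (weighted beta s (fun w => (\1_A (restrict s w))%:E)) w.
  rewrite resamples_glue//; last exact: mge0_weighted.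
  rewrite integral_mkcond/=; apply: eq_integral => eta _.
  rewrite /weighted restrict_glue// patchE indicE; case: (eta \in A).
    by rewrite mule1.
  by rewrite mule0.
rewrite -resamples_glue//; last exact: mge0_weighted.
rewrite fineK//.
have [_ _ [M HM]] := rW.
rewrite ge0_fin_numE; last by apply: (mge0_resamples _ _ _).2; exact: mge0_weighted.
apply: (@le_lt_trans _ _ (resamples haar s (EFin \o (fun=> M)) w)).
  apply: le_resamples; first exact: mge0_weighted.
    apply: mge0_regular; first exact: regular_cst.
    by move=> w'; exact: le_trans (HM w').
  move=> w'; rewrite /weighted/= -EFinM lee_fin indicE.
  have := HM w'; rewrite ger0_norm ?(ltW (weight_gt0 _ _ _))// => H.
  by case: (_ \in _); rewrite ?mulr1 ?mulr0// (le_trans _ H)// ltW// weight_gt0.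
rewrite EFin_rresamples ?ltry//; exact: regular_cst.
Qed.

Section invariance.
Variable mu : probability C R.

(** The integrated DLR equation. Unlike the conditional form in [specified], it can be checked on a
    class of test functions and passes to limits. *)
Definition gibbs_invariant s := forall F, mge0 F ->
  \int[mu]_w F w = \int[mu]_w K s F w.

Lemma integral_gibbs_op_setC s (A : set C) : measurable A ->
  mu A = \int[mu]_w K s (fun w => (\1_A w)%:E) w ->
  mu (~` A) = \int[mu]_w K s (fun w => (\1_(~` A) w)%:E) w.
Proof.
move=> mA muA; have mA' : measurable (~` A) by exact: measurableC.
have fA : mu A \is a fin_num by exact: fin_num_measure.
have H : mu A + \int[mu]_w K s (fun w => (\1_(~` A) w)%:E) w = 1.
  have k1 := mge0_gibbs_op haar beta s (mge0_indic mA).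
  have k2 := mge0_gibbs_op haar beta s (mge0_indic mA').
  rewrite muA -ge0_integralD//; last 4 first.
  - by move=> w _; exact: k1.2.
  - exact: k1.1.
  - by move=> w _; exact: k2.2.
  - exact: k2.1.
  rewrite -(congr1 (fun F => \int[mu]_w F w)
    (gibbs_opD haar beta s (mge0_indic mA) (mge0_indic mA'))).
  rewrite (_ : (fun w => (\1_A w)%:E + _) = fun=> 1).
    rewrite gibbs_op_cst//; exact: integral_probability_cst.
  by apply/funext => w; rewrite !indicE in_setC; case: (w \in A); rewrite /= ?adde0 ?add0e.
rewrite probability_setC// -H addeAC subee ?add0e//.
Qed.

Lemma integral_gibbs_op_bigcup s (A : (set C)^nat) : (forall k, measurable (A k)) ->
  trivIset setT A ->
  (forall k, mu (A k) = \int[mu]_w K s (fun w => (\1_(A k) w)%:E) w) ->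
  mu (\bigcup_k A k) = \int[mu]_w K s (fun w => (\1_(\bigcup_k A k) w)%:E) w.
Proof.
move=> mA tA muA.
pose B k := \big[setU/set0]_(i < k.+1) A i.
have mB k : measurable (B k) by exact: bigsetU_measurable.
have UE : \bigcup_k B k = \bigcup_k A k by exact: bigcup_bigsetU_bigcup.
have mU : measurable (\bigcup_k A k) by exact: bigcupT_measurable.
have ndB : nondecreasing_seq B.
  by move=> k l kl; apply/subsetPset; apply: subset_bigsetU; rewrite ltnS.
have mK (X : set C) : measurable X -> mge0 (K s (fun w => (\1_X w)%:E)).
  by move=> mX; apply: mge0_gibbs_op; exact: mge0_indic.
have muB k : mu (B k) = \int[mu]_w K s (fun w => (\1_(B k) w)%:E) w.
  elim: k => [|k IH]; first by rewrite /B big_ord1 muA.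
  have BE : B k.+1 = B k `|` A k.+1 by rewrite /B big_ord_recr.
  have BA : B k `&` A k.+1 = set0.
    rewrite /B big_distrl/= big1// => i _.
    apply: contrapT => /eqP/set0P H.
    by have := tA i k.+1 I I H => ik; have := ltn_ord i; rewrite ik ltnn.
  rewrite BE; have -> : mu (B k `|` A k.+1) = mu (B k) + mu (A k.+1) by exact: measureU.
  rewrite IH muA -ge0_integralD//; last 4 first.
  - by move=> w _; exact: (mK _ (mB k)).2.
  - exact: (mK _ (mB k)).1.
  - by move=> w _; exact: (mK _ (mA k.+1)).2.
  - exact: (mK _ (mA k.+1)).1.
  rewrite -(congr1 (fun F => \int[mu]_w F w)
    (gibbs_opD haar beta s (mge0_indic (mB k)) (mge0_indic (mA k.+1)))).
  apply: eq_integral => w _; congr (K s _ w); apply/funext => w'.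
  rewrite -EFinD; congr EFin; rewrite !indicE in_setU.
  have := congr1 (fun X : set C => w' \in X) BA; rewrite in_setI in_set0.
  by case: (w' \in B k); case: (w' \in A _); rewrite ?addr0 ?add0r.
have cB : mu (B k) @[k --> \oo] --> mu (\bigcup_k A k).
  by rewrite -UE; apply: nondecreasing_cvg_mu => //; rewrite UE.
have cB' : \int[mu]_w K s (fun w => (\1_(B k) w)%:E) w @[k --> \oo] --> mu (\bigcup_k A k).
  by apply: cvg_trans cB; apply: near_eq_cvg; apply: nearW => k; rewrite -muB.
apply: (cvg_unique _ cB') => //.
have [] := @gibbs_op_lim _ _ _ _ _ haar beta s (fun k w => (\1_(B k) w)%:E)
  (fun w => (\1_(\bigcup_k A k) w)%:E) (fun k => mge0_indic (mB k)) _ _ (mge0_indic mU).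
- move=> w k l /ndB /subsetPset Bkl; rewrite lee_fin !indicE ler_nat.
  by case: (boolP (w \in B k)) => //; rewrite inE => /Bkl; rewrite -inE => ->.
- move=> w; rewrite indicE.
  have [[i _ Aiw]|nA] := pselect ((\bigcup_k A k) w).
    rewrite mem_set; last by exists i.
    apply: cvg_near_cst; exists i => // k /= ik; rewrite indicE mem_set//.
    rewrite /B -(bigcup_mkord _ A); exists i => //=; rewrite ltnS//.
  rewrite memNset//; apply: cvg_near_cst; apply: nearW => k; rewrite indicE memNset//.
  by rewrite -UE in nA => Bk; apply: nA; exists k.
move=> nd cv; rewrite (_ : (fun w => K s (fun w => (\1_(\bigcup_k A k) w)%:E) w) =
   fun w => limn (fun k => K s (fun w => (\1_(B k) w)%:E) w)).
  apply: cvg_monotone_convergence => //.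
  - by move=> k; exact: (mK _ (mB k)).1.
  - by move=> k w _; exact: (mK _ (mB k)).2.
by apply/funext => w; apply/esym/cvg_lim.
Qed.

(** The events satisfying the equation form a Dynkin class, so a generating class closed under
    intersection suffices; functions follow by [ge0_measurable_ind]. *)
Lemma gibbs_invariant_gen s (Gs : set (set C)) :
  @measurable _ C = <<s Gs >> -> setI_closed Gs ->
  (forall A, Gs A -> mu A = \int[mu]_w K s (fun w => (\1_A w)%:E) w) ->
  gibbs_invariant s.
Proof.
move=> mGs GsI GsE.
have setE (A : set C) : measurable A ->
    mu A = \int[mu]_w K s (fun w => (\1_A w)%:E) w.
  move=> mA; have : <<s Gs >> A by rewrite -mGs.
  apply: (@dynkin_induction _ C Gs
    (fun A => mu A = \int[mu]_w K s (fun w => (\1_A w)%:E) w) mGs GsI _ GsE).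
  - rewrite probability_setT (_ : K s _ = fun=> 1) ?integral_probability_cst//.
    rewrite -(gibbs_op_cst haar beta s lee01); congr gibbs_op.
    by apply/funext => w; rewrite indicT.
  - by move=> X mX; exact: integral_gibbs_op_setC.
  - by move=> X mX tX; exact: integral_gibbs_op_bigcup.
move=> F [mF F0]; move: F mF F0; apply: ge0_measurable_ind.
- by move=> A mA; rewrite -setE// integral_indic// setIT.
- move=> f k k0 mf f0 IH.
  have mk : mge0 (fun _ : C => k%:E) by exact: mge0_cst.
  rewrite ge0_integralZl// IH gibbs_opM//.
  have mKf := @mge0_gibbs_op _ _ _ _ _ haar beta s f (conj mf f0).
  by rewrite ge0_integralZl//; [exact: mKf.1|move=> w _; exact: mKf.2].
- move=> f g mf f0 mg g0 IHf IHg.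
  have mKf := @mge0_gibbs_op _ _ _ _ _ haar beta s f (conj mf f0).
  have mKg := @mge0_gibbs_op _ _ _ _ _ haar beta s g (conj mg g0).
  rewrite ge0_integralD// IHf IHg gibbs_opD// ge0_integralD//.
  + by move=> w _; exact: mKf.2.
  + exact: mKf.1.
  + by move=> w _; exact: mKg.2.
  + exact: mKg.1.
- move=> f_ f mf_ f0_ ndf_ cf_ IH.
  have mf : measurable_fun setT f.
    by apply: (emeasurable_fun_cvg f_) => // w _; exact: cf_.
  have f0 w : 0 <= f w by apply: (cvge_to_ge (cf_ w)); exact: nearW.
  have mK k : mge0 (K s (f_ k)) by apply: mge0_gibbs_op; split.
  have [ndK cK] := gibbs_op_lim haar beta s (fun k => conj (mf_ k) (f0_ k)) ndf_ cf_ (conj mf f0).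
  have c1 : \int[mu]_w f_ k w @[k --> \oo] --> \int[mu]_w f w.
    rewrite (_ : f = fun w => limn (f_^~ w)).
      by apply: cvg_monotone_convergence => // w _; exact: ndf_.
    by apply/funext => w; apply/esym/cvg_lim.
  have c1' : \int[mu]_w K s (f_ k) w @[k --> \oo] --> \int[mu]_w f w.
    by apply: cvg_trans c1; apply: near_eq_cvg; apply: nearW => k; rewrite /= IH.
  apply: (cvg_unique _ c1') => //.
  rewrite (_ : K s f = fun w => limn (fun k => K s (f_ k) w)).
    apply: cvg_monotone_convergence => //.
    + by move=> k; exact: (mK k).1.
    + by move=> k w _; exact: (mK k).2.
  by apply/funext => w; apply/esym/cvg_lim.
Qed.

End invariance.

End specification.

(** * Equivalent forms of the DLR equation *)

Section specified_invariant.
Variables (R : realType) (n : nat) (G : gaugeGroup R n).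
Variables (d : nat) (D : set (edge d)) (haar : probability G R) (beta : R).
Local Notation C := (config G D).
Local Notation E := (set_type D).
Local Notation K := (@gibbs_op _ _ _ _ D haar beta).
Implicit Types (w : C) (e : E) (s t : seq E) (F H : C -> \bar R) (f : C -> R).
Variable mu : probability C R.
Local Open Scope ereal_scope.

Let exterior s : set (set C) := <<s coordinate_sets [set e | e \notin s] >>.

Lemma exterior_upd s (B : set C) e w x : exterior s B -> e \in s ->
  B (upd w e x) <-> B w.
Proof.
move=> BB es; move: B BB w.
apply: (@smallest_sub _ _ _ [set B : set C | forall w, B (upd w e x) <-> B w]).
- split.
  + by move=> w.
  + by move=> A HA w; rewrite !setTD /setC /=; split=> nA /(HA w).
  + by move=> A HA w; split=> -[k _ Ak]; exists k => //; exact/(HA k w).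
- move=> _ [f fs [A mA <-]] w; rewrite !setTI /= /upd.
  by case: eqVneq fs => [->|//]; rewrite /= es.
Qed.

Lemma exterior_measurable s (B : set C) : exterior s B -> measurable B.
Proof.
have sub : coordinate_sets (G := G) [set e | e \notin s] `<=` coordinate_sets setT.
  by move=> X [e _ eX]; exists e.
exact: (sub_sigma_algebra2 sub).
Qed.

Lemma exterior_indeps s (B : set C) : exterior s B -> indeps s (fun w => (\1_B w)%:E : \bar R).
Proof.
move=> BB e es w x; rewrite !indicE; congr (_%:R)%:E; apply: congr1.
by apply/idP/idP; rewrite !inE => /(exterior_upd w x BB es).
Qed.

Let gibbs_op_cylinder s A B : uniq s -> measurable A -> exterior s B ->
  \int[mu]_w K s (fun w => (\1_(B `&` [set w | A (restrict s w)]) w)%:E) w =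
  \int[mu]_(w in B) (gibbs_kernel haar beta w A)%:E.
Proof.
move=> us mA BB; have mB := exterior_measurable BB.
rewrite [RHS]integral_mkcond; apply: eq_integral => w _.
rewrite (_ : (fun w => _) = fun w => (\1_B w)%:E * (\1_A (restrict s w))%:E).
  rewrite gibbs_opM//; last 3 first.
  - exact: mge0_indic_restrict.
  - exact: mge0_indic.
  - exact: exterior_indeps.
  rewrite patchE -gibbs_kernelE// indicE; case: (w \in B); first by rewrite mul1e.
  by rewrite mul0e.
apply/funext => w'; rewrite -EFinM; congr EFin; rewrite !indicE in_setI.
by rewrite -mulnb natrM.
Qed.

(** [specified] is the equation for the intersection of an event exterior to [s] with a cylinder
    over [s]. Such intersections are stable under intersection, and they generate because each
    coordinate is either in [s] or exterior. *)
Lemma specified_invariant (F : set (edge d)) s : specified haar beta F mu ->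
  uniq s -> (forall e, e \in s -> F (\val e)) -> gibbs_invariant haar beta mu s.
Proof.
move=> Fmu us sF.
apply: (@gibbs_invariant_gen _ _ _ _ _ _ _ _ _ [set X | exists A B, [/\ measurable A,
   exterior s B & X = B `&` [set w | A (restrict s w)]]]).
- rewrite eqEsubset; split.
    apply: smallest_sub; first exact: smallest_sigma_algebra.
    move=> _ [e _ [A mA <-]]; rewrite setTI; apply: sub_sigma_algebra.
    have [es|es] := boolP (e \in s).
      have es' : (index e s < size s)%N by rewrite index_mem.
      pose i := Ordinal es'.
      exists [set eta : (size s).-tuple G | A (tnth eta i)], setT; split.
      + by have := @measurable_tnth _ G _ i measurableT A mA; rewrite setTI.
      + exact: (@measurableT _ (g_sigma_algebraType (coordinate_sets _))).
      + rewrite setTI; apply/funext => w /=; rewrite tnth_map (tnth_nth e)/=.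
        by rewrite nth_index.
    exists setT, ((fun w : C => w e) @^-1` A); split.
    + exact: measurableT.
    + by apply: sub_sigma_algebra; exists e => //; exists A => //; rewrite setTI.
    + by rewrite eqEsubset; split=> w //= [].
  apply: smallest_sub; first exact: (sigma_algebra_measurable C).
  move=> _ [A [B [mA BB ->]]]; apply: measurableI; first exact: exterior_measurable BB.
  by have := @measurable_restrict _ _ _ _ _ s measurableT A mA; rewrite setTI.
- move=> _ _ [A [B [mA BB ->]]] [A' [B' [mA' BB' ->]]].
  exists (A `&` A'), (B `&` B'); split.
  + exact: measurableI.
  + exact: (@measurableI _ (g_sigma_algebraType (coordinate_sets _)) B B' BB BB').
  + by rewrite setIACA.
- move=> _ [A [B [mA BB ->]]]; rewrite gibbs_op_cylinder//; exact: Fmu.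
Qed.

Lemma invariant_specified (F : set (edge d)) :
  (forall s, uniq s -> (forall e, e \in s -> F (\val e)) -> gibbs_invariant haar beta mu s) ->
  specified haar beta F mu.
Proof.
move=> Fmu s us sF A mA B BB; rewrite -gibbs_op_cylinder//.
have mX : measurable (B `&` [set w | A (restrict s w)]).
  apply: measurableI; first exact: exterior_measurable BB.
  by have := @measurable_restrict _ _ _ _ _ s measurableT A mA; rewrite setTI.
by rewrite -(Fmu s us sF _ (mge0_indic mX)) integral_indic// setIT.
Qed.

End specified_invariant.

Section regular_invariance.
Variables (R : realType) (n : nat) (G : gaugeGroup R n).
Variables (d : nat) (D : set (edge d)) (haar : probability G R) (beta : R).
Local Notation C := (config G D).
Local Notation E := (set_type D).
Local Notation K := (@gibbs_op _ _ _ _ D haar beta).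
Implicit Types (w : C) (e : E) (s t : seq E).

Definition open_cylinder : set (set C) :=
  [set X | exists (t : seq E) (O : E -> set G), (forall e, open (O e)) /\
     X = [set w | forall e, e \in t -> O e (w e)]].

Lemma open_cylinderI : setI_closed open_cylinder.
Proof.
move=> _ _ [r [ O [oO ->]]] [r' [ O' [oO' ->]]].
exists (r ++ r'), (fun e => (if e \in r then O e else setT) `&`
                            (if e \in r' then O' e else setT)); split.
  by move=> e; apply: openI; case: ifP => _ //; exact: openT.
rewrite eqEsubset; split=> w /=.
  by move=> [Ow Ow'] e _; split; case: ifP => // ?; [exact: Ow|exact: Ow'].
move=> H; split=> e et; have [] := H e _; rewrite ?mem_cat ?et ?orbT//.
Qed.

Lemma measurable_open_cylinder : @measurable _ C = <<s open_cylinder >>.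
Proof.
rewrite eqEsubset; split.
  apply: smallest_sub; first exact: smallest_sigma_algebra.
  move=> _ [e _ [A mA <-]]; rewrite setTI.
  move: A mA; apply: smallest_sub; last first.
    move=> O oO; apply: sub_sigma_algebra; exists [:: e], (fun=> O); split=> //.
    rewrite eqEsubset; split=> w /=; first by move=> Ow f; rewrite inE => /eqP ->.
    by apply; rewrite mem_head.
  split.
  - exact: (@measurable0 _ (g_sigma_algebraType open_cylinder)).
  - move=> A HA; rewrite setTD.
    exact: (@measurableC _ (g_sigma_algebraType open_cylinder)).
  - move=> A HA; rewrite preimage_bigcup.
    exact: (@bigcupT_measurable _ (g_sigma_algebraType open_cylinder)).
apply: smallest_sub; first exact: (sigma_algebra_measurable C).
move=> _ [r [ O [oO ->]]].
rewrite (_ : [set w | _] = \bigcap_(e in [set` r]) ((fun w : C => w e) @^-1` O e)).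
  apply: fin_bigcap_measurable => // e _.
  have mO : measurable (O e) by exact: sub_sigma_algebra.
  by have := measurable_coord (e : E) measurableT mO; rewrite setTI.
by rewrite eqEsubset; split=> w.
Qed.

Variable mu : probability C R.

(** The indicator of an open cylinder is an increasing limit of products of continuous functions of
    single edges, and these products are regular. *)
Lemma regular_invariant s :
  (forall f, regular f -> (forall w, 0 <= f w) ->
     (\int[mu]_w (f w)%:E = \int[mu]_w K s (EFin \o f) w)%E) ->
  gibbs_invariant haar beta mu s.
Proof.
move=> rmu; apply: (gibbs_invariant_gen measurable_open_cylinder open_cylinderI).
move=> _ [r [ O [oO ->]]].
have /choice[phi Hphi] := fun e => open_indic_approx (oO e).
set X := [set w : C | _].
have mX : measurable X.
  rewrite measurable_open_cylinder; apply: sub_sigma_algebra; by exists r, O.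
pose f k w := \prod_(e <- r) phi e k (w e).
have XE w : \1_X w = \prod_(e <- r) \1_(O e) (w e) :> R.
  rewrite indicE; have [H|nX] := pselect (X w).
    rewrite mem_set// big_seq big1// => e et; rewrite indicE mem_set//; exact: H.
  rewrite memNset//; move/existsNP: nX => [e /not_implyP[et nO]].
  rewrite (eq_bigr (fun e => \1_(O e) (w e)))//.
  apply/esym/eqP; rewrite prodf_seq_eq0; apply/hasP; exists e => //=.
  by rewrite indicE memNset.
have f0 k w : 0 <= f k w.
  by apply: prodr_ge0 => e _; have [_ /(_ k (w e))/andP[]] := Hphi e.
have rf k : regular (f k).
  rewrite /f; elim: r {X mX f f0 XE} => [|e r IH].
    by under eq_fun do rewrite big_nil; exact: regular_cst.
  under eq_fun do rewrite big_cons; apply: regularM => //.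
  have [cphi phi01 _ _] := Hphi e.
  apply: (regular_coord (phi := phi e k) e (M := 1)) => // x.
  by have /andP[? ?] := phi01 k x; rewrite ger0_norm.
have ndf w : nondecreasing_seq (f^~ w).
  move=> k l kl; apply: ler_prod => e _; have [_ phi01 nd _] := Hphi e.
  by have /andP[-> _] := phi01 k (w e); rewrite nd.
have cf w : f k w @[k --> \oo] --> (\1_X w : R).
  rewrite XE; apply: cvg_big => [|e _]; first exact: mul_continuous.
  by have [_ _ _ ] := Hphi e; exact.
have mf k : mge0 (EFin \o f k) by exact: mge0_regular.
have ndf' w : nondecreasing_seq (fun k => (EFin \o f k) w).
  by move=> k l kl; rewrite lee_fin ndf.
have cf' w : (EFin \o f k) w @[k --> \oo] --> ((\1_X w : R)%:E).
  by apply: cvg_EFin; [exact: nearW|exact: cf].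
have mI := mge0_indic mX.
have [ndK cK] := gibbs_op_lim haar beta s mf ndf' cf' mI.
have mK k : mge0 (K s (EFin \o f k)) by exact: mge0_gibbs_op.
have -> : mu X = (\int[mu]_w (\1_X w : R)%:E)%E by rewrite integral_indic// setIT.
have c1 : (\int[mu]_w (f k w)%:E)%E @[k --> \oo] --> (\int[mu]_w (\1_X w : R)%:E)%E.
  rewrite (_ : (fun w => (\1_X w : R)%:E) = fun w => limn (fun k => (f k w)%:E)).
    apply: cvg_monotone_convergence => //.
    - by move=> k; exact: (mf k).1.
    - by move=> k w _; rewrite lee_fin.
    - by move=> w _; exact: ndf'.
  by apply/funext => w; apply/esym/cvg_lim => //; exact: cf'.
have c1' : (\int[mu]_w K s (EFin \o f k) w)%E @[k --> \oo] --> (\int[mu]_w (\1_X w : R)%:E)%E.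
  by apply: cvg_trans c1; apply: near_eq_cvg; apply: nearW => k; rewrite /= rmu.
apply: (cvg_unique _ c1') => //.
rewrite (_ : (fun w => K s _ w) = fun w => limn (fun k => K s (EFin \o f k) w)).
  apply: cvg_monotone_convergence => //.
  - by move=> k; exact: (mK k).1.
  - by move=> k w _; exact: (mK k).2.
by apply/funext => w; apply/esym/cvg_lim.
Qed.

End regular_invariance.

(** * Infinite-volume limits *)

Section gibbs_prob.
Variables (R : realType) (n : nat) (G : gaugeGroup R n).
Variables (d : nat) (D : set (edge d)) (haar : probability G R) (beta : R).
Local Notation C := (config G D).
Local Notation E := (set_type D).
Local Notation K := (@gibbs_op _ _ _ _ D haar beta).
Implicit Types (w : C) (e : E) (s t : seq E) (F H : C -> \bar R).
Local Open Scope ereal_scope.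

(** The operator integrates only over configurations that agree with [w] off [s]. Elsewhere the
    function may be altered, as is done with [fix_boundary]. *)
Lemma gibbs_op_eq_glue s w F H : uniq s -> mge0 F -> mge0 H ->
  (forall eta : (size s).-tuple G, F (Defs.glue w eta) = H (Defs.glue w eta)) ->
  K s F w = K s H w.
Proof.
move=> us mF mH FH; rewrite /gibbs_op; congr (_ * _).
rewrite !resamples_glue//; [|exact: mge0_weighted|exact: mge0_weighted].
by apply: eq_integral => eta _; rewrite /weighted FH.
Qed.

Variables (s : seq E) (w : C).

Definition gibbs_prob (A : set C) : \bar R := K s (fun w' => (\1_A w')%:E) w.

Let gibbs_prob0 : gibbs_prob set0 = 0.
Proof.
rewrite /gibbs_prob (_ : (fun w => _) = fun=> 0) ?gibbs_op_cst//.
by apply/funext => w'; rewrite indic0.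
Qed.

Let gibbs_prob_ge0 (A : set C) : 0 <= gibbs_prob A.
Proof.
rewrite /gibbs_prob /gibbs_op mule_ge0 ?lee_fin ?invr_ge0 ?(ltW (partition_function_gt0 _ _ _ _))//.
(* Nonnegativity is required for every set [A], measurable or not, hence a direct induction; the
   list being resampled is separated from the list in the weight. *)
elim: s {2}s w => [|e r IH] r' w' /=.
  by rewrite /weighted mule_ge0// lee_fin ?(ltW (weight_gt0 _ _ _))// indicE.
by apply: integral_ge0 => x _; exact: IH.
Qed.

Let gibbs_prob_sigma_additive : semi_sigma_additive gibbs_prob.
Proof.
move=> A mA tA mU.
pose S k w' : \bar R := \sum_(0 <= i < k) (\1_(A i) w')%:E.
have SS k : S k.+1 = fun w' => S k w' + (\1_(A k) w')%:E.
  by apply/funext => w'; rewrite /S big_nat_recr.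
have mS k : mge0 (S k).
  elim: k => [|k IH]; last by rewrite SS; apply: mge0D => //; exact: mge0_indic.
  rewrite (_ : S 0%N = fun=> 0); first exact: mge0_cst.
  by apply/funext => w'; rewrite /S big_geq.
have KS k : \sum_(0 <= i < k) gibbs_prob (A i) = K s (S k) w.
  elim: k => [|k IH].
    rewrite big_geq// (_ : S 0%N = fun=> 0) ?gibbs_op_cst//.
    by apply/funext => w'; rewrite /S big_geq.
  by rewrite big_nat_recr//= IH SS gibbs_opD//; exact: mge0_indic.
have ndS w' : nondecreasing_seq (S^~ w').
  by apply/nondecreasing_seqP => k; rewrite SS leeDl// lee_fin.
have cS w' : S k w' @[k --> \oo] --> ((\1_(\bigcup_k A k) w')%:E : \bar R).
  rewrite indicE; have [[j _ Aj]|nA] := pselect ((\bigcup_k A k) w').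
    rewrite mem_set; last by exists j.
    apply: cvg_near_cst; exists j.+1 => // k /= jk.
    rewrite /S big_mkord (bigD1 (Ordinal jk))//= indicE mem_set//= big1 ?adde0// => i ij.
    rewrite indicE memNset// => Ai; move/negP: ij; apply; apply/eqP/val_inj.
    by apply: (tA i j I I); exists w'.
  rewrite memNset//; apply: cvg_near_cst; apply: nearW => k.
  rewrite /S big_mkord big1// => i _; rewrite indicE memNset// => Ai.
  by apply: nA; exists i.
have [_ /(_ w)] := gibbs_op_lim haar beta s mS ndS cS (mge0_indic mU).
by apply: cvg_trans; apply: near_eq_cvg; apply: nearW => k; rewrite /= KS.
Qed.

HB.instance Definition _ := isMeasure.Build _ _ _ gibbs_prob
  gibbs_prob0 gibbs_prob_ge0 gibbs_prob_sigma_additive.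

Let gibbs_prob_setT : gibbs_prob setT = 1.
Proof.
rewrite /gibbs_prob (_ : (fun w => _) = fun=> 1) ?gibbs_op_cst//.
by apply/funext => w'; rewrite indicT.
Qed.

HB.instance Definition _ := Measure_isProbability.Build _ _ _ gibbs_prob gibbs_prob_setT.

Lemma integral_gibbs_prob F : mge0 F -> \int[gibbs_prob]_w' F w' = K s F w.
Proof.
case; move: F; apply: ge0_measurable_ind.
- by move=> A mA; rewrite integral_indic// setIT.
- move=> f k k0 mf f0 IH.
  by rewrite ge0_integralZl// IH (@gibbs_opM _ _ _ _ _ haar beta s f (fun=> k%:E))//;
    exact: mge0_cst.
- by move=> f g mf f0 mg g0 IHf IHg; rewrite ge0_integralD// IHf IHg gibbs_opD.
- move=> f_ f mf_ f0_ ndf_ cf_ IH.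
  have mf : measurable_fun setT f.
    by apply: (emeasurable_fun_cvg f_) => // w' _; exact: cf_.
  have f0 w' : 0 <= f w' by apply: (cvge_to_ge (cf_ w')); exact: nearW.
  have [_ /(_ w) cK] := gibbs_op_lim haar beta s (fun k => conj (mf_ k) (f0_ k)) ndf_ cf_ (conj mf f0).
  have c1 : \int[gibbs_prob]_w' f_ k w' @[k --> \oo] --> \int[gibbs_prob]_w' f w'.
    rewrite (_ : f = fun w' => limn (f_^~ w')).
      by apply: cvg_monotone_convergence => // w' _; exact: ndf_.
    by apply/funext => w'; apply/esym/cvg_lim.
  apply: (cvg_unique _ c1) => //.
  by apply: cvg_trans cK; apply: near_eq_cvg; apply: nearW => k; rewrite /= IH.
Qed.

Lemma Rintegral_gibbs_prob (f : C -> R) : regular f -> (forall w', (0 <= f w')%R) ->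
  (\int[gibbs_prob]_w' f w')%R = rgibbs_op haar beta s f w.
Proof.
move=> rf f0; rewrite /Rintegral (integral_gibbs_prob (mge0_regular rf f0)).
by rewrite EFin_gibbs_op.
Qed.

End gibbs_prob.

(** * Limits of finite-volume measures along an ultrafilter *)

Section gibbs_limit.
Variables (R : realType) (n : nat) (G : gaugeGroup R n).
Variables (d : nat) (D : set (edge d)) (haar : probability G R) (beta : R).
Local Notation C := (config G D).
Local Notation E := (set_type D).
Local Notation K := (@gibbs_op _ _ _ _ D haar beta).
Variables (F : set (edge d)) (t_ : nat -> seq E) (w_ : nat -> C).
Hypotheses (t_uniq : forall L, uniq (t_ L)).
Hypothesis (t_F : forall L e, e \in t_ L -> F (\val e)).
Variables (U : set_system nat) (UU : UltraFilter U) (Uoo : \oo `<=` U).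
Hypothesis (t_U : forall e : E, F (\val e) -> U [set L | e \in t_ L]).

Let Q L : probability C R := gibbs_prob haar beta (t_ L) (w_ L).
Let Y : measurableType _ := g_sigma_algebraType (@measurable _ (@ultraproduct _ C U UU)).
Let P : probability Y R := ultra_measure Q Uoo.

Let ulim_ex : exists ulim : (nat -> G) -> G, forall g_, g_ L @[L --> U] --> ulim g_.
Proof.
have /choice[ul Hul] : forall g_ : nat -> G, exists g : G, g_ L @[L --> U] --> g.
  by move=> g_; exact: gauge_ultra_cvg.
by exists ul.
Qed.

Let ulim := sval (cid ulim_ex).

Let ulimP (g_ : nat -> G) : g_ L @[L --> U] --> ulim g_.
Proof. exact: svalP (cid ulim_ex) g_. Qed.

Definition limit_boundary : C := fun e => ulim (fun L => w_ L e).

(** A sequence in the ultraproduct is arbitrary off [F]. Overwriting it there by [w_ L] gives every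
    standard part, not just almost every one, the limit boundary condition; by [fix_glue] the
    finite-volume averages do not notice. *)
Let fix_boundary L (w : C) : C := fun e => if `[< F (\val e) >] then w e else w_ L e.

(** The standard part map, as a coordinatewise ultralimit. *)
Let st (y : Y) : C := fun e => ulim (fun L => fix_boundary L (y L) e).

Let measurable_fix L : measurable_fun setT (fix_boundary L).
Proof.
apply: measurable_config => e; rewrite /fix_boundary; case: asboolP => _.
  exact: measurable_coord.
exact: measurable_cst.
Qed.

Let st_cvg f (y : Y) : regular f -> f (fix_boundary L (y L)) @[L --> U] --> f (st y).
Proof. by move=> [_ cf _]; apply: cf => e; exact: ulimP. Qed.

Let fix_glue L eta : fix_boundary L (Defs.glue (s := t_ L) (w_ L) eta) = Defs.glue (w_ L) eta.
Proof.
apply/funext => e; rewrite /fix_boundary; case: asboolP => // nF.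
rewrite /Defs.glue nth_default// size_tuple memNindex//.
by apply/negP => /t_F.
Qed.

(** Measurability is stated for [f] composed with [st], as the measurability of [st] itself is
    deduced from it. *)
Let regular_limit f : regular f -> (forall w, 0 <= f w) ->
  measurable_fun setT (fun y : Y => f (st y)) /\
  rgibbs_op haar beta (t_ L) f (w_ L) @[L --> U] --> \int[P]_y f (st y).
Proof.
move=> rf f0; have [mf _ [M fM]] := rf.
pose h L w := f (fix_boundary L w).
have mh L : measurable_fun setT (h L) by exact: measurableT_comp.
have hM L w : 0 <= h L w <= M.
  by rewrite /h f0 (le_trans (ler_norm _))//.
have hF (y : @ultraproduct _ C U UU) : h L (y L) @[L --> U] --> f (st y) by exact: st_cvg.
split; first exact: (ultra_limit_measurable mh hF).
have := @cvg_ultra_integral _ _ _ Q _ _ Uoo _ _ _ mh hM hF; apply: cvg_trans.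
apply: near_eq_cvg; apply: (@filterE _ U) => L /=.
rewrite -Rintegral_gibbs_prob// /Rintegral; congr fine.
have mge (f' : C -> R) : measurable_fun setT f' -> (forall w, 0 <= f' w) -> mge0 (EFin \o f').
  by move=> mf' f'0; split=> [|w]; [exact/measurable_EFinP|rewrite lee_fin].
rewrite (integral_gibbs_prob haar beta (t_ L) (w_ L) (mge _ mf f0)).
rewrite (integral_gibbs_prob haar beta (t_ L) (w_ L) (mge _ (mh L) _)); last first.
  by move=> w; case/andP: (hM L w).
apply: gibbs_op_eq_glue; [exact: t_uniq| |exact: mge|].
  by apply: mge => // w; case/andP: (hM L w).
by move=> eta; rewrite /= /h fix_glue.
Qed.

Let measurable_st : measurable_fun setT st.
Proof.
apply: measurable_config => e; apply: (measurability (@open G)) => //.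
move=> _ [ O oO <-]; rewrite setTI.
have [phi [cphi phi01 phind phiO]] := open_indic_approx oO.
(* The [phi k] increase to 1 on [O] and vanish off it, so one threshold strictly between 0 and 1
   detects [O]. *)
have -> : (fun y => st y e) @^-1` O = \bigcup_k ((fun y => phi k (st y e)) @^-1` `]2^-1, +oo[).
  rewrite eqEsubset; split=> y /=.
    move=> Oy; have := phiO (st y e); rewrite indicE mem_set// => H.
    have half1 : 2^-1 < 1 :> R by rewrite invf_lt1 ?ltr1n.
    have := cvgr_gt _ H _ half1; move=> [k _ Hk]; exists k => //.
    by rewrite /= in_itv/= andbT; apply: Hk => /=.
  move=> [k _]; rewrite /= in_itv/= andbT => Hk; apply: contrapT => nO.
  have := phiO (st y e); rewrite indicE memNset// => H.
  have := nondecreasing_cvgn_le (phind (st y e)) (cvgP _ H) k.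
  by rewrite (cvg_lim _ H)// leNgt (lt_trans _ Hk)// invr_gt0.
apply: bigcupT_measurable => k.
have rphi : regular (fun w : C => phi k (w e)).
  by apply: (regular_coord e (cphi k) (M := 1)) => x; have /andP[? ?] := phi01 k x;
    rewrite ger0_norm.
have [|mphi _] := regular_limit rphi; first by move=> w; have /andP[] := phi01 k (w e).
by have := mphi measurableT _ (measurable_itv `]2^-1, +oo[); rewrite setTI.
Qed.

Let mu : probability C R := distribution P (mfun_Sub (mem_set measurable_st)).

Let integral_mu (H : C -> \bar R) : mge0 H ->
  (\int[mu]_w H w = \int[P]_y H (st y))%E.
Proof.
by move=> [mH H0]; rewrite ge0_integral_distribution//; apply: eq_integral.
Qed.

Let Rintegral_mu f : regular f -> (forall w, 0 <= f w) ->
  \int[mu]_w f w = \int[P]_y f (st y).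
Proof. by move=> rf f0; rewrite /Rintegral (integral_mu (mge0_regular rf f0)). Qed.

Let fin_mu f : regular f -> (forall w, 0 <= f w) ->
  (\int[mu]_w (f w)%:E)%E = (\int[mu]_w f w)%:E.
Proof.
move=> rf f0; rewrite /Rintegral fineK//; apply: integrable_fin_num => //.
by have [mf _ [M fM]] := rf; exact: bounded_integrable fM.
Qed.

Let rgibbs_op_ge0 s (f : C -> R) : regular f -> (forall w, 0 <= f w) ->
  forall w, 0 <= rgibbs_op haar beta s f w.
Proof.
move=> rf f0 w; rewrite -lee_fin.
rewrite -[X in (_ <= X)%E]/((EFin \o rgibbs_op haar beta s f) w) -EFin_gibbs_op//.
by apply: (mge0_gibbs_op _ _ _ _).2; exact: mge0_regular.
Qed.

(** Once [t_ L] contains [s], consistency makes the finite-volume averages of [f] and of its image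
    under the operator of [s] equal. Both functions are regular, so the equality passes to the
    limit. *)
Let mu_invariant s : uniq s -> (forall e, e \in s -> F (\val e)) ->
  gibbs_invariant haar beta mu s.
Proof.
move=> us sF; apply: regular_invariant => f rf f0.
have rK := regular_rgibbs_op haar beta s rf.
have K0 := rgibbs_op_ge0 s rf f0.
rewrite EFin_gibbs_op// [RHS](fin_mu rK K0) fin_mu// !Rintegral_mu//; congr EFin.
have [_ c1] := regular_limit rf f0; have [_ c2] := regular_limit rK K0.
apply: (cvg_unique _ c1) => //; apply: cvg_trans c2; apply: near_eq_cvg.
have : U [set L | forall e, e \in s -> e \in t_ L].
  elim: s us sF {rK K0} => [|e s IH] /=; first by move=> _ _; exact: filterE.
  move=> /andP[_ us] sF.
  have H1 := t_U (sF e (mem_head _ _)).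
  have H2 : U [set L | forall e, e \in s -> e \in t_ L].
    by apply: IH => // f' fs; apply: sF; rewrite inE fs orbT.
  by apply: filterS2 H1 H2 => L /= H1 H2 f'; rewrite inE => /orP[/eqP ->|/H2].
apply: filterS => L /= sL; apply: EFin_inj; symmetry.
rewrite -[LHS]/((EFin \o rgibbs_op haar beta (t_ L) f) (w_ L)).
rewrite -[RHS]/((EFin \o rgibbs_op haar beta (t_ L) (rgibbs_op haar beta s f)) (w_ L)).
by rewrite -!EFin_gibbs_op// gibbs_op_sub//; exact: mge0_regular.
Qed.

Lemma gibbs_limit : exists mu : probability C R,
  [/\ mu [set w | forall e, ~ F (\val e) -> w e = limit_boundary e] = 1%E,
      specified haar beta F mu &
      forall f, regular f -> (forall w, 0 <= f w) ->
        rgibbs_op haar beta (t_ L) f (w_ L) @[L --> U] --> \int[mu]_w f w].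
Proof.
exists mu; split.
- rewrite /mu /distribution/= /pushforward -(probability_setT P); congr (P _).
  rewrite eqEsubset; split=> // y _ /= e nF; rewrite /st /limit_boundary.
  by congr ulim; apply/funext => L; rewrite /fix_boundary; case: asboolP.
- exact: invariant_specified mu_invariant.
- by move=> f rf f0; rewrite Rintegral_mu//; have [] := regular_limit rf f0.
Qed.

End gibbs_limit.

(** * Decay of slab crossings *)

Section irreducible.
Variables (R : realType) (n : nat) (G : gaugeGroup R n) (m : nat).
Variable (rho : G -> 'M[R[i]]_m).
Hypothesis rhoP : irreducible_unitary_representation rho.

Lemma irreducible_unitary_rep : unitary_rep rho.
Proof. by split; [exact: rep_continuous|exact: rep_unitary|exact: rep_mul]. Qed.

(* The vectors fixed by rho g0 form an invariant subspace as g0 is central. *)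
Lemma central_fixed0 (g0 : G) (A : 'M[R[i]]_m) : central g0 -> rho g0 <> 1%:M ->
  rho g0 *m A = A -> A = 0.
Proof.
move=> cg0 rg0 gA; pose B := rho g0 - 1%:M.
pose f : 'Hom('cV[R[i]]_m, 'cV[R[i]]_m) := linfun (mulmx B).
have fE v : (v \in lker f) = (rho g0 *m v == v).
  by rewrite memv_ker lfunE/= /B mulmxBl mul1mx subr_eq0.
have [g v|U0|U1] := rep_irreducible rhoP (U := lker f).
- rewrite !fE => /eqP gv; rewrite mulmxA -rep_mul// cg0 rep_mul// -mulmxA gv//.
- apply/matrixP => i j; have : col j A \in lker f by rewrite fE colE mulmxA gA.
  by rewrite U0 memv0 => /eqP/matrixP/(_ i ord0); rewrite !mxE.
- exfalso; apply: rg0; apply/matrixP => i j.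
  have : delta_mx j ord0 \in lker f by rewrite U1 memvf.
  rewrite fE => /eqP; rewrite -[X in _ = X -> _](mul1mx (delta_mx j ord0)) -!colE.
  by move=> /matrixP/(_ i ord0); rewrite !mxE.
Qed.

End irreducible.

Section finite_volume_limit.
Variables (R : realType) (n : nat) (G : gaugeGroup R n).
Variables (d : nat) (D : set (edge d)) (haar : probability G R) (beta : R).
Local Notation C := (config G D).
Local Notation E := (set_type D).
Variables (F : set (edge d)) (t_ : nat -> seq E).
Hypotheses (t_uniq : forall L, uniq (t_ L)).
Hypothesis (t_F : forall L e, e \in t_ L -> F (\val e)).
Hypothesis (t_exhaust : forall e : E, F (\val e) -> \forall L \near \oo, e \in t_ L).

(* If all the Gibbs measures agree on f, compactness makes the finite-volume
   expectations of f converge uniformly in the boundary condition. *)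
Lemma finite_volume_uniform (f : C -> R) (c eps : R) : regular f ->
  (forall w, 0 <= f w) -> 0 < eps ->
  (forall (mu : probability C R) (delta : C),
     mu [set w | forall e, ~ F (\val e) -> w e = delta e] = 1%E ->
     specified haar beta F mu -> \int[mu]_w f w = c) ->
  exists L0, forall L, (L0 <= L)%N -> forall w,
    `|rgibbs_op haar beta (t_ L) f w - c| <= eps.
Proof.
move=> rf f0 eps0 fc; apply: contrapT => /forallNP bad.
(* The volumes chosen here need not be monotone in [L0]; being at least [L0] is enough for them to
   exhaust [F] along [U]. *)
have /choice[k Hk] : forall L0, exists Lw : nat * C, (L0 <= Lw.1)%N /\
    eps < `|rgibbs_op haar beta (t_ Lw.1) f Lw.2 - c|.
  move=> L0; have /existsNP[L /not_implyP[L0L /existsNP[w Hw]]] := bad L0.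
  by exists (L, w); split=> //; rewrite ltNge; apply/negP.
have [U [UU Uoo]] := @ultraFilterLemma nat \oo _.
have t_U (e : E) : F (\val e) -> U [set L | e \in t_ (k L).1].
  move=> /t_exhaust [L0 _ HL0]; apply: Uoo; exists L0 => // L /= L0L.
  by apply: HL0 => /=; apply: leq_trans L0L _; case: (Hk L).
have [mu [mu1 mus mul]] := gibbs_limit haar beta (F := F) (t_ := fun L => t_ (k L).1)
  (fun L => (k L).2) (fun L => t_uniq _) (fun L e => @t_F _ e) UU Uoo t_U.
have := mul f rf f0; rewrite (fc mu _ mu1 mus) => /cvgrPdist_le/(_ _ eps0) H.
have [L /=] := filter_ex H; rewrite distrC leNgt => /negP; apply.
by case: (Hk L).
Qed.

End finite_volume_limit.

Section exhaustion.
Variables (d : nat) (D F : set (edge d)).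
Local Notation E := (set_type D).

Lemma edge_exhaustion : exists t_ : nat -> seq E,
  [/\ forall L, uniq (t_ L), forall L e, e \in t_ L -> F (\val e) &
      forall e : E, F (\val e) -> \forall L \near \oo, e \in t_ L].
Proof.
pose t_ (L : nat) : seq E := undup [seq e <- pmap insub
  (pmap (@choice.unpickle ('rV[int]_d * 'I_d)%type) (iota 0 L)) | `[< F (\val e) >]].
exists t_; split.
- by move=> L; exact: undup_uniq.
- by move=> L e; rewrite mem_undup mem_filter => /andP[/asboolP].
move=> e Fe; exists (choice.pickle (\val e : ('rV[int]_d * 'I_d)%type)).+1 => // L /= eL.
rewrite mem_undup mem_filter asboolT//= mem_pmap_sub mem_pmap.
apply/mapP; exists (choice.pickle (\val e : ('rV[int]_d * 'I_d)%type)).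
  by rewrite mem_iota.
by rewrite choice.pickleK.
Qed.

End exhaustion.

Lemma Rintegral_sum d' (T : measurableType d') (R : realType)
    (P : probability T R) (I : Type) (r : seq I) (f : I -> T -> R) :
  (forall i, P.-integrable setT (EFin \o f i)) ->
  \int[P]_x (\sum_(i <- r) f i x) = \sum_(i <- r) \int[P]_x f i x.
Proof.
move=> fi; suff [] : P.-integrable setT (EFin \o (fun x => \sum_(i <- r) f i x)) /\
  \int[P]_x (\sum_(i <- r) f i x) = \sum_(i <- r) \int[P]_x f i x by [].
elim: r => [|i r [IH1 IH2]].
  split; first by under eq_fun do rewrite big_nil; exact: finite_measure_integrable_cst.
  by under eq_Rintegral do rewrite big_nil; rewrite big_nil Rintegral_probability_cst.
split; last by under eq_Rintegral do rewrite big_cons; rewrite RintegralD// IH2 big_cons.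
have := integrableD measurableT (fi i) IH1; apply: eq_integrable => // x _.
by rewrite /= big_cons.
Qed.

(** * Vanishing of the mean crossing and its finite-volume form *)

Section slab_decay.
Variables (R : realType) (n : nat) (G : gaugeGroup R n).
Variables (d N : nat) (haar : probability G R) (beta : R).
Variables (o : 'I_d) (o0 : o = 0%N :> nat).
Variables (m : nat) (rho : G -> 'M[R[i]]_m).
Hypothesis rhoP : irreducible_unitary_representation rho.
Local Notation D := (@slab_edges d N).
Local Notation C := (config G D).
Local Notation E := (set_type D).
Implicit Types (w : C).

Lemma layerE k (x : site d) : layer k x <-> x ord0 o = k%:Z.
Proof.
split=> [|xk i i0]; first exact.
by rewrite (_ : i = o)//; apply: val_inj; rewrite /= i0.
Qed.

Lemma stepE (i j : 'I_d) : step i ord0 j = (i == j)%:R.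
Proof. by rewrite mxE eqxx/= eq_sym. Qed.

Lemma stepMnE (i j : 'I_d) h : (step i *+ h) ord0 j = (i == j)%:R *+ h.
Proof. by rewrite mulmxnE stepE. Qed.

Definition crossing : seq (dedge d) := [seq ((step o *+ h, o), false) | h <- iota 0 N].

Definition crossing_rep w := rep_path rho crossing w.

Lemma crossing_edge h : (h < N)%N -> D (step o *+ h, o).
Proof.
move=> hN; split.
  by exists h; [exact: ltnW|rewrite layerE /src/= stepMnE eqxx/= mulr1n natz].
by exists h.+1 => //; rewrite layerE /tgt/= mxE stepE stepMnE eqxx/= mulr1n natz -addn1 PoszD.
Qed.

(** Only the first edge of the path joins the layers 0 and 1, and it is the leftmost factor, so
    [rho g0] appears exactly once and in front. *)
Lemma crossing_center g0 w : (0 < N)%N ->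
  crossing_rep (center_transform g0 w) = rho g0 *m crossing_rep w.
Proof.
move=> N0; have rhoU := irreducible_unitary_rep rhoP.
have edgeE h : (h < N)%N -> edge_value (center_transform g0 w) (step o *+ h, o) =
    if h == 0%N then (g0 * edge_value w (step o *+ h, o))%g else edge_value w (step o *+ h, o).
  move=> hN; rewrite /edge_value; case: insubP => [e _ eE|]; last first.
    by move/negP; case; rewrite inE; exact: crossing_edge.
  rewrite /= /center_transform eE.
  case: (eqVneq h 0%N) => [->|h0].
    rewrite asboolT//; split; first by rewrite layerE /src/= stepMnE mulr0n.
    by rewrite layerE /tgt/= mxE stepE stepMnE mulr0n eqxx add0r.
  rewrite asboolF// => -[]; rewrite layerE /src/= stepMnE eqxx/= mulr1n natz => -[/eqP].
  by rewrite (negbTE h0).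
have iotaE : iota 0 N = 0%N :: iota 1 N.-1 by rewrite -{1}(prednK N0).
rewrite /crossing_rep /crossing iotaE /rep_path /= !big_cons mulmxA -[in RHS](rep_mul rhoP); congr (_ *m _).
  by rewrite /dedge_value /= edgeE.
rewrite !big_map big_seq [RHS]big_seq; apply: eq_bigr => h.
rewrite mem_iota => /andP[h0 hk]; rewrite /dedge_value/= edgeE//.
  by rewrite gtn_eqF.
by rewrite -(prednK N0) -addn1 addnC.
Qed.

Lemma cvg_mulmxl (T : Type) (F : set_system T) (FF : Filter F) p q r
    (A : 'M[R[i]]_(p, q)) (f : T -> 'M[R[i]]_(q, r)) B :
  f t @[t --> F] --> B -> A *m f t @[t --> F] --> A *m B.
Proof.
move=> fB; apply: cvg_mx => i j b; rewrite mxE part_sum.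
rewrite (_ : (fun t => _) = fun t => \sum_k part b (A i k * f t k j)); last first.
  by apply/funext => t; rewrite mxE part_sum.
apply: cvg_big => [|k _]; first exact: add_continuous.
rewrite partM (_ : (fun t => _) = fun t =>
  if b then part false (A i k) * part true (f t k j) + part true (A i k) * part false (f t k j)
  else part false (A i k) * part false (f t k j) - part true (A i k) * part true (f t k j)).
  by case: b; [apply: cvgD|apply: cvgB]; apply: cvgMr; exact: cvg_mx_part.
by apply/funext => t; rewrite partM.
Qed.

Lemma mulg_continuous (g : G) : continuous (fun x : G => (g * x)%g).
Proof.
move=> x; have Fx := nbhs_filter x; apply: gauge_cvg => i j b.
apply: (@cvg_mx_part _ _ (nbhs x) _ _ _ (fun y : G => \val g *m \val y)).
apply: cvg_mulmxl; exact: (@initial_continuous _ _ (set_val : gg_set G -> _)).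
Qed.

Lemma measurable_center g0 : measurable_fun setT (@center_transform _ _ G d N g0).
Proof.
apply: measurable_config => e; rewrite /center_transform; case: asboolP => _; last first.
  exact: measurable_coord.
apply: (measurability (@open G)) => // _ [ O oO <-]; rewrite setTI.
have oO' : open ((fun x : G => (g0 * x)%g) @^-1` O).
  by move/continuousP: (@mulg_continuous g0); apply.
have mO' : measurable ((fun x : G => (g0 * x)%g) @^-1` O) by exact: sub_sigma_algebra.
by have := measurable_coord e measurableT mO'; rewrite setTI.
Qed.

Lemma edge_value_val (D' : set (edge d)) (w : config G D') (e : set_type D') :
  edge_value w (\val e) = w e.
Proof. by rewrite /edge_value valK. Qed.

Hypothesis N0 : (0 < N)%N.
Hypothesis unbroken : forall delta : set_type (@slab_boundary d N) -> G,
  slab_unbroken_center_symmetry haar beta delta.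
Variable g0 : G.
Hypotheses (g0C : central g0) (rho_g0 : rho g0 <> 1%:M).

Lemma regular_crossing i j b : regular (fun w => part b (crossing_rep w i j)).
Proof. by apply: mx_regular_path; exact: irreducible_unitary_rep. Qed.

Lemma crossing_le1 i j b w : `|part b (crossing_rep w i j)| <= 1.
Proof.
by apply: unitarymx_part_le1; apply: rep_path_unitary; exact: irreducible_unitary_rep.
Qed.

(** The entries have modulus at most 1, so adding 1 makes their parts nonnegative, as the limit
    theorem requires; the target mean becomes 1 instead of 0. *)
Definition shifted_crossing i j b w := 1 + part b (crossing_rep w i j).

Lemma regular_shifted_crossing i j b : regular (shifted_crossing i j b).
Proof. by apply: regularD; [exact: regular_cst|exact: regular_crossing]. Qed.

Lemma shifted_crossing_ge0 i j b w : 0 <= shifted_crossing i j b w.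
Proof.
rewrite /shifted_crossing -lerBlDl sub0r.
by have := crossing_le1 i j b w; rewrite ler_norml => /andP[].
Qed.

Section mean.
Variables (mu : probability C R) (delta : C).
Hypothesis mu_delta : mu [set w | forall e, ~ (~` @slab_boundary d N) (\val e) ->
  w e = delta e] = 1%E.
Hypothesis mu_spec : specified haar beta (~` @slab_boundary d N) mu.

Lemma center_invariant (A : set C) : measurable A ->
  pushforward mu (center_transform g0) A = mu A.
Proof.
(* The limit theorem fixes the boundary values by means of a configuration on the whole slab; its
   restriction to the boundary edges is the boundary condition. *)
pose delta' (f : set_type (@slab_boundary d N)) : G := edge_value delta (\val f).
apply: (unbroken (delta := delta')) => //; split=> //.
rewrite -mu_delta; congr (mu _); rewrite eqEsubset; split=> w /= H e.
  move=> /contrapT be.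
  by rewrite (H e (SigSub (mem_set be)))// /delta' /= edge_value_val.
move=> f ef; rewrite H; last by move=> nb; apply: nb; rewrite ef; exact: set_mem (valP f).
by rewrite /delta' -ef edge_value_val.
Qed.

Let crossing_integrable i j b :
  mu.-integrable setT (EFin \o (fun w => part b (crossing_rep w i j))).
Proof.
have [mc _ _] := regular_crossing i j b.
exact: (@bounded_integrable _ _ _ mu (fun w => part b (crossing_rep w i j)) 1 mc (crossing_le1 i j b)).
Qed.

Let mean : 'M[R[i]]_m := \matrix_(i, j)
  Complex (\int[mu]_w part false (crossing_rep w i j))
          (\int[mu]_w part true (crossing_rep w i j)).

Let mean_part i j b : part b (mean i j) = \int[mu]_w part b (crossing_rep w i j).
Proof. by rewrite mxE; case: b. Qed.

(** The change of variables is made for the nonnegative shifted entry, and the added constant then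
    cancels. *)
Let integral_center i j b :
  \int[mu]_w part b ((rho g0 *m crossing_rep w) i j) =
  \int[mu]_w part b (crossing_rep w i j).
Proof.
pose tau : {mfun C >-> C} := mfun_Sub (mem_set (measurable_center g0)).
have rs := regular_shifted_crossing i j b.
have [mc0 _] := mge0_regular rs (shifted_crossing_ge0 i j b).
have E : (\int[mu]_w (shifted_crossing i j b (center_transform g0 w))%:E =
    \int[mu]_w (shifted_crossing i j b w)%:E)%E.
  rewrite -(ge0_integral_distribution tau mc0); last first.
    by move=> w; rewrite lee_fin shifted_crossing_ge0.
  by apply: eq_measure_integral => A mA _; exact: center_invariant.
have rc : regular (fun w => part b ((rho g0 *m crossing_rep w) i j)).
  apply: mx_regularM; first exact: mx_regular_cst.
  by move=> i' j' b'; exact: regular_crossing.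
have ic : mu.-integrable setT (EFin \o (fun w => part b ((rho g0 *m crossing_rep w) i j))).
  by have [mc _ [M cM]] := rc; exact: bounded_integrable cM.
have := congr1 fine E.
rewrite -[LHS]/(\int[mu]_w (shifted_crossing i j b (center_transform g0 w))).
rewrite -[RHS]/(\int[mu]_w (shifted_crossing i j b w)).
rewrite /shifted_crossing; under eq_Rintegral do rewrite crossing_center//.
have i1 := @finite_measure_integrable_cst _ _ _ mu setT 1 measurableT.
by rewrite !RintegralD// => /addrI.
Qed.

Let mean_fixed : rho g0 *m mean = mean.
Proof.
apply/matrixP => i j; apply/eqP; rewrite eq_complex.
suff H b : part b ((rho g0 *m mean) i j) = part b (mean i j).
  by apply/andP; split; apply/eqP; [exact: (H false)|exact: (H true)].
rewrite mean_part -integral_center mxE part_sum.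
under [RHS]eq_Rintegral do rewrite mxE part_sum.
have cst_int c k b' : mu.-integrable setT (EFin \o (fun w => c * part b' (crossing_rep w k j))).
  have rc : regular (fun w => c * part b' (crossing_rep w k j)).
    by apply: regularM; [exact: regular_cst|exact: regular_crossing].
  by have [mc _ [M cM]] := rc; exact: bounded_integrable cM.
have part_int k : mu.-integrable setT
    (EFin \o (fun w => part b (rho g0 i k * crossing_rep w k j))).
  have rc : regular (fun w => part b (rho g0 i k * crossing_rep w k j)).
    under eq_fun do rewrite partM.
    case: b; [apply: regularD|apply: regularB]; apply: regularM;
      (exact: regular_cst || exact: regular_crossing).
  by have [mc _ [M cM]] := rc; exact: bounded_integrable cM.
rewrite Rintegral_sum//; apply: eq_bigr => k _; rewrite partM !mean_part.
under [RHS]eq_Rintegral do rewrite partM.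
by case: b {part_int}; [rewrite RintegralD//|rewrite RintegralB//];
  rewrite !RintegralZl//; exact: crossing_integrable.
Qed.

Lemma crossing_mean0 i j b : \int[mu]_w part b (crossing_rep w i j) = 0.
Proof.
rewrite -mean_part (central_fixed0 rhoP g0C rho_g0 mean_fixed) mxE.
by case: b.
Qed.

Lemma shifted_crossing_mean i j b : \int[mu]_w shifted_crossing i j b w = 1.
Proof.
have i1 := @finite_measure_integrable_cst _ _ _ mu setT 1 measurableT.
by rewrite /shifted_crossing RintegralD// crossing_mean0 addr0 Rintegral_probability_cst.
Qed.

End mean.

Lemma slab_decay eps : 0 < eps -> exists s : seq E,
  [/\ uniq s, forall e, e \in s -> (~` @slab_boundary d N) (\val e) &
      forall w i j b, `|rgibbs_op haar beta s (shifted_crossing i j b) w - 1| <= eps].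
Proof.
move=> eps0.
have [t_ [t_uniq t_F t_exhaust]] := edge_exhaustion D (~` @slab_boundary d N).
have /choice[L0 HL0] : forall k : 'I_m * 'I_m * bool, exists L0, forall L, (L0 <= L)%N ->
    forall w, `|rgibbs_op haar beta (t_ L) (shifted_crossing k.1.1 k.1.2 k.2) w - 1| <= eps.
  move=> k; apply: (finite_volume_uniform t_uniq t_F t_exhaust) => //.
  - exact: regular_shifted_crossing.
  - exact: shifted_crossing_ge0.
  - by move=> mu delta mu1 mus; exact: shifted_crossing_mean mu1 mus _ _ _.
(* There are finitely many entries and parts, so the largest threshold gives one [s] for all of
   them. *)
exists (t_ (\max_k L0 k)); split; [exact: t_uniq|exact: t_F|move=> w i j b].
by apply: (HL0 (i, j, b)); exact: (leq_bigmax (i, j, b)).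
Qed.

End slab_decay.

(** * Slabs along a Wilson loop *)

Section embedding.
Variables (R : realType) (n : nat) (G : gaugeGroup R n).
Variables (d N : nat) (o : 'I_d) (o0 : o = 0%N :> nat) (j : 'I_d).
Local Notation D := (@slab_edges d N).
Local Notation C := (config G D).
Local Notation Z := (config G [set: edge d]).
Local Notation E := (set_type D).
Implicit Types (x y c : site d) (e : E) (s : seq E).

Local Notation swap := (tperm o j).

(* Swapping the axes o and j turns the thin direction of the slab into the
   direction of the long side of the loop. *)
Definition emb_site c x : site d := col_perm swap x + c.

Definition emb_edge c (f : edge d) : edge d := (emb_site c f.1, swap f.2).

Definition emb_dedge c (a : dedge d) : dedge d := (emb_edge c a.1, a.2).

Lemma emb_siteE c x i : emb_site c x ord0 i = x ord0 (swap i) + c ord0 i.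
Proof. by rewrite !mxE. Qed.

Lemma emb_site_step c x i : emb_site c (x + step i) = emb_site c x + step (swap i).
Proof.
apply/rowP => k; rewrite !mxE eqxx addrAC /=; congr (_ + _%:R).
by congr nat_of_bool; apply/eqP/eqP => [<-|->]; rewrite tpermK.
Qed.

(** The inverse of an axis swap followed by a translation by [c] is again of this form, with this
    translation. *)
Definition emb_inv c : site d := - col_perm swap c.

Lemma emb_invK : involutive emb_inv.
Proof. by move=> c; apply/rowP => k; rewrite !mxE tpermK opprK. Qed.

Lemma emb_siteK c : cancel (emb_site c) (emb_site (emb_inv c)).
Proof. by move=> x; apply/rowP => k; rewrite !emb_siteE !mxE tpermK addrK. Qed.

Lemma emb_edgeK c : cancel (emb_edge c) (emb_edge (emb_inv c)).
Proof. by move=> [x i]; rewrite /emb_edge/= emb_siteK tpermK. Qed.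

Definition full_edge (f : edge d) : set_type [set: edge d] :=
  SigSub (mem_set (Logic.I : [set: edge d] f)).

Definition embE c e : set_type [set: edge d] := full_edge (emb_edge c (\val e)).

Lemma embE_inj c : injective (embE c).
Proof.
move=> e f /(congr1 val)/= /(can_inj (@emb_edgeK c)) ef; exact: val_inj.
Qed.

Definition pull c (w : Z) : C := fun e => w (embE c e).

Lemma pull_upd c (w : Z) e (g : G) : pull c (upd w (embE c e) g) = upd (pull c w) e g.
Proof. by apply/funext => f; rewrite /pull /upd (inj_eq (@embE_inj c)). Qed.

Lemma pull_upd_out c (w : Z) (f : set_type [set: edge d]) (g : G) :
  (forall e, \val f != emb_edge c (\val e)) -> pull c (upd w f g) = pull c w.
Proof.
move=> fc; apply/funext => e; rewrite /pull /upd -val_eqE/= eq_sym.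
by rewrite (negbTE (fc e)).
Qed.

Lemma edge_value_full (w : Z) f : edge_value w f = w (full_edge f).
Proof. exact: (edge_value_val w (full_edge f)). Qed.

Lemma edge_value_pull c (w : Z) f : D f ->
  edge_value (pull c w) f = edge_value w (emb_edge c f).
Proof.
move=> Df; rewrite edge_value_full.
exact: (edge_value_val (pull c w) (SigSub (mem_set Df) : E)).
Qed.

Lemma rep_path_pull m (phi : G -> 'M[R[i]]_m) c l (w : Z) :
  (forall a, a \in l -> D a.1) ->
  rep_path phi l (pull c w) = rep_path phi (map (emb_dedge c) l) w.
Proof.
move=> lD; rewrite /rep_path big_map; apply: eq_big_seq => a al.
by rewrite /dedge_value /= edge_value_pull//; exact: lD.
Qed.

Lemma regular_pull c (f : C -> R) : regular f -> regular (f \o pull c).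
Proof.
move=> [mf uf [M fM]]; split.
- apply: measurableT_comp => //; apply: measurable_config => e.
  exact: measurable_coord.
- by move=> U UU w_ w ww; apply: uf => e; exact: ww.
- by exists M => w; exact: fM.
Qed.

Lemma rresamples_pull haar c s (f : C -> R) (w : Z) :
  rresamples haar (map (embE c) s) (f \o pull c) w = rresamples haar s f (pull c w).
Proof.
rewrite -[RHS]/((rresamples haar s f \o pull c) w); congr (_ w).
elim: s => [//|e s IH] /=; rewrite IH; apply/funext => v /=.
by apply: eq_Rintegral => x _; rewrite /= pull_upd.
Qed.

(** The swap can reverse the order of the two directions, so they are sorted again; [insubd] then
    succeeds, which is [emb_plaqE]. *)
Definition emb_plaq c (p : plaquette d) : plaquette d :=
  insubd p (if (swap (\val p).1.2 < swap (\val p).2)%N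
    then (emb_site c (\val p).1.1, swap (\val p).1.2, swap (\val p).2)
    else (emb_site c (\val p).1.1, swap (\val p).2, swap (\val p).1.2)).

Lemma emb_plaqE c p : \val (emb_plaq c p) =
  if (swap (\val p).1.2 < swap (\val p).2)%N
  then (emb_site c (\val p).1.1, swap (\val p).1.2, swap (\val p).2)
  else (emb_site c (\val p).1.1, swap (\val p).2, swap (\val p).1.2).
Proof.
rewrite /emb_plaq val_insubd; case: (ltnP (swap (\val p).1.2) (swap (\val p).2)) => h /=; first by rewrite h.
rewrite /= ltn_neqAle h andbT.
rewrite (_ : (_ != _) = true)//; apply/negP => /eqP/val_inj/perm_inj pE.
by have := valP p; rewrite pE ltnn.
Qed.

Lemma emb_plaqK c : cancel (emb_plaq c) (emb_plaq (emb_inv c)).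
Proof.
move=> p; apply: val_inj; rewrite !emb_plaqE.
case: p => -[[x a] b] /= ab.
case: (ltnP (swap a) (swap b)) => h /=; rewrite !tpermK emb_siteK.
  by rewrite ab.
by rewrite ltnNge (ltnW ab).
Qed.

Lemma emb_plaq_edges c p : plaquette_edges (emb_plaq c p) =i
  map (emb_edge c) (plaquette_edges p).
Proof.
rewrite /plaquette_edges /plaquette_path emb_plaqE.
case: p => -[[x a] b] /= ab f; case: ifP => h; rewrite /= /emb_edge /= !inE !emb_site_step //.
by do 4!case: (f == _).
Qed.

(** Reversing a path turns its holonomy into the conjugate transpose. This covers the plaquettes
    whose orientation is reversed by the sorting in [emb_plaq]. *)
Lemma Re_trC_path (l : seq (dedge d)) (w : Z) :
  complex.Re (\tr (rep_path (fun g : G => \val g) (rev [seq (a.1, ~~ a.2) | a <- l]) w)) =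
  complex.Re (\tr (rep_path (fun g : G => \val g) l w)).
Proof.
have vP := val_unitary_rep G.
have -> : rep_path (fun g : G => \val g) (rev [seq (a.1, ~~ a.2) | a <- l]) w =
    (rep_path (fun g : G => \val g) l w ^t*)%sesqui.
  elim: l => [|a l IH]; first by rewrite /rep_path !big_nil trmx1 map_mx1.
  rewrite /= rev_cons -cats1 rep_path_cat IH /rep_path !big_cons big_nil mulmx1.
  rewrite trmx_mul map_mxM; congr (_ *m _).
  have V (g : G) : sval (g^-1)%g = ((sval g : 'M[R[i]]_n) ^t*)%sesqui := unitary_repV vP g.
  case: a => f []; rewrite /dedge_value; cbv beta iota delta [fst snd negb]; rewrite V//.
  by apply/matrixP => k l'; rewrite !mxE; exact: esym (conjCK _).
rewrite /mxtrace -!/(part false _) !part_sum; apply: eq_bigr => k _; rewrite !mxE.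
by case: (rep_path _ _ _ k k).
Qed.

Lemma Re_tr_emb_plaq c p (w : Z) : (forall f, f \in plaquette_edges p -> D f) ->
  Re_tr_plaquette w (emb_plaq c p) = Re_tr_plaquette (pull c w) p.
Proof.
move=> pD; rewrite /Re_tr_plaquette !val_holonomy rep_path_pull; last first.
  by move=> a ap; apply: pD; exact: map_f.
rewrite /plaquette_path emb_plaqE; case: p {pD} => -[[x a] b] /= ab.
rewrite /emb_dedge /emb_edge /= !emb_site_step; case: ifP => h //.
by rewrite -Re_trC_path.
Qed.

Lemma slab_edgesE (f : edge d) : D f <->
  0 <= f.1 ord0 o /\ f.1 ord0 o + (f.2 == o)%:R <= N%:Z.
Proof.
case: f => x i; split=> /=.
  move=> [[k kN /(layerE o0)]]; rewrite /src/= => xk [k' k'N /(layerE o0)].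
  by rewrite /tgt/= mxE stepE => ->; rewrite xk.
move=> [x0 xN]; split; [exists (absz (x ord0 o))|exists (absz (x ord0 o + (i == o)%:R))].
- by case: (i == o) xN => /=; lia.
- by apply/(layerE o0); rewrite /src/=; lia.
- by case: (i == o) xN => /=; lia.
- apply/(layerE o0); rewrite /tgt/= mxE stepE.
  by case: (i == o) xN => /=; lia.
Qed.

Lemma slab_boundaryE (f : edge d) : f.2 != o -> f.1 ord0 o = 0 \/ f.1 ord0 o = N%:Z ->
  @slab_boundary d N f.
Proof.
case: f => x i /= io; have tx : (tgt (x, i)) ord0 o = x ord0 o.
  by rewrite /tgt/= mxE stepE (negbTE io) addr0.
by move=> [] xE; [left|right]; split; apply/(layerE o0); rewrite ?tx.
Qed.

Lemma slab_interior e : (~` @slab_boundary d N) (\val e) ->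
  0 <= (\val e).1 ord0 o /\ ((\val e).2 = o -> (\val e).1 ord0 o < N%:Z) /\
  ((\val e).2 <> o -> 0 < (\val e).1 ord0 o < N%:Z).
Proof.
move=> nb; have [x0 xN] := (slab_edgesE _).1 (set_mem (valP e)).
split=> //; split=> [io|/eqP io]; first by move: xN; rewrite io eqxx; lia.
have h : (\val e).1 ord0 o <> 0 /\ (\val e).1 ord0 o <> N%:Z.
  by split=> xE; apply: nb; apply: slab_boundaryE => //; [left|right].
by move: xN; rewrite (negbTE io) addr0 => xN; apply/andP; lia.
Qed.

(** This is why slab and lattice have the same conditional laws: a plaquette touching an interior
    edge stays in the slab, so no term of the weight is lost by restricting to the slab. *)
Lemma plaquette_slab p e : (~` @slab_boundary d N) (\val e) ->
  \val e \in plaquette_edges p -> forall f, f \in plaquette_edges p -> D f.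
Proof.
move=> /slab_interior [e0 [eo eno]] ep f fp; apply/slab_edgesE; move: e0 eo eno ep fp.
case: p => -[[x a] b] /= ab; rewrite /plaquette_edges/=.
(* [b] is the larger direction, so it cannot be the axis of index 0. *)
have bo : b <> o by move=> bo; move: ab; rewrite bo o0.
have /eqP/negbTE bF := bo.
have sE k : (x + step k) ord0 o = x ord0 o + (k == o)%:R by rewrite mxE stepE.
case: (\val e) => y i /= e0 eo eno; rewrite !inE.
have [ao|/eqP ao] := eqVneq a o.
  move=> /or4P[]/eqP[yE iE]; have := eo; have := eno; rewrite iE; move: e0; rewrite yE;
    rewrite ?sE ?ao ?eqxx ?bF /= => e0 h1 h2; move=> /or4P[]/eqP ->/=;
    rewrite ?sE ?eqxx ?bF /=;
    try (have := h1 bo); try (have := h2 erefl); lia.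
have /eqP/negbTE aF := ao.
move=> /or4P[]/eqP[yE iE]; have := eno; rewrite iE; move: e0; rewrite yE;
  rewrite ?sE ?aF ?bF /= => e0 h1; move=> /or4P[]/eqP ->/=;
  rewrite ?sE ?aF ?bF /=;
  try (have := h1 bo); try (have := h1 ao); lia.
Qed.

Lemma touching_emb c s : (forall e, e \in s -> (~` @slab_boundary d N) (\val e)) ->
  set_bij (touching s) (touching (map (embE c) s)) (emb_plaq c).
Proof.
move=> sF; split.
- move=> p [pD [e es ep]]; split=> //; exists (embE c e); first exact: map_f.
  by rewrite emb_plaq_edges /=; exact: map_f.
- by move=> p q _ _; exact: (can_inj (@emb_plaqK c)).
- move=> q [_ [_ /mapP[e es ->] eq]]; have qK := @emb_plaqK (emb_inv c) q.
  rewrite emb_invK in qK; exists (emb_plaq (emb_inv c) q) => //.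
  have ep : \val e \in plaquette_edges (emb_plaq (emb_inv c) q).
    rewrite emb_plaq_edges; apply/mapP; exists (\val (embE c e)) => //.
    by rewrite /= emb_edgeK.
  by split; [exact: plaquette_slab (sF e es) ep|exists e].
Qed.

Lemma weight_pull beta c s (w : Z) :
  (forall e, e \in s -> (~` @slab_boundary d N) (\val e)) ->
  weight beta (map (embE c) s) w = weight beta s (pull c w).
Proof.
move=> sF; rewrite /weight; congr (expR (_ * _)).
rewrite (reindex_fsbig (emb_plaq c) (touching s) _ _ (touching_emb c sF)); apply: eq_fsbigr => p.
by rewrite inE => -[pD _]; exact: Re_tr_emb_plaq.
Qed.

Lemma rgibbs_op_pull haar beta c s (f : C -> R) (w : Z) :
  (forall e, e \in s -> (~` @slab_boundary d N) (\val e)) ->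
  rgibbs_op haar beta (map (embE c) s) (f \o pull c) w =
  rgibbs_op haar beta s f (pull c w).
Proof.
move=> sF; rewrite /rgibbs_op /partition_function -!rresamples_pull.
congr (_^-1 * _); last first.
  by congr rresamples; apply/funext => v /=; rewrite weight_pull.
by congr rresamples; apply/funext => v /=; rewrite weight_pull.
Qed.

End embedding.

(** * Integrating out the slabs of a stack *)

Section slab_integration.
Variables (R : realType) (n : nat) (G : gaugeGroup R n).
Variables (d N : nat) (o : 'I_d) (o0 : o = 0%N :> nat) (j : 'I_d).
Variables (haar : probability G R) (beta : R) (m : nat) (rho : G -> 'M[R[i]]_m).
Hypothesis rhoP : irreducible_unitary_representation rho.
Local Notation D := (@slab_edges d N).
Local Notation Z := (config G [set: edge d]).
Variables (eps : R) (s : seq (set_type D)) (s_uniq : uniq s).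
Hypothesis s_F : forall e, e \in s -> (~` @slab_boundary d N) (\val e).
Hypothesis s_decay : forall w a b c,
  `|rgibbs_op haar beta s (shifted_crossing o rho a b c) w - 1| <= eps.
Variables (y : site d) (mu : probability Z R).
Hypothesis mu_gibbs : gibbs_measure haar beta mu.
Local Notation "\mxprod_ ( h <- l ) F" := (\big[mulmx/1%:M]_(h <- l) F)
  (at level 36, F at level 36, h, l at level 50).

(** The spacing is exactly [N]: consecutive slabs share a boundary layer, and their crossings
    concatenate to a straight path without gaps. *)
Definition slab_origin k : site d := y + step j *+ (k * N).

Local Notation pullk k := (@pull R n G d N o j (slab_origin k)).
Local Notation embk k := (@embE d N o j (slab_origin k)).

Definition slab_crossing k (w : Z) : 'M[R[i]]_m := crossing_rep o rho (pullk k w).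

(** Subtracting 1 undoes the shift: this is the average of a part of a crossing entry given the
    configuration outside the resampled edges. *)
Definition slab_error k a b c (w : Z) : R :=
  rgibbs_op haar beta s (shifted_crossing o rho a b c) (pullk k w) - 1.

(* What is left of the k-th crossing after the interior of the k-th slab has
   been integrated out. *)
Definition slab_residue k (w : Z) : 'M[R[i]]_m :=
  \matrix_(a, b) Complex (slab_error k a b false w) (slab_error k a b true w).

Definition slab_fixed (T : Type) k (F : Z -> T) :=
  forall e, e \in s -> forall w x, F (upd w (embk k e) x) = F w.

(** An interior edge along [j] starts below the top layer of its slab, and a transversal one lies
    strictly between the two end layers. So it avoids the other slabs entirely, including the shared
    layers. *)
Lemma emb_disjoint k k' e f : e \in s -> D f -> k != k' ->
  \val (embk k e) != emb_edge o j (slab_origin k') f.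
Proof.
move=> es /(slab_edgesE N o0) [f0 fN] kk'.
have [e0 [eo eno]] := slab_interior o0 (s_F es).
have kN : (k * N + N <= k' * N \/ k' * N + N <= k * N)%N.
  by case: (ltngtP k k') kk' => // kk' _; [left|right]; rewrite -mulSnr leq_mul2r kk' orbT.
have -> : \val (embk k e) = emb_edge o j (slab_origin k) (\val e) by [].
move: (\val e) e0 eo eno => z z0 zo zno; apply/eqP => -[].
move=> /(congr1 (fun x : site d => x ord0 j)); rewrite !emb_siteE tpermR !mxE.
rewrite !mulmxnE !stepE eqxx !natz => E /perm_inj zf; rewrite -zf in fN.
have [zE|/eqP zE] := eqVneq z.2 o.
  by move: (zo zE) fN; rewrite zE eqxx mulr1n => zN fN; lia.
by move: (zno zE) fN => /andP[z1 zN]; rewrite (negbTE (introN eqP zE)) addr0 => fN; lia.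
Qed.

Lemma slab_fixed_pull (T : Type) k k' (F : config G D -> T) : k != k' ->
  slab_fixed k (F \o pullk k').
Proof.
move=> kk' e es w x /=; rewrite pull_upd_out// => f.
by apply: emb_disjoint => //; exact: set_mem (valP f).
Qed.

Lemma slab_fixed_crossing k k' : k != k' -> slab_fixed k (slab_crossing k').
Proof. exact: slab_fixed_pull. Qed.

Lemma slab_fixed_residue k k' : k != k' -> slab_fixed k (slab_residue k').
Proof.
move=> kk' e es w x; apply/matrixP => a b; rewrite !mxE /slab_error.
rewrite (pull_upd_out _ (c := slab_origin k'))// => f.
by apply: emb_disjoint => //; exact: set_mem (valP f).
Qed.

Lemma part_residue k w a b c : part c (slab_residue k w a b) = slab_error k a b c w.
Proof. by rewrite mxE; case: c. Qed.

Lemma regular_slab_error k a b c : regular (slab_error k a b c).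
Proof.
apply: regularB; last exact: regular_cst.
apply: (regular_pull o j (slab_origin k)); apply: regular_rgibbs_op.
exact: regular_shifted_crossing.
Qed.

Lemma mx_regular_slab_crossing k : mx_regular (slab_crossing k).
Proof.
move=> a b c; apply: (regular_pull o j (slab_origin k) (f := fun w => part c (crossing_rep o rho w a b))).
exact: regular_crossing.
Qed.

Lemma mx_regular_slab_residue k : mx_regular (slab_residue k).
Proof.
move=> a b c; under eq_fun do rewrite part_residue.
exact: regular_slab_error.
Qed.

Let regular_int (f : Z -> R) : regular f -> mu.-integrable setT (EFin \o f).
Proof. by move=> [mf _ [M fM]]; exact: (@bounded_integrable _ _ _ mu f M mf fM). Qed.

(** The operator of the [k]-th copy of [s] preserves [mu] and treats [H] as a constant, so it
    replaces the crossing by its conditional average. As it acts on nonnegative functions, both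
    factors are shifted first. *)
Lemma integral_crossing_entry k a b c (H : Z -> R) : regular H -> slab_fixed k H ->
  \int[mu]_w (part c (slab_crossing k w a b) * H w) =
  \int[mu]_w (slab_error k a b c w * H w).
Proof.
move=> rH fH; pose f := shifted_crossing o rho a b c \o pullk k.
have rsc := @regular_shifted_crossing R n G d N o m rho rhoP a b c.
have rf : regular f := regular_pull o j (slab_origin k) rsc.
have f0 w : 0 <= f w by exact: shifted_crossing_ge0.
pose t := map (embk k) s.
have tinv : gibbs_invariant haar beta mu t.
  apply: (specified_invariant mu_gibbs) => //.
  by rewrite map_inj_uniq//; exact: embE_inj.
pose g := rgibbs_op haar beta t f.
have gE w : g w = slab_error k a b c w + 1.
  by rewrite /g /slab_error subrK /f rgibbs_op_pull.
have rg : regular g by exact: regular_rgibbs_op.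
have step1 (M : R) : (forall w, 0 <= H w + M) ->
    \int[mu]_w (f w * (H w + M)) = \int[mu]_w (g w * (H w + M)).
  move=> HM; have rHM : regular (fun w => H w + M).
    by apply: regularD => //; exact: regular_cst.
  have mHM : mge0 (EFin \o (fun w => H w + M)) := mge0_regular rHM HM.
  have mf : mge0 (EFin \o f) := mge0_regular rf f0.
  have := tinv _ (mge0M mHM mf); rewrite gibbs_opM//; last first.
    by move=> _ /mapP[e es ->] w x /=; rewrite fH.
  rewrite EFin_gibbs_op// => /(congr1 fine) E.
  rewrite /Rintegral; under eq_integral do rewrite mulrC.
  by rewrite E; congr fine; apply: eq_integral => w _; rewrite mulrC.
have [_ _ [M HM]] := rH.
have M0 : 0 <= M by apply: le_trans (HM point).
have E1 : \int[mu]_w (f w * (H w + M)) = \int[mu]_w (g w * (H w + M)).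
  by apply: step1 => w; have := HM w; rewrite ler_norml; lra.
have E2 : \int[mu]_w (f w * (H w + (M + 1))) = \int[mu]_w (g w * (H w + (M + 1))).
  by apply: step1 => w; have := HM w; rewrite ler_norml; lra.
have lin (h : Z -> R) (M' : R) : regular h ->
    \int[mu]_w (h w * (H w + M')) = \int[mu]_w (h w * H w) + M' * \int[mu]_w h w.
  move=> rh; under eq_Rintegral do rewrite mulrDr [X in _ + X]mulrC.
  rewrite RintegralD ?RintegralZl//.
  - exact: regular_int.
  - by apply: regular_int; exact: regularM.
  - by apply: regular_int; apply: regularM => //; exact: regular_cst.
rewrite !lin// in E1 E2.
(* Subtracting [E1] from [E2] shows that [f] and [g] have equal integrals, and then the terms of
   [E1] in [M] cancel. This is the purpose of the second shift of [H]. *)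
have E3 : \int[mu]_w (f w * H w) = \int[mu]_w (g w * H w) by nra.
have split1 (h : Z -> R) : regular h ->
    \int[mu]_w ((1 + h w) * H w) = \int[mu]_w H w + \int[mu]_w (h w * H w).
  move=> rh; under eq_Rintegral do rewrite mulrDl mul1r.
  by rewrite RintegralD//; apply: regular_int => //; exact: regularM.
apply: (addrI (\int[mu]_w H w)); rewrite -!split1; last 2 first.
- exact: regular_slab_error.
- exact: mx_regular_slab_crossing.
have := E3; under [RHS]eq_Rintegral do rewrite gE addrC.
by [].
Qed.

Let integral_tr (A B : Z -> 'M[R[i]]_m) c : mx_regular A -> mx_regular B ->
  \int[mu]_w part c (\tr (A w *m B w)) = \sum_a \sum_b
    (if c then \int[mu]_w (part false (A w a b) * part true (B w b a)) +
               \int[mu]_w (part true (A w a b) * part false (B w b a))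
     else \int[mu]_w (part false (A w a b) * part false (B w b a)) -
          \int[mu]_w (part true (A w a b) * part true (B w b a))).
Proof.
move=> rA rB; have rAB a b c1 c2 :
    mu.-integrable setT (EFin \o (fun w => part c1 (A w a b) * part c2 (B w b a))).
  by apply: regular_int; apply: regularM; [exact: rA|exact: rB].
have rABc a b : regular (fun w => part c (A w a b * B w b a)).
  under eq_fun do rewrite partM.
  by case: c; [apply: regularD|apply: regularB]; apply: regularM;
    (exact: rA || exact: rB).
under eq_Rintegral do (rewrite /mxtrace part_sum;
  under eq_bigr do rewrite mxE part_sum).
rewrite Rintegral_sum => [|a]; last first.
  by apply: regular_int; apply: regular_sum => b; exact: rABc.
apply: eq_bigr => a _; rewrite Rintegral_sum => [|b]; last exact/regular_int/rABc.
apply: eq_bigr => b _; under eq_Rintegral do rewrite partM.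
by case: c {rABc}; [rewrite RintegralD|rewrite RintegralB].
Qed.

Lemma integral_crossing_tr k c (Q : Z -> 'M[R[i]]_m) : mx_regular Q -> slab_fixed k Q ->
  \int[mu]_w part c (\tr (slab_crossing k w *m Q w)) =
  \int[mu]_w part c (\tr (slab_residue k w *m Q w)).
Proof.
move=> rQ fQ; rewrite !integral_tr//; last 2 first.
- exact: mx_regular_slab_residue.
- exact: mx_regular_slab_crossing.
apply: eq_bigr => a _; apply: eq_bigr => b _.
have E c1 c2 : \int[mu]_w (part c1 (slab_crossing k w a b) * part c2 (Q w b a)) =
    \int[mu]_w (part c1 (slab_residue k w a b) * part c2 (Q w b a)).
  rewrite integral_crossing_entry; last 2 first.
  - exact: rQ.
  - by move=> e es w x /=; rewrite fQ.
  by under [RHS]eq_Rintegral do rewrite part_residue.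
by rewrite !E.
Qed.

Lemma mx_regular_prod (r : seq nat) (A : nat -> Z -> 'M[R[i]]_m) :
  (forall k, mx_regular (A k)) -> mx_regular (fun w => \mxprod_(k <- r) A k w).
Proof.
move=> rA; elim: r => [|k r IH].
  by under eq_fun do rewrite big_nil; exact: mx_regular_cst.
by under eq_fun do rewrite big_cons; exact: mx_regularM.
Qed.

Lemma slab_fixed_prod k (r : seq nat) (A : nat -> Z -> 'M[R[i]]_m) :
  (forall k', k != k' -> slab_fixed k (A k')) -> k \notin r ->
  slab_fixed k (fun w => \mxprod_(k' <- r) A k' w).
Proof.
move=> fA kr e es w x; apply: eq_big_seq => k' k'r; apply: fA => //.
by apply: contraNneq kr => ->.
Qed.

Variables (K : nat) (X : Z -> 'M[R[i]]_m).
Hypotheses (rX : mx_regular X) (fX : forall k, (k < K)%N -> slab_fixed k X).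

(** Slabs are replaced from the first on. When the [k]-th is treated, the residues already produced,
    the crossings still to come and [X] are all insensitive to its resampled edges. *)
Lemma integral_slabs c k : (k <= K)%N ->
  \int[mu]_w part c (\tr (\mxprod_(h <- iota 0 K) slab_crossing h w *m X w)) =
  \int[mu]_w part c (\tr (\mxprod_(h <- iota 0 k) slab_residue h w *m
    (\mxprod_(h <- iota k (K - k)) slab_crossing h w *m X w))).
Proof.
elim: k => [_|k IH kK].
  by rewrite subn0; under [RHS]eq_Rintegral do rewrite big_nil mul1mx.
have iE : iota k (K - k) = k :: iota k.+1 (K - k.+1) by rewrite -(subnSK kK).
refine (etrans (IH (ltnW kK)) _); rewrite iE {IH iE}.
(* Cyclicity of the trace moves the residues behind [X], so that the [k]-th crossing stands in
   front. *)
pose Q w := (\mxprod_(h <- iota k.+1 (K - k.+1)) slab_crossing h w *m X w) *m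
  \mxprod_(h <- iota 0 k) slab_residue h w.
have rQ : mx_regular Q.
  apply: mx_regularM; last by apply: mx_regular_prod; exact: mx_regular_slab_residue.
  by apply: mx_regularM => //; apply: mx_regular_prod; exact: mx_regular_slab_crossing.
have fQ : slab_fixed k Q.
  move=> e es w x; rewrite /Q (fX kK es).
  rewrite (slab_fixed_prod (@slab_fixed_crossing k) _ es); last first.
    by rewrite mem_iota ltnn.
  rewrite (slab_fixed_prod (@slab_fixed_residue k) _ es)//.
  by rewrite mem_iota add0n ltnn andbF.
transitivity (\int[mu]_w part c (\tr (slab_crossing k w *m Q w))).
  apply: eq_Rintegral => w _; congr (part c _).
  by rewrite big_cons mxtrace_mulC /Q -!mulmxA.
rewrite (integral_crossing_tr c rQ fQ).
apply: eq_Rintegral => w _; congr (part c _).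
have -> : iota 0 k.+1 = iota 0 k ++ [:: k] by rewrite -addn1 iotaD.
by rewrite big_cat_mulmx (big_cons _ _ k) big_nil mulmx1 -[in RHS]mulmxA [RHS]mxtrace_mulC -[in RHS]mulmxA.
Qed.

Lemma mx_entry_mul (A B : 'M[R[i]]_m) (u v : R) : (forall a b, `|A a b| <= u%:C%C) ->
  (forall a b, `|B a b| <= v%:C%C) -> forall a b, `|(A *m B) a b| <= (m%:R * (u * v))%:C%C.
Proof.
move=> Au Bv a b; rewrite mxE; apply: le_trans (ler_norm_sum _ _ _) _.
apply: (@le_trans _ _ (\sum_(k < m) (u * v)%:C%C)).
  by apply: ler_sum => k _; rewrite normrM rmorphM ler_pM.
by rewrite sumr_const card_ord -rmorphMn/= -mulr_natl.
Qed.

(** A residue entry is at most [eps + eps] by adding its two parts, an entry of the unitary [X] at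
    most 1. Every matrix product costs a factor [m], and so does the trace. *)
Lemma slab_bound (Xu : forall w, X w \is unitarymx) c :
  `|\int[mu]_w part c (\tr (\mxprod_(h <- iota 0 K) slab_crossing h w *m X w))| <=
  m%:R * (m%:R * (eps + eps)) ^+ K.
Proof.
rewrite (integral_slabs c (leqnn K)) subnn.
under eq_Rintegral do rewrite big_nil mul1mx.
set f := fun w => part c (\tr (\mxprod_(h <- iota 0 K) slab_residue h w *m X w)).
have rf : regular f.
  rewrite /f; under eq_fun do rewrite /mxtrace part_sum.
  apply: regular_sum => a; apply: mx_regularM => //.
  by apply: mx_regular_prod; exact: mx_regular_slab_residue.
have res_le h w a b : `|slab_residue h w a b| <= (eps + eps)%:C%C.
  apply: le_trans (norm_le_part _) _; rewrite lecR.
  by rewrite !part_residue lerD ?s_decay.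
have fM w : `|f w| <= m%:R * (m%:R * (eps + eps)) ^+ K.
  have entry (r : seq nat) a b : `|(\mxprod_(h <- r) slab_residue h w *m X w) a b| <=
      ((m%:R * (eps + eps)) ^+ size r)%:C%C.
    elim: r a b => [|h r IH] a b.
      by rewrite big_nil mul1mx expr0; exact: unitarymx_norm_le1.
    rewrite big_cons -mulmxA /= exprS -mulrA.
    by apply: mx_entry_mul => // a' b'; exact: res_le.
  rewrite -lecR; apply: le_trans (part_le_norm _ _) _.
  apply: le_trans (ler_norm_sum _ _ _) _.
  apply: (@le_trans _ _ (\sum_(k < m) ((m%:R * (eps + eps)) ^+ K)%:C%C)).
    by apply: ler_sum => a _; have := entry (iota 0 K) a a; rewrite size_iota.
  by rewrite sumr_const card_ord -rmorphMn/= -mulr_natl.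
apply: le_trans (le_normr_Rintegral measurableT (regular_int rf)) _.
rewrite -[leRHS](Rintegral_probability_cst mu); apply: le_Rintegral => //.
- have [mf _ _] := rf; apply: (@bounded_integrable _ _ _ mu _ (m%:R * (m%:R * (eps + eps)) ^+ K)).
    exact: measurableT_comp.
  by move=> w; rewrite normr_id.
- exact: finite_measure_integrable_cst.
Qed.

End slab_integration.

(** * Rectangular loops along a stack of slabs *)

Section wilson_loops.
Variables (R : realType) (n : nat) (G : gaugeGroup R n).
Variables (d N : nat) (o : 'I_d) (o0 : o = 0%N :> nat).
Variables (haar : probability G R) (beta : R) (m : nat) (rho : G -> 'M[R[i]]_m).
Hypothesis rhoP : irreducible_unitary_representation rho.
Local Notation D := (@slab_edges d N).
Local Notation Z := (config G [set: edge d]).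
Implicit Types (w : Z) (l : seq (dedge d)).

Lemma wilson_loop_cat l1 l2 w :
  wilson_loop rho (l1 ++ l2) w = wilson_loop rho (l2 ++ l1) w.
Proof. by rewrite /wilson_loop !big_cat_mulmx mxtrace_mulC. Qed.

Lemma wilson_loop_rot k l w : wilson_loop rho (rot k l) w = wilson_loop rho l w.
Proof. by rewrite /rot wilson_loop_cat cat_take_drop. Qed.

Definition column (j : 'I_d) (y : site d) (h t : nat) : seq (dedge d) :=
  [seq ((y + step j *+ k, j), false) | k <- iota h t].

Lemma column_slabs j y K w : rep_path rho (column j y 0 (K * N)) w =
  \big[mulmx/1%:M]_(k <- iota 0 K) slab_crossing N o j rho y k w.
Proof.
elim: K => [|K IH]; first by rewrite mul0n /rep_path !big_nil.
rewrite mulSnr /column iotaD map_cat rep_path_cat [X in X *m _]IH.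
rewrite -(addn1 K) iotaD big_cat_mulmx add0n; congr (_ *m _).
rewrite (big_cons _ _ K) big_nil mulmx1 /slab_crossing /crossing_rep rep_path_pull; last first.
  by move=> a /mapP[h]; rewrite mem_iota => /andP[_ hN] ->; exact: crossing_edge.
congr (rep_path _ _ w); rewrite -[X in iota X _]addn0 iotaDl -!map_comp.
apply: eq_map => h /=; rewrite /emb_dedge /emb_edge /= tpermL /slab_origin.
congr (_, _, _); apply/rowP => i; rewrite emb_siteE !mxE !mulmxnE !stepE.
rewrite mulrnDr addrA [RHS]addrC; congr (_ + _ *+ _); congr (_%:R).
by congr nat_of_bool; rewrite -[X in X == tperm _ _ _](tpermR o j) (inj_eq perm_inj).
Qed.

Variables (eps : R) (s : seq (set_type D)) (s_uniq : uniq s).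
Hypothesis s_F : forall e, e \in s -> (~` @slab_boundary d N) (\val e).
Hypothesis s_decay : forall (w : config G D) a b c,
  `|rgibbs_op haar beta s (shifted_crossing o rho a b c) w - 1| <= eps.
Variable B : nat.
Hypothesis s_B : forall e i, e \in s -> `|(\val e).1 ord0 i| < B%:Z.
Variable mu : probability Z R.
Hypothesis mu_gibbs : gibbs_measure haar beta mu.

Section column.
Variables (j : 'I_d) (y : site d).

(* The edges off the interiors of the first K slabs stacked along the column. *)
Definition off_column K (a : dedge d) : Prop :=
  [\/ a.1.2 = j /\ y ord0 j + (K * N)%:Z <= a.1.1 ord0 j,
      a.1.2 <> j /\ (a.1.1 ord0 j <= y ord0 j \/ y ord0 j + (K * N)%:Z <= a.1.1 ord0 j) |
      exists2 i, i != j & B%:Z <= `|a.1.1 ord0 i - y ord0 i|].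

(** Edges along [j] starting above the stack miss it by height. Transversal edges at or beyond an
    end layer miss it because resampled transversal edges lie strictly inside their slab. Far edges
    miss it because the coordinates in [s] are below [B]. *)
Lemma off_columnP K a k e : off_column K a -> (k < K)%N -> e \in s ->
  \val (embE o j (slab_origin N j y k) e) <> a.1.
Proof.
move=> aK kK es; have [e0 [eo eno]] := slab_interior o0 (s_F es).
have sB i := s_B i es; have kN : (k * N + N <= K * N)%N by rewrite -mulSnr leq_mul2r kK orbT.
have -> : \val (embE o j (slab_origin N j y k) e) =
  emb_edge o j (slab_origin N j y k) (\val e) by [].
have orE i : slab_origin N j y k ord0 i = y ord0 i + (j == i)%:R *+ (k * N).
  by rewrite mxE mulmxnE stepE.
move: (\val e) e0 eo eno sB => z z0 zo zno sB za; move: aK; rewrite /off_column -za /=.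
rewrite !emb_siteE tpermR orE eqxx natz.
have zj : tperm o j z.2 = j <-> z.2 = o.
  by split=> [zj|->]; [apply: (@perm_inj _ (tperm o j)); rewrite zj|]; rewrite tpermL.
move=> [[/zj zE H]|[zE H]|[i ij]].
- by have := zo zE; lia.
- by have /andP[] := zno (contra_not zj.2 zE); lia.
- rewrite emb_siteE orE eq_sym (negbTE ij) mul0rn addr0 addrK.
  by have := sB (tperm o j i); lia.
Qed.

Lemma column_bound K l c : (forall a, a \in l -> off_column K a) ->
  `|\int[mu]_w part c (wilson_loop rho (column j y 0 (K * N) ++ l) w)| <=
  m%:R * (m%:R * (eps + eps)) ^+ K.
Proof.
move=> lK; have rhoU := irreducible_unitary_rep rhoP.
have rX := @mx_regular_path _ _ _ _ _ rhoU _ [set: edge d] l.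
have fX k : (k < K)%N -> slab_fixed o j s y k (rep_path rho l).
  move=> kK e es w x; apply: rep_path_upd; apply/mapP => -[a al].
  exact: off_columnP (lK a al) kK es.
have := slab_bound o0 rhoP s_uniq s_F s_decay mu_gibbs rX fX (rep_path_unitary rhoU l) c.
by congr (`| _ | <= _); apply: eq_Rintegral => w _; rewrite -column_slabs -rep_path_cat.
Qed.

End column.

Lemma rectangle_bound x i j (r t : nat) l k c : i != j -> (B <= r)%N ->
  l = rot k (rectangle_path x i j r t) \/ l = rot k (rectangle_path x j i t r) ->
  `|\int[mu]_w part c (wilson_loop rho l w)| <=
  m%:R * (m%:R * (eps + eps)) ^+ (t %/ N).
Proof.
move=> ij Br; pose K := (t %/ N)%N.
have KN : (K * N <= t)%N by rewrite leq_trunc_div.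
have colE y : column j y 0 t = column j y 0 (K * N) ++ column j y (K * N) (t - K * N).
  by rewrite /column -map_cat -iotaD subnKC.
suff H l' y : (forall w, wilson_loop rho l w = wilson_loop rho (column j y 0 (K * N) ++ l') w) ->
    (forall a, a \in l' -> off_column j y K a) ->
    `|\int[mu]_w part c (wilson_loop rho l w)| <= m%:R * (m%:R * (eps + eps)) ^+ K.
  have stepij h (z : site d) : (z + step i *+ h ) ord0 j = z ord0 j.
    by rewrite mxE mulmxnE stepE (negbTE ij) mul0rn addr0.
  have stepji h (z : site d) : (z + step j *+ h ) ord0 i = z ord0 i.
    by rewrite mxE mulmxnE stepE eq_sym (negbTE ij) mul0rn addr0.
  have stepii h (p : 'I_d) (z : site d) : (z + step p *+ h ) ord0 p = z ord0 p + h%:Z.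
    by rewrite mxE mulmxnE stepE eqxx mulr1n natz.
  case=> lE.
    (* The column is the side traversed upwards: it starts here in this orientation and at [x] in
       the other. The opposite side is at lateral distance [r >= B], and the part of the column
       above the slabs joins the rest of the loop. *)
    pose y := x + step i *+ r.
    apply: (H (column j y (K * N) (t - K * N) ++
      rev [seq ((x + step j *+ t + step i *+ k, i), true) | k <- iota 0 r] ++
      rev [seq ((x + step j *+ k, j), true) | k <- iota 0 t] ++
      [seq ((x + step i *+ k, i), false) | k <- iota 0 r]) y).
      move=> w; rewrite lE wilson_loop_rot /rectangle_path -/(column j y 0 t) colE.
      by rewrite [LHS]wilson_loop_cat -!catA.
    move=> a; rewrite !mem_cat !mem_rev => /or4P[]/mapP[h]; rewrite mem_iota => /andP[h1 h2] ->.
    - by apply: Or31; split=> //=; rewrite stepii; lia.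
    - apply: Or32; rewrite /= !stepij ?stepii; split; last by right; lia.
      by apply/eqP.
    - apply: Or33; exists i => //=; rewrite stepji stepii; lia.
    - apply: Or32; rewrite /= !stepij; split; last by left.
      by apply/eqP.
  apply: (H (column j x (K * N) (t - K * N) ++
    [seq ((x + step j *+ t + step i *+ k, i), false) | k <- iota 0 r] ++
    rev [seq ((x + step i *+ r + step j *+ k, j), true) | k <- iota 0 t] ++
    rev [seq ((x + step i *+ k, i), true) | k <- iota 0 r]) x).
    by move=> w; rewrite lE wilson_loop_rot /rectangle_path -/(column j x 0 t) colE -!catA.
  move=> a; rewrite !mem_cat !mem_rev => /or4P[]/mapP[h]; rewrite mem_iota => /andP[h1 h2] ->.
  - by apply: Or31; split=> //=; rewrite stepii; lia.
  - apply: Or32; rewrite /= stepij ?stepii; split; last by right; lia.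
    by apply/eqP.
  - apply: Or33; exists i => //=; rewrite stepji stepii; lia.
  - apply: Or32; rewrite /= stepij; split; last by left.
    by apply/eqP.
move=> lE l'K; under eq_Rintegral do rewrite lE.
exact: column_bound.
Qed.

End wilson_loops.

(** * From slab bounds to the rate function *)

Section area_law.
Variables (R : realType) (n : nat) (G : gaugeGroup R n) (d N : nat).
Variables (o : 'I_d) (o0 : o = 0%N :> nat).
Variables (haar : probability G R) (beta : R) (m : nat) (rho : G -> 'M[R[i]]_m).
Hypothesis rhoP : irreducible_unitary_representation rho.
Hypothesis N0 : (0 < N)%N.
Hypothesis unbroken : forall delta : set_type (@slab_boundary d N) -> G,
  slab_unbroken_center_symmetry haar beta delta.
Variable g0 : G.
Hypotheses (g0C : central g0) (rho_g0 : rho g0 <> 1%:M).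

Definition decay_rate (r : nat) (v : R) : Prop :=
  forall l t, (1 <= r)%N -> (r <= t)%N -> rectangular_loop l r t ->
  forall mu : probability (config G [set: edge d]) R, gibbs_measure haar beta mu ->
    `|wilson_expectation rho mu l| <= (expR (- v * t%:R))%:C%C.

Lemma wilson_expectation_le (mu : probability (config G [set: edge d]) R) l (M : R) :
  (forall c, `|\int[mu]_w part c (wilson_loop rho l w)| <= M) ->
  `|wilson_expectation rho mu l| <= (M + M)%:C%C.
Proof.
move=> HM; apply: le_trans (norm_le_part _) _; rewrite lecR.
by apply: lerD; [exact: (HM false)|exact: (HM true)].
Qed.

(** With zero slabs, [slab_bound] is the bound [m] on the trace of a unitary matrix, and 2 m <= 1 +
    2 m t <= exp (2 m t). This gives every [r] a rate from which the maximum can start. *)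
Lemma decay_rate0 r : decay_rate r (- (m + m)%:R).
Proof.
move=> l t r1 rt _ mu mu_gibbs.
have [s [s_uniq s_F s_decay]] := slab_decay o0 rhoP N0 unbroken g0C rho_g0 ltr01.
have rhoU := irreducible_unitary_rep rhoP.
have H c : `|\int[mu]_w part c (wilson_loop rho l w)| <= m%:R.
  have := @slab_bound _ _ _ _ _ o o0 o _ _ _ _ rhoP _ _ s_uniq s_F s_decay 0 mu mu_gibbs
    0%N _ (@mx_regular_path _ _ _ _ _ rhoU _ [set: edge d] l) _ (rep_path_unitary rhoU l) c.
  rewrite expr0 mulr1; move=> /(_ (fun k k0 => False_ind _ (notF k0))).
  by congr (`| _ | <= _); apply: eq_Rintegral => w _; rewrite big_nil mul1mx.
apply: le_trans (wilson_expectation_le H) _; rewrite lecR -natrD opprK.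
apply: le_trans (expR_ge1Dx _); rewrite -natrM nat1r ler_nat.
by rewrite leqW// leq_pmulr// (leq_trans r1).
Qed.

Lemma decay_rate_large (A : nat) : exists r0, forall r, (r0 <= r)%N -> decay_rate r A%:R.
Proof.
have m0 : 0 < m%:R :> R by rewrite ltr0n (rep_nonzero rhoP).
(* The factor [2 * N] compensates the passage from [t] to the number of slabs, and the summand
   [m + m] absorbs the prefactor, using [t >= 1]. *)
pose a : R := (2 * N)%:R * (A%:R + (m + m)%:R).
pose eps : R := expR (- a) / (m%:R + m%:R).
have eps0 : 0 < eps by rewrite divr_gt0 ?expR_gt0 ?addr_gt0.
have epsE : m%:R * (eps + eps) = expR (- a) by rewrite /eps; field; rewrite gt_eqF ?addr_gt0.
have [s [s_uniq s_F s_decay]] := slab_decay o0 rhoP N0 unbroken g0C rho_g0 eps0.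
pose B := (\max_(e <- s) \max_(i < d) absz ((\val e).1 ord0 i)).+1.
have s_B e i : e \in s -> `|(\val e).1 ord0 i| < B%:Z.
  move=> es; rewrite -abszE ltz_nat ltnS.
  apply: (@leq_trans (\max_(i < d) absz ((\val e).1 ord0 i))).
    exact: (leq_bigmax (F := fun i : 'I_d => absz ((\val e).1 ord0 i)) i).
  exact: (@leq_bigmax_seq _ s predT (fun e => \max_(i < d) absz ((\val e).1 ord0 i)) e es isT).
(* [B] keeps the opposite side away from the resampled edges; [N] guarantees at least one slab. *)
exists (maxn B N) => r; rewrite geq_max => /andP[Br Nr] l t r1 rt [_ [x [i [j [k [ij lE]]]]]].
move=> mu mu_gibbs; pose K := (t %/ N)%N.
have H c := rectangle_bound o0 rhoP s_uniq s_F s_decay s_B mu_gibbs c ij Br lE.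
apply: le_trans (wilson_expectation_le H) _; rewrite lecR epsE -expRM_natl.
(* t < (K + 1) N <= 2 N K, as [K] is positive. *)
have tK : (t <= 2 * N * K)%N.
  have K1 : (0 < K)%N by rewrite divn_gt0// (leq_trans Nr).
  have := ltn_ceil t N0; rewrite -/K => /ltnW tK; apply: leq_trans tK _.
  by rewrite -mulnA mulnCA mulnC leq_mul2l; lia.
rewrite -mulrDl -natrD; set c := (m + m)%:R.
apply: (@le_trans _ _ (expR c * expR (K%:R * - a))).
  rewrite ler_pM2r ?expR_gt0//; apply: le_trans (expR_ge1Dx _); lra.
rewrite -expRD ler_expR.
have tK' : t%:R <= (2 * N)%:R * K%:R :> R by rewrite -natrM ler_nat.
have t1 : 1 <= t%:R :> R by rewrite ler1n (leq_trans r1).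
have c0 : 0 <= c by rewrite ler0n.
have A0 : 0 <= A%:R :> R by rewrite ler0n.
rewrite /a -/c.
have : t%:R * (A%:R + c) <= (2 * N)%:R * K%:R * (A%:R + c).
  by rewrite ler_pM2r//; rewrite ltr_wpDl// ltr0n addn_gt0 (rep_nonzero rhoP).
have : c <= c * t%:R by rewrite ler_peMr.
lra.
Qed.

Lemma decay_rate_max r u v : decay_rate r u -> decay_rate r v -> decay_rate r (Num.max u v).
Proof. by move=> ru rv; rewrite /Num.max; case: ifP. Qed.

(** Rates are stable under maxima, so all integers [A] valid at [r] can be combined; restricting to
    [A <= r] makes the maximum finite without bounding it as [r] grows. *)
Lemma decay_rate_cvg : exists V : nat -> R, V r @[r --> \oo] --> +oo /\
  forall r, decay_rate r (V r).
Proof.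
have [r0 Hr0] := choice decay_rate_large.
exists (fun r => \big[Num.max/- (m + m)%:R]_(A < r.+1 | (r0 A <= r)%N) A%:R); split.
  apply/cvgryPge => M; pose A := Num.bound `|M|.
  exists (maxn A (r0 A)) => // r /=; rewrite geq_max => /andP[Ar r0r].
  have AM : M <= A%:R by apply: le_trans (ler_norm _) _; rewrite ltW// archi_boundP.
  apply: le_trans AM _.
  pose A' : 'I_r.+1 := Ordinal (Ar : (A < r.+1)%N).
  exact: (@le_bigmax_cond _ _ _ _ A' (fun B : 'I_r.+1 => (r0 B <= r)%N) (fun B : 'I_r.+1 => B%:R)).
move=> r; apply: big_ind => [||A r0r]; [exact: decay_rate0|exact: decay_rate_max|].
exact: Hr0.
Qed.

End area_law.

Theorem theorem2p2 (R : realType) (n d : nat) (hn : (1 <= n)%N) (hd : (2 <= d)%N)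
    (G : gaugeGroup R n) (haar : probability G R) (haarP : is_haar haar)
    (beta : R) (hbeta : 0 < beta)
    (hsym : unbroken_center_symmetry d haar beta)
    (m : nat) (rho : G -> 'M[R[i]]_m)
    (hrho : irreducible_unitary_representation rho)
    (hcenter : exists2 g0 : G, central g0 & rho g0 <> 1%:M) :
  exists V : nat -> R,
    V r @[r --> \oo] --> +oo /\
    forall (l : seq (dedge d)) (r t : nat),
      (1 <= r)%N -> (r <= t)%N -> rectangular_loop l r t ->
      forall mu : probability (config G [set: edge d]) R,
        gibbs_measure haar beta mu ->
        `|wilson_expectation rho mu l| <= (expR (- V r * t%:R))%:C%C.
Proof.
have [N N0 unbroken] := hsym; have [g0 g0C rho_g0] := hcenter.
pose o : 'I_d := Ordinal (ltnW hd).
have [V [Voo HV]] := decay_rate_cvg (erefl : o = 0%N :> nat) hrho N0 unbroken g0C rho_g0.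
by exists V; split=> // l r t; exact: HV.
Qed.
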